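(* Let $\mathcal{D}$ be a separable, unital, strongly self-absorbing and $K_1$-injective $C^*$-algebra. Then $[X,\mathrm{Aut}(\mathcal{D})]$ reduces to a point for any compact Hausdorff space $X$.
   Context: $\mathrm{Aut}(\mathcal{D})$ is the group of $*$-automorphisms of $\mathcal{D}$ with the point-norm topology, and $[X,\mathrm{Aut}(\mathcal{D})]$ is the set of homotopy classes of continuous maps $X\to\mathrm{Aut}(\mathcal{D})$. For a unital $C^*$-algebra $B$, $\mathcal{U}(B)$ is its unitary group and $\mathcal{U}_0(B)$ the connected component of $\mathbf{1}_B$ in $\mathcal{U}(B)$ (norm topology). Two $*$-homomorphisms $\sigma,\gamma:C\to B$ are approximately unitarily equivalent, $\sigma\approx_{\mathrm{u}}\gamma$, if there is a sequence $(u_n)_{n\in\mathbb{N}}$ of unitaries in $B$ with $\|u_n\sigma(c)u_n^*-\gamma(c)\|\to 0$ for every $c\in C$. A separable unital $C^*$-algebra $\mathcal{D}$ is strongly self-absorbing if $\mathcal{D}\neq\mathbb{C}$ and there is an isomorphism $\varphi:\mathcal{D}\to\mathcal{D}\otimes\mathcal{D}$ such that $\varphi\approx_{\mathrm{u}}\mathrm{id}_{\mathcal{D}}\otimes\mathbf{1}_{\mathcal{D}}$, where $\mathrm{id}_{\mathcal{D}}\otimes\mathbf{1}_{\mathcal{D}}$ is the map $d\mapsto d\otimes\mathbf{1}_{\mathcal{D}}$. Strongly self-absorbing $C^*$-algebras are known to be simple and nuclear, so $C^*$-tensor products with $\mathcal{D}$ are unambiguous. A unital $C^*$-algebra $\mathcal{D}$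 is $K_1$-injective if the canonical map $\mathcal{U}(\mathcal{D})/\mathcal{U}_0(\mathcal{D})\to K_1(\mathcal{D})$ is injective. *)

(* Defs.v *)
From HB Require Import structures.
From mathcomp Require Import all_boot all_order all_algebra.
From mathcomp Require Import complex.
From mathcomp Require Import all_classical all_reals all_analysis.

Set Implicit Arguments.
Unset Strict Implicit.
Unset Printing Implicit Defensive.

Import Order.TTheory GRing.Theory Num.Theory.
Import numFieldNormedType.Exports.

Local Open Scope classical_set_scope.
Local Open Scope ring_scope.

HB.mixin Record Algebra_isStar (R : realType) A & GRing.Algebra R[i] A := {
  star : A -> A;
  starK : involutive star;
  star_antilinear : forall (a : R[i]) (x y : A),
    star (a *: x + y) = Num.conj a *: star x + star y;
  starM : forall x y : A, star (x * y) = star y * star x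
}.

#[short(type="starAlgType")]
HB.structure Definition StarAlgebra (R : realType) :=
  {A of GRing.Algebra R[i] A & Algebra_isStar R A}.

(* Unital C*-algebras over the complex numbers [R[i]]; the norm takes its values
   in the nonnegative reals of [R[i]]. Algebra and norm are bundled by hand: a
   common HB subclass of [algType] and [normedModType] is rejected, because
   [numDomainType] already inherits from both a ring and a normed module. *)
Record cstarAlgType (R : realType) := CStarAlgebra {
  cstar_base : completeNormedModType R[i];
  cmul : cstar_base -> cstar_base -> cstar_base;
  cone : cstar_base;
  cstar : cstar_base -> cstar_base;
  cmulA : associative cmul;
  cmul1l : left_id cone cmul;
  cmul1r : right_id cone cmul;
  cmulDl : left_distributive cmul +%R;
  cmulDr : right_distributive cmul +%R;
  cone_neq0 : cone != 0;
  cmulZl : forall (a : R[i]) x y, a *: cmul x y = cmul (a *: x) y;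
  cmulZr : forall (a : R[i]) x y, a *: cmul x y = cmul x (a *: y);
  cstarK : involutive cstar;
  cstar_antilinear : forall (a : R[i]) x y,
    cstar (a *: x + y) = Num.conj a *: cstar x + cstar y;
  cstarM : forall x y, cstar (cmul x y) = cmul (cstar y) (cstar x);
  cnormM : forall x y, `|cmul x y| <= `|x| * `|y|;
  cstar_identity : forall x, `|cmul (cstar x) x| = `|x| ^+ 2
}.

Definition cstar_sort (R : realType) (A : cstarAlgType R) : Type :=
  cstar_base A.
Coercion cstar_sort : cstarAlgType >-> Sortclass.

HB.instance Definition _ (R : realType) (A : cstarAlgType R) :=
  CompleteNormedModule.copy (cstar_sort A) (cstar_base A).
HB.instance Definition _ (R : realType) (A : cstarAlgType R) :=
  GRing.Zmodule_isNzRing.Build (cstar_sort A) (@cmulA R A) (@cmul1l R A)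
    (@cmul1r R A) (@cmulDl R A) (@cmulDr R A) (@cone_neq0 R A).
HB.instance Definition _ (R : realType) (A : cstarAlgType R) :=
  GRing.Lmodule_isLalgebra.Build R[i] (cstar_sort A) (@cmulZl R A).
HB.instance Definition _ (R : realType) (A : cstarAlgType R) :=
  GRing.Lalgebra_isAlgebra.Build R[i] (cstar_sort A) (@cmulZr R A).
HB.instance Definition _ (R : realType) (A : cstarAlgType R) :=
  Algebra_isStar.Build R (cstar_sort A) (@cstarK R A) (@cstar_antilinear R A)
    (@cstarM R A).

Section ComplexNumbers.
Variable R : realType.

Fact conj_antilinear (a : R[i]) (x y : R[i]^o) :
  Num.conj (a *: x + y) = Num.conj a *: (Num.conj x : R[i]^o) + Num.conj y.
Proof. by rewrite rmorphD rmorphM. Qed.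

Fact conj_antimul (x y : R[i]^o) :
  Num.conj (x * y) = Num.conj y * Num.conj x :> R[i]^o.
Proof. by rewrite rmorphM mulrC. Qed.

HB.instance Definition _ := Algebra_isStar.Build R R[i]^o
  (@conjCK R[i]) conj_antilinear conj_antimul.

End ComplexNumbers.

Section StarMorphisms.
Variable R : realType.

Definition star_hom (A B : starAlgType R) (f : A -> B) :=
  [/\ linear f, {morph f : x y / x * y} & {morph f : x / star x}].

Definition star_iso (A B : starAlgType R) (f : A -> B) :=
  star_hom f /\ bijective f.

Definition star_isomorphic (A B : starAlgType R) :=
  exists f : A -> B, star_iso f.

End StarMorphisms.

Section Unitaries.
Variables (R : realType) (B : cstarAlgType R).

Definition unitary : set B := [set u | star u * u = 1 /\ u * star u = 1].

Definition unitary0 : set B := connected_component unitary 1.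

Definition approx_unitary_equiv (C : cstarAlgType R) (s g : C -> B) :=
  exists2 u : nat -> B, (forall n, unitary (u n)) &
    forall c, u n * s c * star (u n) @[n --> \oo] --> g c.

End Unitaries.

Section HilbertSpaces.
Variable R : realType.

Record hilbertSpace := HilbertSpace {
  hilbert_sort :> completeNormedModType R[i];
  inner : {dot hilbert_sort for Num.conj};
  innerE : forall x, inner x x = `|x| ^+ 2
}.

Definition unital_rep (A : cstarAlgType R) (H : hilbertSpace)
    (pi : A -> H -> H) :=
  [/\ forall a, linear (pi a) /\ continuous (pi a),
      forall h, linear (fun a => pi a h),
      forall h, pi 1 h = h,
      forall a b h, pi (a * b) h = pi a (pi b h)
    & forall a h k, inner H (pi a h) k = inner H h (pi (star a) k)].

Definition faithful_rep (A : cstarAlgType R) (H : hilbertSpace)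
    (pi : A -> H -> H) := unital_rep pi /\ injective pi.

Definition elementary_sums (U V : Type) (W : nmodType) (t : U -> V -> W) :
    set W :=
  [set w | exists n (u : 'I_n -> U) (v : 'I_n -> V),
             w = \sum_(i < n) t (u i) (v i)].

Definition hilbert_tensor (H K L : hilbertSpace) (t : H -> K -> L) :=
  [/\ forall k, linear (t^~ k), forall h, linear (t h),
      forall h h' k k',
        inner L (t h k) (t h' k') = inner H h h' * inner K k k'
    & dense (elementary_sums t)].

(* [E], with elementary tensors [a (x) b := tau a b], is the minimal (spatial)
   tensor product of [A] and [B]: for some faithful representations of [A] on
   [H] and of [B] on [K], it is the closed linear span of the operators
   [pi a (x) rho b] on the Hilbert space [L = H (x) K]. Bilinearity and
   multiplicativity of [tau] follow, since [Pi] is injective. By a classical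
   theorem, [(E, tau)] does not depend on the representations up to a
   *-isomorphism preserving elementary tensors. *)
Definition spatial_tensor (A B E : cstarAlgType R) (tau : A -> B -> E) :=
  dense (elementary_sums tau) /\
  exists (H K L : hilbertSpace) (t : H -> K -> L)
         (pi : A -> H -> H) (rho : B -> K -> K) (Pi : E -> L -> L),
    [/\ hilbert_tensor t, faithful_rep pi, faithful_rep rho, faithful_rep Pi
      & forall a b h k, Pi (tau a b) (t h k) = t (pi a h) (rho b k)].

End HilbertSpaces.

Definition separable (T : topologicalType) :=
  exists2 S : set T, countable S & dense S.

Definition strongly_self_absorbing (R : realType) (D : cstarAlgType R) :=
  [/\ separable D,
      ~ star_isomorphic (R[i]^o : starAlgType R) D
    & exists (E : cstarAlgType R) (tau : D -> D -> E),
        spatial_tensor tau /\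
        exists2 phi : D -> E, star_iso phi &
          approx_unitary_equiv phi (fun d => tau d 1)].

Section K1.
Variables (R : realType) (D : cstarAlgType R).

(* 'M[D]_n carries the entrywise topology, which is the one given by the
   C*-norm of M_n(D). *)
Definition adjmx n (u : 'M[D]_n) : 'M[D]_n := map_mx star u^T.

Definition unitary_mx n : set 'M[D]_n :=
  [set u | adjmx u *m u = 1%:M /\ u *m adjmx u = 1%:M].

Definition stabilize n (u : 'M[D]_n) p : 'M[D]_(n + p) :=
  block_mx u 0 0 1%:M.

(* Equality in the inductive limit of the groups U(M_n(D)) / U_0(M_n(D)). *)
Definition K1_eq m (u : 'M[D]_m) n (v : 'M[D]_n) :=
  exists p q (e : (m + p = n + q)%N),
    connected_component (@unitary_mx (n + q))
      (stabilize v q) (castmx (e, e) (stabilize u p)).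

Definition K1_class m (u : 'M[D]_m) : set {n : nat & 'M[D]_n} :=
  [set w | unitary_mx (projT2 w) /\ K1_eq u (projT2 w)].

Definition K1 : set (set {n : nat & 'M[D]_n}) :=
  [set c | exists m (u : 'M[D]_m), unitary_mx u /\ c = K1_class u].

Definition unitary_coset (u : D) : set D := [set u * w | w in @unitary0 R D].

Definition unitary_quotient : set (set D) :=
  [set unitary_coset u | u in @unitary R D].

(* The canonical map from [unitary_quotient] to [K1]: all the elements of a
   coset have the same K1-class, which is thus the union below. *)
Definition K1_map (c : set D) : set {n : nat & 'M[D]_n} :=
  \bigcup_(u in c) K1_class (u%:M : 'M[D]_1).

Definition K1_injective := set_inj unitary_quotient K1_map.

End K1.

Section Homotopy.
Variables (R : realType) (X Y : topologicalType).

Definition homotopic (f g : continuousType X Y) :=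
  exists H : R * X -> Y,
    [/\ {within `[0, 1]%classic `*` [set: X], continuous H},
        forall x, H (0, x) = f x & forall x, H (1, x) = g x].

Definition homotopy_classes : set (set (continuousType X Y)) :=
  range (fun f => [set g | homotopic f g]).

End Homotopy.

Arguments homotopy_classes : clear implicits.

Section Automorphisms.
Variables (R : realType) (D : cstarAlgType R).

Definition star_automorphism : set {ptws D -> D} :=
  [set f | star_iso (f : D -> D)].

(* The point-norm topology: [set_type] carries the topology induced by that of
   pointwise convergence on functions [D -> D]. *)
Definition Aut : topologicalType := set_type star_automorphism.

End Automorphisms.

(* Main.v *)
(** Write [al(d) = d (x) 1] and [be(d) = 1 (x) d], read in [D] through
    [D ~ D (x) D]. If unitaries [w_t] of [D], [0 < t < 1], satisfy
    [w_t d w_t^* -> al(d)] as [t -> 0] and [-> be(d)] as [t -> 1], then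
    [Ad(w_t^* ) o (f (x) g) o Ad(w_t)] is a homotopy from [f] to [g], for any two
    continuous maps [f, g : X -> Aut(D)].

    To get [w_t]: [al] is approximately inner by hypothesis, and then so is [be],
    by permuting the factors of [D (x) D (x) D]. If [w] implements [al]
    approximately, so does [be(w)^* w], which has trivial class in K1 and thus
    lies in the identity component. Consecutive approximating unitaries differ
    by a [u] in the identity component which almost commutes with a large finite
    set; [u (x) 1] is then close to its conjugate by an approximate half-flip
    [w], and the conjugate by [w] of a path from [1] to [u] in the first factor
    almost commutes with the prescribed elements of the first factor.

    The flip of [D (x) D] and the automorphisms [f (x) g] exist because the
    spatial norm does not depend on the faithful representations: by Schur
    complements, the positivity of an operator matrix with entries in [A] is the
    same in all of them. *)

From HB Require Import structures.
Require Import Defs.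
From mathcomp Require Import all_boot all_order all_algebra.
From mathcomp Require Import complex.
From mathcomp Require Import all_classical all_reals all_analysis.
From mathcomp Require Import ring lra.
Set Implicit Arguments.
Unset Strict Implicit.
Unset Printing Implicit Defensive.
Import Order.TTheory GRing.Theory Num.Theory.
Import numFieldNormedType.Exports.
Local Open Scope classical_set_scope.
Local Open Scope ring_scope.

(** * Real-valued norms *)

(** There is no spectral theory behind the estimates. Positivity of an element means that it is the
    square of a self-adjoint one, and a bound [nm a <= c] is read off an identity [a^2 + b^2 = c^2]
    between commuting self-adjoint elements; such identities survive homomorphisms and
    representations. All square roots in the algebra come from one iteration for
    [(1 - z)^2 = 1 - T].

    The class of [star (be w) * w] is trivial because [be w] is close to some [v * w * star v]: the
    product is then close to a group commutator, which a rotation in 2x2 matrices kills in K1.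

    K1-injectivity only puts a unitary into a connected component, and approximate equivalences
    control finitely many elements at a time. Hence finite chains of unitaries with small steps take
    the place of paths: connectedness yields them directly, and translations, conjugations and one
    extra small jump turn chains into chains. Only at the end are consecutive points joined by
    explicit arcs of speed at most 1, over one half-line for [al] and one for [be]; the two are
    joined at [1] and squeezed onto an interval. *)

Section RealNorm.
Context {R : realType}.

(** The norm lives in [R[i]], which is only partially ordered; its real part gives access to a total
    order and to [lra]. *)
Definition nm {V : normedModType R[i]} (x : V) : R := complex.Re `|x|.

Lemma ReC_ge0 (z : R[i]) : 0 <= z -> z = (complex.Re z)%:C%C.
Proof. by case: z => a b; rewrite lecE /= => /andP[/eqP -> _]. Qed.

Section Mod.
Variable V : normedModType R[i].
Implicit Types x y z : V.

Lemma nmE x : `|x| = (nm x)%:C%C. Proof. exact: ReC_ge0. Qed.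

Lemma nm_ge0 x : 0 <= nm x.
Proof. by rewrite -lecR -nmE; exact: normr_ge0. Qed.

Lemma nm0 : nm (0 : V) = 0. Proof. by rewrite /nm normr0. Qed.

Lemma nm0_eq0 x : nm x = 0 -> x = 0.
Proof. by move=> x0; apply: normr0_eq0; rewrite nmE x0. Qed.

Lemma nmD x y : nm (x + y) <= nm x + nm y.
Proof. by rewrite -lecR rmorphD /= -!nmE ler_normD. Qed.

Lemma nmN x : nm (- x) = nm x. Proof. by rewrite /nm normrN. Qed.

Lemma nm_sub x y : nm (x - y) = nm (y - x).
Proof. by rewrite -nmN opprB. Qed.

Lemma nmB x y : nm (x - y) <= nm x + nm y.
Proof. by apply: le_trans (nmD _ _) _; rewrite nmN. Qed.

Lemma nm_tri y x z : nm (x - z) <= nm (x - y) + nm (y - z).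
Proof. by rewrite -[X in nm X <= _](subrKA y); exact: nmD. Qed.

Lemma nmZ (a : R[i]) x : nm (a *: x) = complex.Re `|a| * nm x.
Proof.
apply: complexI; rewrite -nmE normrZ rmorphM /= -nmE; congr (_ * _).
Qed.

Lemma nmZr (r : R) x : nm (r%:C%C *: x) = `|r| * nm x.
Proof. by rewrite nmZ normc_def /= expr0n addr0 sqrtr_sqr. Qed.

Lemma nm_sum I (r : seq I) (P : pred I) (F : I -> V) :
  nm (\sum_(i <- r | P i) F i) <= \sum_(i <- r | P i) nm (F i).
Proof.
elim/big_ind2: _ => //; first by rewrite nm0.
by move=> x a y b xa yb; rewrite (le_trans (nmD _ _))// lerD.
Qed.

Lemma nm_le_eq0 x : (forall e : R, 0 < e -> nm x <= e) -> x = 0.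
Proof.
move=> h; apply: nm0_eq0; apply/eqP; rewrite eq_le nm_ge0 andbT.
by apply/ler_addgt0Pl => e e0; rewrite addr0 h.
Qed.

Lemma nbhs_nmP x (A : set V) :
  nbhs x A <-> exists2 e : R, 0 < e & forall y, nm (x - y) < e -> A y.
Proof.
split.
  move=> /nbhs_ballP[e /= e0 eA]; have eE := ReC_ge0 (ltW e0).
  exists (complex.Re e); first by rewrite -ltcR -eE.
  by move=> y xy; apply: eA; rewrite -ball_normE /= nmE eE ltcR.
move=> [e e0 eA]; apply/nbhs_ballP; exists e%:C%C; first by rewrite /= ltcR.
by move=> y; rewrite -ball_normE /= nmE ltcR => /eA.
Qed.

Lemma cvg_nmP (T : Type) (F : set_system T) {FF : Filter F} (f : T -> V) x :
  f t @[t --> F] --> x <->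
  forall e : R, 0 < e -> \forall t \near F, nm (x - f t) < e.
Proof.
split=> [fx e e0|fx A /nbhs_nmP[e e0 eA]].
  have /fx : nbhs x [set y | nm (x - y) < e] by apply/nbhs_nmP; exists e.
  by [].
by have := fx e e0; apply: filterS => t /eA.
Qed.

Lemma continuous_nmP (T : topologicalType) (f : T -> V) t :
  {for t, continuous f} <->
  forall e : R, 0 < e -> \forall s \near t, nm (f t - f s) < e.
Proof. exact: cvg_nmP. Qed.

Lemma dense_nmP (S : set V) : dense S <->
  forall x (e : R), 0 < e -> exists2 y, S y & nm (x - y) < e.
Proof.
split=> [dS x e e0|dS O [x Ox] oO].
  have xU : nbhs x [set y | nm (x - y) < e] by apply/nbhs_nmP; exists e.
  have [|y [/interior_subset xy Sy]] := dS _ _ (@open_interior _ [set y | nm (x - y) < e]).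
    by exists x.
  by exists y.
have /nbhs_nmP[e e0 eO] : nbhs x O by exact: open_nbhs_nbhs.
by have [y Sy xy] := dS x e e0; exists y; split; [exact: eO|].
Qed.

End Mod.

(** Majorant method: distances along [u] are at most the differences of the bounded nondecreasing
    [t], so [u] is Cauchy. It serves the square root, the Neumann series and extension by
    density. *)
Lemma cvg_majorant (V : completeNormedModType R[i]) (u : nat -> V)
    (t : nat -> R) (M : R) :
  (forall n, nm (u n.+1 - u n) <= t n.+1 - t n) -> (forall n, t n <= M) ->
  exists l : V, u n @[n --> \oo] --> l.
Proof.
move=> ut tM.
have uts n k : nm (u (n + k)%N - u n) <= t (n + k)%N - t n.
  elim: k => [|k IH]; first by rewrite addn0 !subrr nm0.
  rewrite addnS; apply: le_trans (nm_tri (u (n + k)%N) _ _) _.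
  by have := ut (n + k)%N; lra.
have tnd : nondecreasing_seq t.
  by apply/nondecreasing_seqP => n; rewrite -subr_ge0 (le_trans (nm_ge0 _) (ut n)).
have tc : cvgn t.
  apply: nondecreasing_is_cvgn => //; exists M => _ [n _ <-]; exact: tM.
suff : cauchy (u n @[n --> \oo]) by move=> /cauchy_cvg h; exists (lim (u n @[n --> \oo])).
apply/cauchy_ballP => e /=; move=> e0; have eE := ReC_ge0 (ltW e0).
have re0 : 0 < complex.Re e by rewrite -ltcR -eE.
have e20 : 0 < complex.Re e / 2 by rewrite divr_gt0.
near \oo => N.
have tN k : t (N + k)%N - t N < complex.Re e / 2.
  have : t (N + k)%N <= limn t by apply: nondecreasing_cvgn_le.
  have : limn t - t N < complex.Re e / 2.
    rewrite (le_lt_trans (ler_norm _))//; near: N.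
    by move/cvgrPdist_lt: tc; apply.
  lra.
exists ([set u (N + k)%N | k in setT], [set u (N + k)%N | k in setT]) => /=.
  split; (exists N => // n /= Nn; exists (n - N)%N => //; by rewrite subnKC).
move=> [_ _] /= [[k _ <-] [l _ <-]].
rewrite -ball_normE /= nmE eE ltcR (le_lt_trans (nm_tri (u N) _ _))//.
rewrite [nm (u N - _)]nm_sub.
have := uts N k; have := uts N l; have := tN k; have := tN l; lra.
Unshelve. all: by end_near. Qed.

End RealNorm.

(** * Square roots and self-adjoint elements *)

Section CStar.
Context {R : realType} {A : cstarAlgType R}.
Implicit Types x y z : A.

(* The norm lemmas restated at [A], so that the ring operations are those
   inferred from [cstar_sort] and not from the normed module. *)
Lemma cnm0 : nm (0 : A) = 0. Proof. exact: nm0. Qed.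
Lemma cnmN x : nm (- x) = nm x. Proof. exact: nmN. Qed.
Lemma cnmD x y : nm (x + y) <= nm x + nm y. Proof. exact: nmD. Qed.
Lemma cnmB x y : nm (x - y) <= nm x + nm y. Proof. exact: nmB. Qed.
Lemma cnm_sub x y : nm (x - y) = nm (y - x). Proof. exact: nm_sub. Qed.
Lemma cnm_tri y x z : nm (x - z) <= nm (x - y) + nm (y - z).
Proof. exact: nm_tri. Qed.
Lemma cnmZr (r : R) x : nm (r%:C%C *: x) = `|r| * nm x.
Proof. exact: nmZr. Qed.
Lemma cnm_sum I (r : seq I) (P : pred I) (F : I -> A) :
  nm (\sum_(i <- r | P i) F i) <= \sum_(i <- r | P i) nm (F i).
Proof. exact: nm_sum. Qed.
Lemma cnm0_eq0 x : nm x = 0 -> x = 0. Proof. exact: nm0_eq0. Qed.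
Lemma ccvg_nmP (T : Type) (F : set_system T) {FF : Filter F} (f : T -> A) x :
  f t @[t --> F] --> x <->
  forall e : R, 0 < e -> \forall t \near F, nm (x - f t) < e.
Proof. exact: cvg_nmP. Qed.
Lemma ccontinuous_nmP (T : topologicalType) (f : T -> A) t :
  {for t, continuous f} <->
  forall e : R, 0 < e -> \forall s \near t, nm (f t - f s) < e.
Proof. exact: continuous_nmP. Qed.
Lemma cdense_nmP (S : set A) : dense S <->
  forall x (e : R), 0 < e -> exists2 y, S y & nm (x - y) < e.
Proof. exact: dense_nmP. Qed.
Lemma ccvg_majorant (u : nat -> A) (t : nat -> R) (M : R) :
  (forall n, nm (u n.+1 - u n) <= t n.+1 - t n) -> (forall n, t n <= M) ->
  exists l : A, u n @[n --> \oo] --> l.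
Proof. exact: cvg_majorant. Qed.

Lemma nmM x y : nm (x * y) <= nm x * nm y.
Proof. by rewrite -lecR rmorphM /= -!nmE; exact: cnormM. Qed.

Lemma nm_starM x : nm (star x * x) = nm x ^+ 2.
Proof.
by apply: complexI; rewrite rmorphXn /= -!nmE; exact: (cstar_identity x).
Qed.

Lemma starD x y : star (x + y) = star x + star y.
Proof. by have := star_antilinear 1 x y; rewrite conjC1 !scale1r. Qed.

Lemma star0 : star 0 = 0 :> A.
Proof. by apply: (addrI (star 0)); rewrite -starD !addr0. Qed.

Lemma starZ (a : R[i]) x : star (a *: x) = Num.conj a *: star x.
Proof. by have := star_antilinear a x 0; rewrite star0 !addr0. Qed.

Lemma starZr (r : R) x : star (r%:C%C *: x) = r%:C%C *: star x.
Proof. by rewrite starZ; congr (_ *: _); exact: conjc_real. Qed.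

Lemma starN x : star (- x) = - star x.
Proof. by apply: (addrI (star x)); rewrite -starD !subrr star0. Qed.

Lemma starB x y : star (x - y) = star x - star y.
Proof. by rewrite starD starN. Qed.

Lemma star1 : star 1 = 1 :> A.
Proof. by have := starM (star 1) (1 : A); rewrite mulr1 starK mulr1 => <-. Qed.

Lemma star_sum I (r : seq I) (P : pred I) (F : I -> A) :
  star (\sum_(i <- r | P i) F i) = \sum_(i <- r | P i) star (F i).
Proof. exact: (big_morph _ starD star0). Qed.

Lemma nm_star x : nm (star x) = nm x.
Proof.
have le y : nm y <= nm (star y).
  have [->|y0] := eqVneq y 0; first by rewrite star0.
  have ypos : 0 < nm y.
    by rewrite lt_neqAle nm_ge0 andbT eq_sym; apply/eqP => /cnm0_eq0/eqP; apply/negP.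
  by rewrite -(ler_pM2r ypos) -expr2 -nm_starM nmM.
by apply/eqP; rewrite eq_le le andbT -{2}(starK x) le.
Qed.

Lemma nm1 : nm (1 : A) = 1.
Proof.
have := nm_starM 1; rewrite star1 mul1r expr2 => h.
have n0 : nm (1 : A) != 0 by apply/eqP => /cnm0_eq0/eqP; rewrite oner_eq0.
by apply: (mulfI n0); rewrite mulr1.
Qed.

Lemma nm_unitary x : unitary x -> nm x = 1.
Proof.
move=> [xx _]; have := nm_starM x; rewrite xx nm1 => /esym/eqP.
by rewrite sqrf_eq1 => /orP[] /eqP // h; have := nm_ge0 x; rewrite h; lra.
Qed.

Lemma unitary1 : unitary (1 : A).
Proof. by split; rewrite star1 mulr1. Qed.

Lemma unitaryM x y : unitary x -> unitary y -> unitary (x * y).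
Proof.
move=> [x1 x2] [y1 y2]; split; rewrite starM.
  by rewrite mulrA -(mulrA (star y)) x1 mulr1.
by rewrite mulrA -(mulrA x) y2 mulr1.
Qed.

Lemma unitary_star x : unitary x -> unitary (star x).
Proof. by move=> [x1 x2]; split; rewrite starK. Qed.

Lemma nm_unitaryl x y : unitary x -> nm (x * y) = nm y.
Proof.
move=> xu; apply/eqP; rewrite eq_le; apply/andP; split.
  by apply: le_trans (nmM _ _) _; rewrite (nm_unitary xu) mul1r.
rewrite -[y in leLHS]mul1r -(proj1 xu) -mulrA; apply: le_trans (nmM _ _) _.
by rewrite (nm_unitary (unitary_star xu)) mul1r.
Qed.

Lemma nm_unitaryr x y : unitary x -> nm (y * x) = nm y.
Proof.
by move=> xu; rewrite -nm_star starM (nm_unitaryl _ (unitary_star xu)) nm_star.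
Qed.

Lemma cvg_mul (T : Type) (F : set_system T) {FF : Filter F} (f g : T -> A) x y :
  f t @[t --> F] --> x -> g t @[t --> F] --> y -> f t * g t @[t --> F] --> x * y.
Proof.
move=> /ccvg_nmP fx /ccvg_nmP gy; apply/ccvg_nmP => e e0.
pose M := nm x + nm y + 1; have M0 : 0 < M by have := nm_ge0 x; have := nm_ge0 y; rewrite /M; lra.
have d0 : 0 < Num.min 1 (e / (2 * M)) by rewrite lt_min ltr01 divr_gt0 ?mulr_gt0.
apply: filterS (filterI (fx _ d0) (gy _ d0)) => t [] /=.
rewrite !lt_min => /andP[f1 fe] /andP[g1 ge].
have -> : x * y - f t * g t = (x - f t) * g t + x * (y - g t).
  by rewrite mulrBl mulrBr [RHS]addrC subrKA.
apply: le_lt_trans (cnmD _ _) _.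
have gM : nm (g t) <= M.
  have := cnmB y (y - g t); rewrite subKr; have := nm_ge0 x; rewrite /M; lra.
have xM : nm x <= M by have := nm_ge0 y; rewrite /M; lra.
have h1 : nm ((x - f t) * g t) <= nm (x - f t) * M.
  by apply: le_trans (nmM _ _) _; rewrite ler_wpM2l // nm_ge0.
have h2 : nm (x * (y - g t)) <= nm (y - g t) * M.
  by apply: le_trans (nmM _ _) _; rewrite mulrC ler_wpM2l // nm_ge0.
have : e = e / (2 * M) * M + e / (2 * M) * M by field; lra.
have : nm (x - f t) * M < e / (2 * M) * M by rewrite ltr_pM2r.
have : nm (y - g t) * M < e / (2 * M) * M by rewrite ltr_pM2r.
lra.
Qed.

Lemma cvg_star (T : Type) (F : set_system T) {FF : Filter F} (f : T -> A) x :
  f t @[t --> F] --> x -> star (f t) @[t --> F] --> star x.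
Proof.
move=> /ccvg_nmP fx; apply/ccvg_nmP => e /fx; apply: filterS => t.
by rewrite -starB nm_star.
Qed.

Lemma cvg_nm_le (u : nat -> A) x (s : R) :
  u n @[n --> \oo] --> x -> (forall n, nm (u n) <= s) -> nm x <= s.
Proof.
move=> /ccvg_nmP ux us; apply/ler_addgt0Pl => e /ux[N _ /(_ N (leqnn N)) h].
have := cnmD (x - u N) (u N); rewrite subrK; have := us N; lra.
Qed.

Lemma cvg_eq (u : nat -> A) x y :
  u n @[n --> \oo] --> x -> u n @[n --> \oo] --> y -> x = y.
Proof. by move=> ux uy; apply: cvg_unique ux uy. Qed.

Lemma halfC : 2^-1 = (2^-1)%:C%C :> R[i].
Proof. by rewrite fmorphV rmorph_nat. Qed.

Lemma nm_half x : nm (2^-1 *: x) = 2^-1 * nm x.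
Proof. by rewrite halfC cnmZr ger0_norm. Qed.

Section Sqrt.
Variable T : A.

(** Iteration for the fixed point [z = (T + z^2) / 2], that is [(1 - z)^2 = 1 - T]. Its terms are
    polynomials in [T], so the limit commutes with all that commutes with [T]. *)
Fixpoint sqrt_seq n : A :=
  if n is n.+1 then 2^-1 *: (T + sqrt_seq n * sqrt_seq n) else 0.

(** The same iteration for the scalar [T = 1], which stays in [[0, 1]] and is the majorant. *)
Fixpoint sqrt_maj n : R :=
  if n is n.+1 then 2^-1 * (1 + sqrt_maj n ^+ 2) else 0.

Hypothesis T1 : nm T <= 1.

Lemma sqrt_maj01 n : 0 <= sqrt_maj n <= 1.
Proof. by elim: n => [|n IH] /=; nra. Qed.

Lemma nm_sqrt_seq n : nm (sqrt_seq n) <= sqrt_maj n.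
Proof.
elim: n => [|n IH] /=; first by rewrite cnm0.
rewrite nm_half; have := cnmD T (sqrt_seq n * sqrt_seq n).
have := nmM (sqrt_seq n) (sqrt_seq n).
have : nm (sqrt_seq n) * nm (sqrt_seq n) <= sqrt_maj n ^+ 2.
  by rewrite expr2 ler_pM ?nm_ge0.
have := T1; lra.
Qed.

Lemma nm_sqrt_seqB n :
  nm (sqrt_seq n.+1 - sqrt_seq n) <= sqrt_maj n.+1 - sqrt_maj n.
Proof.
elim: n => [|n IH].
  by rewrite /= !subr0 mulr0 addr0 expr0n /= addr0 nm_half; have := T1; lra.
set u := sqrt_seq n.+1 in IH *; set v := sqrt_seq n in IH *.
(* This form of [u^2 - v^2] needs no commutation of [u] and [v]. *)
have -> : sqrt_seq n.+2 - u = 2^-1 *: (u * (u - v) + (u - v) * v).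
  rewrite /u [sqrt_seq n.+2]/= -/u [X in _ - X]/= -/v -scalerBr; congr (_ *: _).
  by rewrite mulrBl mulrBr subrKA opprD addrACA subrr add0r.
rewrite nm_half.
have ut := nm_sqrt_seq n.+1; have vt := nm_sqrt_seq n; rewrite -/u -/v in ut vt.
have h1 := nmM u (u - v); have h2 := nmM (u - v) v; have h3 := cnmD (u * (u - v)) ((u - v) * v).
have u0 := nm_ge0 u; have v0 := nm_ge0 v; have w0 := nm_ge0 (u - v).
have -> : sqrt_maj n.+2 - sqrt_maj n.+1 =
  2^-1 * ((sqrt_maj n.+1 - sqrt_maj n) * (sqrt_maj n.+1 + sqrt_maj n)).
  have E : sqrt_maj n.+1 = 2^-1 * (1 + sqrt_maj n ^+ 2) by [].
  have -> : sqrt_maj n.+2 = 2^-1 * (1 + sqrt_maj n.+1 ^+ 2) by [].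
  by move: (sqrt_maj n.+1) (sqrt_maj n) E => b a E; lra.
have : nm (u - v) * (nm u + nm v) <=
    (sqrt_maj n.+1 - sqrt_maj n) * (sqrt_maj n.+1 + sqrt_maj n).
  by apply: ler_pM => //; [rewrite addr_ge0|exact: lerD].
lra.
Qed.

(** In the last clause the ball of radius [s] is stable under the iteration, as
    [(nm T + s^2) / 2 <= s]. It is used with [s = 1] and [s = nm T]. *)
Lemma sqrt_exists : exists z : A,
  [/\ (1 - z) * (1 - z) = 1 - T, star T = T -> star z = z,
      forall x, x * T = T * x -> x * z = z * x
    & forall s, 0 <= s -> nm T <= 2 * s - s ^+ 2 -> nm z <= s].
Proof.
have [z zc] := ccvg_majorant nm_sqrt_seqB (fun n => proj2 (andP (sqrt_maj01 n))).
have zE : z = 2^-1 *: (T + z * z).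
  apply: (@cvg_eq (fun n => sqrt_seq n.+1)).
    by move: zc; rewrite -(cvg_shiftS sqrt_seq).
  by apply: cvgZr; apply: cvgD; [exact: cvg_cst|exact: cvg_mul].
exists z; split.
- have zz : z + z = T + z * z.
    rewrite [in X in X + _]zE [in X in _ + X = _]zE -scalerDl.
    by rewrite -[2^-1]mul1r -splitr scale1r.
  have -> : T = z + z - z * z by rewrite zz addrK.
  by rewrite mulrBl mul1r mulrBr mulr1 -[LHS]addrA -opprD addrA.
- move=> Ts; apply: (cvg_eq _ zc).
  suff : forall n, star (sqrt_seq n) = sqrt_seq n.
    move=> /funext h.
    have : star (sqrt_seq n) @[n --> \oo] --> star z by exact: cvg_star.
    by rewrite h.
  elim=> [|n IH] /=; first by rewrite star0.
  by rewrite halfC starZr starD starM IH Ts.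
- move=> x xT; apply: (@cvg_eq (fun n => x * sqrt_seq n)).
    by apply: cvg_mul => //; exact: cvg_cst.
  suff h n : x * sqrt_seq n = sqrt_seq n * x.
    by rewrite (funext h); apply: cvg_mul => //; exact: cvg_cst.
  elim: n => [|n IH] /=; first by rewrite mul0r mulr0.
  by rewrite -scalerAr -scalerAl mulrDr mulrDl xT mulrA IH -mulrA IH mulrA.
- move=> s s0 Ts; apply: (cvg_nm_le zc); elim=> [|n IH] /=; first by rewrite cnm0.
  rewrite nm_half; have := cnmD T (sqrt_seq n * sqrt_seq n).
  have := nmM (sqrt_seq n) (sqrt_seq n).
  have : nm (sqrt_seq n) * nm (sqrt_seq n) <= s ^+ 2.
    by rewrite expr2 ler_pM ?nm_ge0.
  lra.
Qed.
End Sqrt.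

End CStar.

Section SelfAdjoint.
Context {R : realType} {A : cstarAlgType R}.
Implicit Types a b q x z : A.

Lemma star_i x : star ('i *: x) = - ('i *: star x).
Proof. by rewrite starZ conjCi scaleNr. Qed.

Lemma half_dbl x : 2^-1 *: (x + x) = x.
Proof. by rewrite scalerDr -scalerDl -[2^-1]mul1r -splitr scale1r. Qed.

Lemma sa_cartesian a b : star a = a -> star b = b -> a * b = b * a ->
  star (a + 'i *: b) * (a + 'i *: b) = a * a + b * b.
Proof.
move=> sa sb ab; rewrite starD star_i sa sb mulrDr !mulrDl !mulNr.
rewrite -!scalerAl -!scalerAr scalerA -['i * 'i]expr2 sqrCi scaleN1r opprK.
by rewrite ab addrA addrNK.
Qed.

Lemma sa_unitary a b : star a = a -> star b = b -> a * b = b * a ->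
  a * a + b * b = 1 -> unitary (a + 'i *: b).
Proof.
move=> sa sb ab sq; split; first by rewrite sa_cartesian.
have := @sa_cartesian a (- b) sa; rewrite starN sb mulrN mulNr mulrNN ab sq.
have -> : a + 'i *: - b = star (a + 'i *: b).
  by rewrite starD star_i sa sb scalerN.
by rewrite starK; apply.
Qed.

(** By the C*-identity [a + i b] has norm [c], and [a] is its real part. This stands for the
    implication from [a^2 <= c^2] to [nm a <= c]. *)
Lemma sa_nm_le a b (c : R) : star a = a -> star b = b -> a * b = b * a ->
  0 <= c -> a * a + b * b = (c ^+ 2)%:C%C *: 1 -> nm a <= c.
Proof.
move=> sa sb ab c0 sq; have aE : a = 2^-1 *: ((a + 'i *: b) + star (a + 'i *: b)).
  by rewrite starD star_i sa sb addrACA subrr addr0 half_dbl.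
rewrite aE nm_half; have := cnmD (a + 'i *: b) (star (a + 'i *: b)).
suff : nm (a + 'i *: b) <= c by rewrite nm_star; lra.
rewrite -(ler_pXn2r (ltn0Sn 1)) ?nnegrE ?nm_ge0 // -nm_starM sa_cartesian // sq.
by rewrite cnmZr nm1 mulr1 ger0_norm ?sqr_ge0.
Qed.

Lemma sa_nm_le1 a b : star a = a -> star b = b -> a * b = b * a ->
  a * a + b * b = 1 -> nm a <= 1.
Proof.
move=> sa sb ab sq; apply: (sa_nm_le sa sb ab ler01).
by rewrite sq expr1n scale1r.
Qed.

(** The sine [b = sqrt (1 - a^2)] of the cosine [a]. *)
Lemma sa_sqrt_compl a : star a = a -> nm a <= 1 -> exists b,
  [/\ star b = b, a * a + b * b = 1, forall x, x * a = a * x -> x * b = b * x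
    & nm b <= 1].
Proof.
move=> sa a1.
have aa1 : nm (a * a) <= 1.
  by apply: le_trans (nmM _ _) _; have := nm_ge0 a; nra.
have [z [z2 zs zc _]] := sqrt_exists aa1.
have bs : star (1 - z) = 1 - z by rewrite starB star1 zs // starM sa.
have comm x : x * a = a * x -> x * (1 - z) = (1 - z) * x.
  move=> xa; rewrite mulrBl mulrBr mul1r mulr1 zc //.
  by rewrite mulrA xa -mulrA xa mulrA.
exists (1 - z); split => //; first by rewrite z2 addrC subrK.
apply: (@sa_nm_le1 _ a) => //; first by rewrite comm.
by rewrite z2 subrK.
Qed.

Lemma sa_pos_sqrt a : star a = a -> nm (1 - a) <= 1 -> exists q,
  [/\ star q = q, q * q = a & forall x, x * a = a * x -> x * q = q * x].
Proof.
move=> sa a1; have [z [z2 zs zc _]] := sqrt_exists a1.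
exists (1 - z); split; first by rewrite starB star1 zs // starB star1 sa.
  by rewrite z2 subKr.
move=> x xa; rewrite mulrBl mulrBr mul1r mulr1 zc //.
by rewrite mulrBl mulrBr mul1r mulr1 xa.
Qed.

(** Here [q^2] is [|a|], obtained as [sqrt (1 - b^2)] with [b = sqrt (1 - a^2)]. That root is
    [1 - z] with [nm z <= 1], so it has in turn a root [q], which witnesses that [|a|] is
    positive. *)
Lemma sa_abs a : star a = a -> nm a <= 1 -> exists q,
  [/\ star q = q, (q * q) * (q * q) = a * a
    & forall x, x * a = a * x -> x * q = q * x].
Proof.
move=> sa a1; have [b [bs ab bc b1]] := sa_sqrt_compl sa a1.
have bb1 : nm (b * b) <= 1.
  by apply: le_trans (nmM _ _) _; have := nm_ge0 b; nra.
have [z [z2 zs zc znm]] := sqrt_exists bb1.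
have z1 : nm z <= 1 by apply: znm => //; rewrite expr1n; lra.
have ps : star (1 - z) = 1 - z by rewrite starB star1 zs // starM bs.
have [|q [qs qq qc]] := @sa_pos_sqrt (1 - z) ps; first by rewrite subKr.
exists q; split => //; first by rewrite qq z2 -ab addrK.
move=> x xa; apply: qc; rewrite mulrBl mulrBr mul1r mulr1 zc //.
by rewrite mulrA (bc _ xa) -mulrA (bc _ xa) mulrA.
Qed.

Lemma sa_sq0 a : star a = a -> a * a = 0 -> a = 0.
Proof.
move=> sa aa; apply: cnm0_eq0; have := nm_starM a; rewrite sa aa cnm0.
by move=> /esym/eqP; rewrite sqrf_eq0 => /eqP.
Qed.

End SelfAdjoint.

(** * Homomorphisms of C*-algebras *)

Section StarHom.
Context {R : realType} {A B : cstarAlgType R}.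
Variable f : A -> B.

Definition unital_hom := star_hom f /\ f 1 = 1.

Hypothesis fh : star_hom f.

Lemma homD x y : f (x + y) = f x + f y.
Proof. by case: fh => l _ _; have := l 1 x y; rewrite !scale1r. Qed.
Lemma hom0 : f 0 = 0.
Proof. by apply: (addrI (f 0)); rewrite -homD !addr0. Qed.
Lemma homZ c x : f (c *: x) = c *: f x.
Proof. by case: fh => l _ _; have := l c x 0; rewrite hom0 !addr0. Qed.
Lemma homN x : f (- x) = - f x.
Proof. by apply: (addrI (f x)); rewrite -homD !subrr hom0. Qed.
Lemma homB x y : f (x - y) = f x - f y. Proof. by rewrite homD homN. Qed.
Lemma homM x y : f (x * y) = f x * f y. Proof. by case: fh => _ + _; apply. Qed.
Lemma homS x : f (star x) = star (f x). Proof. by case: fh => _ _; apply. Qed.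
Lemma hom_sum I (r : seq I) (P : pred I) (F : I -> A) :
  f (\sum_(i <- r | P i) F i) = \sum_(i <- r | P i) f (F i).
Proof. exact: (big_morph _ homD hom0). Qed.

Lemma hom_surj1 : (forall y, exists x, f x = y) -> f 1 = 1.
Proof. by move=> /(_ 1)[x x1]; rewrite -[LHS]mulr1 -x1 -homM mul1r. Qed.

Lemma hom_unitary u : f 1 = 1 -> unitary u -> unitary (f u).
Proof. by move=> f1 [u1 u2]; split; rewrite -homS -homM ?u1 ?u2. Qed.

(** For self-adjoint [a] in the unit ball, the relation [a^2 + b^2 = 1] passes to the images and
    bounds [f a]. Scaling and the C*-identity give the rest. *)
Lemma hom_contr x : f 1 = 1 -> nm (f x) <= nm x.
Proof.
move=> f1.
have sa1 (a : A) : star a = a -> nm a <= 1 -> nm (f a) <= 1.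
  move=> sa a1; have [b [bs ab bc _]] := sa_sqrt_compl sa a1.
  apply: (@sa_nm_le1 _ _ _ (f b)); rewrite -?homS -?homM ?sa ?bs ?bc //.
  by rewrite -homD ab.
have sa_le (a : A) : star a = a -> nm (f a) <= nm a.
  move=> sa; have [->|/eqP a0] := eqVneq a 0; first by rewrite hom0 !cnm0.
  have a_gt0 : 0 < nm a.
    by rewrite lt_neqAle nm_ge0 andbT eq_sym; apply/eqP => /cnm0_eq0.
  have := sa1 ((nm a)^-1%:C%C *: a); rewrite starZr sa homZ !cnmZr.
  rewrite ger0_norm ?invr_ge0 ?nm_ge0 // mulVf ?gt_eqF // => /(_ erefl (lexx _)).
  by rewrite -(ler_pM2l a_gt0) mulrA mulfV ?gt_eqF // mul1r mulr1.
rewrite -(ler_pXn2r (ltn0Sn 1)) ?nnegrE ?nm_ge0 // -!nm_starM -homS -homM.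
by apply: sa_le; rewrite starM starK.
Qed.

End StarHom.

Lemma bij_hom_inv {R : realType} {A B : cstarAlgType R} (f : A -> B) g :
  star_hom f -> cancel f g -> cancel g f -> star_hom (g : B -> A).
Proof.
move=> fh fg gf; split.
- by move=> c x y; apply: (can_inj fg); rewrite (homD fh) (homZ fh) !gf.
- by move=> x y; apply: (can_inj fg); rewrite (homM fh) !gf.
- by move=> x; apply: (can_inj fg); rewrite (homS fh) !gf.
Qed.

Lemma star_iso_nm {R : realType} {A B : cstarAlgType R} (f : A -> B) x :
  star_iso (f : A -> B) -> nm (f x) = nm x.
Proof.
move=> [fh [g fg gf]]; have gh := bij_hom_inv fh fg gf.
have f1 : f 1 = 1 by apply: hom_surj1 => // y; exists (g y).
have g1 : g 1 = 1 by apply: hom_surj1 => // y; exists (f y).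
by apply/eqP; rewrite eq_le (hom_contr fh) // -{1}(fg x) (hom_contr gh).
Qed.

(** * Representations on Hilbert spaces *)

Section Hilbert.
Context {R : realType} {H : hilbertSpace R}.
Implicit Types h k x y : H.

Lemma ipDl x y z : inner H (x + y) z = inner H x z + inner H y z.
Proof. exact: linearDl. Qed.
Lemma ipDr x y z : inner H x (y + z) = inner H x y + inner H x z.
Proof. exact: linearDr. Qed.
Lemma ipZl c x y : inner H (c *: x) y = c * inner H x y.
Proof. exact: linearZl_LR. Qed.
Lemma ip0l x : inner H 0 x = 0.
Proof. by apply: (addrI (inner H 0 x)); rewrite -ipDl !addr0. Qed.
Lemma ip0r x : inner H x 0 = 0.
Proof. by apply: (addrI (inner H x 0)); rewrite -ipDr !addr0. Qed.
Lemma ipNl x y : inner H (- x) y = - inner H x y.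
Proof. by apply: (addrI (inner H x y)); rewrite -ipDl !subrr ip0l. Qed.
Lemma ipNr x y : inner H x (- y) = - inner H x y.
Proof. by apply: (addrI (inner H x y)); rewrite -ipDr !subrr ip0r. Qed.
Lemma ipC x y : inner H x y = Num.conj (inner H y x).
Proof. by rewrite hermC expr0 mul1r. Qed.
Lemma ip_nm x : inner H x x = (nm x ^+ 2)%:C%C.
Proof. by rewrite innerE nmE rmorphXn. Qed.
Lemma ip_ge0 x : 0 <= inner H x x.
Proof. by rewrite ip_nm lecR sqr_ge0. Qed.
Lemma ip_suml I (r : seq I) (P : pred I) (F : I -> H) x :
  inner H (\sum_(i <- r | P i) F i) x = \sum_(i <- r | P i) inner H (F i) x.
Proof. by apply: (big_morph (fun y => inner H y x)) => [? ?|]; rewrite ?ipDl ?ip0l. Qed.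
Lemma ip_sumr I (r : seq I) (P : pred I) (F : I -> H) x :
  inner H x (\sum_(i <- r | P i) F i) = \sum_(i <- r | P i) inner H x (F i).
Proof. by apply: (big_morph (fun y => inner H x y)) => [? ?|]; rewrite ?ipDr ?ip0r. Qed.

Lemma ip_eq0 x : inner H x x = 0 -> x = 0.
Proof.
rewrite ip_nm => /complexI/eqP; rewrite sqrf_eq0 => /eqP; exact: nm0_eq0.
Qed.

Lemma nm_le_ip x y : inner H x x <= inner H y y -> nm x <= nm y.
Proof. by rewrite !ip_nm lecR ler_pXn2r ?nnegrE ?nm_ge0. Qed.

(** By Pythagoras [x] is no longer than [x - s], for every [s] in [S]. *)
Lemma dense_ortho (S : set H) x : dense S ->
  (forall s, S s -> inner H x s = 0) -> x = 0.
Proof.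
move=> /dense_nmP dS xS; apply: nm_le_eq0 => e e0.
have [s Ss xs] := dS x e e0.
apply: le_trans (ltW xs); apply: nm_le_ip.
rewrite ipDl !ipDr !ipNl !ipNr [inner H s x]ipC (xS _ Ss).
by rewrite conjC0 oppr0 add0r opprK addr0 lerDl ip_ge0.
Qed.
End Hilbert.

Section Representations.
Context {R : realType} {A : cstarAlgType R} {H : hilbertSpace R}.
Variable pi : A -> H -> H.
Hypothesis rp : unital_rep pi.
Implicit Types (a b q : A) (h k : H).

Lemma repDr a h k : pi a (h + k) = pi a h + pi a k.
Proof. by case: rp => + _ _ _ _ => /(_ a)[l _]; have := l 1 h k; rewrite !scale1r. Qed.
Lemma rep0r a : pi a 0 = 0.
Proof. by apply: (addrI (pi a 0)); rewrite -repDr !addr0. Qed.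
Lemma repDl a b h : pi (a + b) h = pi a h + pi b h.
Proof. by case: rp => _ + _ _ _ => /(_ h) l; have := l 1 a b; rewrite !scale1r. Qed.
Lemma rep0l h : pi 0 h = 0.
Proof. by apply: (addrI (pi 0 h)); rewrite -repDl !addr0. Qed.
Lemma repZl c a h : pi (c *: a) h = c *: pi a h.
Proof. by case: rp => _ + _ _ _ => /(_ h) l; have := l c a 0; rewrite rep0l !addr0. Qed.
Lemma repNl a h : pi (- a) h = - pi a h.
Proof. by apply: (addrI (pi a h)); rewrite -repDl !subrr rep0l. Qed.
Lemma repBl a b h : pi (a - b) h = pi a h - pi b h.
Proof. by rewrite repDl repNl. Qed.
Lemma repNr a h : pi a (- h) = - pi a h.
Proof. by apply: (addrI (pi a h)); rewrite -repDr !subrr rep0r. Qed.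
Lemma rep1 h : pi 1 h = h. Proof. by case: rp. Qed.
Lemma repM a b h : pi (a * b) h = pi a (pi b h). Proof. by case: rp. Qed.
Lemma repS a h k : inner H (pi a h) k = inner H h (pi (star a) k).
Proof. by case: rp. Qed.
Lemma rep_suml I (r : seq I) (P : pred I) (F : I -> A) h :
  pi (\sum_(i <- r | P i) F i) h = \sum_(i <- r | P i) pi (F i) h.
Proof. by apply: (big_morph (fun a => pi a h)) => [? ?|]; rewrite ?repDl ?rep0l. Qed.
Lemma rep_sumr I (r : seq I) (P : pred I) (F : I -> H) a :
  pi a (\sum_(i <- r | P i) F i) = \sum_(i <- r | P i) pi a (F i).
Proof. by apply: (big_morph (pi a)) => [? ?|]; rewrite ?repDr ?rep0r. Qed.

Lemma rep_sq_ge0 q h : star q = q -> 0 <= inner H (pi (q * q) h) h.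
Proof. by move=> qs; rewrite repM repS qs ip_ge0. Qed.

(** When [nm b <= 1], [1 - star b * b] is a square [q * q], whence
    [|pi b h|^2 = |h|^2 - |pi q h|^2]. *)
Lemma rep_contr a h : nm (pi a h) <= nm a * nm h.
Proof.
have le1 b : nm b <= 1 -> nm (pi b h) <= nm h.
  move=> b1; have bb1 : nm (star b * b) <= 1.
    by rewrite nm_starM expr_le1 ?nm_ge0.
  have sb : star (star b * b) = star b * b by rewrite starM starK.
  have := @sa_pos_sqrt _ _ (1 - star b * b).
  rewrite starB star1 sb subKr => /(_ erefl bb1)[q [qs qq _]].
  apply: nm_le_ip; have := rep_sq_ge0 h qs; rewrite qq repBl rep1 ipDl ipNl.
  by rewrite subr_ge0 repM repS starK.
have [->|/eqP a0] := eqVneq a 0; first by rewrite rep0l cnm0 nm0 mul0r.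
have a_gt0 : 0 < nm a.
  by rewrite lt_neqAle nm_ge0 andbT eq_sym; apply/eqP => /cnm0_eq0.
have := le1 ((nm a)^-1%:C%C *: a); rewrite repZl cnmZr nmZr.
rewrite ger0_norm ?invr_ge0 ?nm_ge0 // mulVf ?gt_eqF // => /(_ (lexx _)).
by rewrite -(ler_pM2l a_gt0) mulrA mulfV ?gt_eqF // mul1r.
Qed.

Hypothesis pi_inj : injective pi.

Lemma rep_eq0 a : (forall h, pi a h = 0) -> a = 0.
Proof. by move=> a0; apply: pi_inj; apply/funext => h; rewrite a0 rep0l. Qed.

(* With [p = |a| = q^2] and [m = p - a], [a m = - p m]; as [a >= 0], this gives
   [<p m h, m h> <= 0], so [p m = 0] and then [m^2 = 0]. *)
Lemma rep_pos_sqrt a : star a = a -> (forall h, 0 <= inner H (pi a h) h) ->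
  exists q, [/\ star q = q, q * q = a & forall x, x * a = a * x -> x * q = q * x].
Proof.
have small b : star b = b -> nm b <= 1 -> (forall h, 0 <= inner H (pi b h) h) ->
    exists q, [/\ star q = q, q * q = b & forall x, x * b = b * x -> x * q = q * x].
  move=> sb b1 bpos; have [q [qs qq qc]] := sa_abs sb b1.
  exists q; split => //; set p := q * q in qq *.
  have ps : star p = p by rewrite starM qs.
  have bp : b * p = p * b by rewrite mulrA qc // -mulrA qc // mulrA.
  pose m := p - b.
  have bm : b * m = - (p * m) by rewrite /m !mulrBr bp qq opprB.
  have pm0 : p * m = 0.
    apply: rep_eq0 => h; have := bpos (pi m h).
    rewrite -repM bm repNl ipNl oppr_ge0 repM => le0.
    have : inner H (pi q (pi m h)) (pi q (pi m h)) = 0.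
      by apply: le_anti; rewrite ip_ge0 andbT -{2}qs -repS -repM.
    by move=> /ip_eq0 q0; rewrite /p repM q0 rep0r.
  have : m * m = 0 by rewrite {1}/m mulrBl bm pm0 oppr0 subr0.
  by move=> /(sa_sq0 _) m0; apply/eqP; rewrite -subr_eq0 -/m m0 // /m starB ps sb.
move=> sa apos; pose M := nm a + 1.
have M0 : 0 < M by rewrite ltr_wpDl ?nm_ge0.
have [||h|q [qs qq qc]] := small (M^-1%:C%C *: a).
- by rewrite starZr sa.
- rewrite cnmZr ger0_norm ?invr_ge0 ?(ltW M0) // -(ler_pM2l M0) mulrA mulfV ?gt_eqF //.
  by rewrite mul1r mulr1 lerDl.
- by rewrite repZl ipZl mulr_ge0 // lecR invr_ge0 ltW.
exists ((Num.sqrt M)%:C%C *: q); split.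
- by rewrite starZr qs.
- rewrite -scalerAl -scalerAr scalerA qq scalerA -!rmorphM /= -expr2 sqr_sqrtr ?ltW //.
  by rewrite mulfV ?gt_eqF // scale1r.
- move=> x xa; rewrite -scalerAl -scalerAr qc //.
  by rewrite -scalerAl -scalerAr xa.
Qed.

(** A faithful representation detects positivity, so both [star a * a] and [c^2 - star a * a] are
    squares, [p^2] and [q^2], with commuting roots; [p^2 + q^2 = c^2] then bounds [p], hence [a]. *)
Lemma rep_isom a (c : R) : 0 <= c -> (forall h, nm (pi a h) <= c * nm h) ->
  nm a <= c.
Proof.
move=> c0 ac; pose y := star a * a; have sy : star y = y by rewrite starM starK.
have [h|p [ps pp pc]] := rep_pos_sqrt sy.
  by rewrite /y repM repS starK ip_ge0.
have [||q [qs qq qc]] := @rep_pos_sqrt ((c ^+ 2)%:C%C *: 1 - y).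
- by rewrite starB starZr star1 sy.
- move=> h; rewrite repBl repZl rep1 ipDl ipNl subr_ge0 ipZl /y repM repS starK.
  rewrite !ip_nm -rmorphM /= lecR -exprMn ler_pXn2r ?nnegrE ?nm_ge0 //.
  by rewrite mulr_ge0 ?nm_ge0.
have ppqq : p * p + q * q = (c ^+ 2)%:C%C *: 1 by rewrite pp qq addrC subrK.
have pq : p * q = q * p.
  apply: qc; rewrite mulrBr mulrBl -scalerAl -scalerAr mul1r mulr1; congr (_ - _).
  by rewrite -pp mulrA.
have p_le : nm p <= c by apply: sa_nm_le ppqq.
have : nm a ^+ 2 <= c ^+ 2.
  rewrite -nm_starM -/y -pp; apply: le_trans (nmM _ _) _.
  by rewrite expr2 ler_pM ?nm_ge0.
by rewrite ler_pXn2r ?nnegrE ?nm_ge0.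
Qed.
End Representations.

(** * Independence of the spatial norm from the representations *)

Section Inverse.
Context {R : realType} {A : cstarAlgType R}.
Implicit Types c d q T x y : A.

Lemma neumann T : nm T < 1 -> exists y, (1 - T) * y = 1 /\ y * (1 - T) = 1.
Proof.
move=> T1; pose r := nm T; have r1 : 0 < 1 - r by rewrite subr_gt0.
pose u n : A := iter n (fun y => 1 + T * y) 0.
have us n : nm (u n.+1 - u n) <= r ^+ n.
  elim: n => [|n IH]; first by rewrite /u /= mulr0 addr0 subr0 nm1 expr0.
  have -> : u n.+2 - u n.+1 = T * (u n.+1 - u n).
    by rewrite mulrBr /u [iter n.+2 _ _]iterS [X in _ - X]iterS opprD addrACA subrr add0r.
  by apply: le_trans (nmM _ _) _; rewrite exprS ler_wpM2l ?nm_ge0.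
have [||y uy] := @ccvg_majorant _ _ u (fun n => (1 - r ^+ n) / (1 - r)) (1 - r)^-1.
- move=> n; apply: le_trans (us n) _; rewrite -mulrBl -(ler_pM2r r1).
  by rewrite mulfVK ?gt_eqF // exprS; lra.
- move=> n; rewrite -(ler_pM2r r1) mulfVK ?gt_eqF // mulVf ?gt_eqF //.
  by rewrite gerBl exprn_ge0 ?nm_ge0.
have yE : y = 1 + T * y.
  apply: (@cvg_eq _ _ (fun n => u n.+1)).
    by move: uy; rewrite -(cvg_shiftS u).
  by apply: cvgD; [exact: cvg_cst|apply: cvg_mul => //; exact: cvg_cst].
have yT : y * T = T * y.
  apply: (@cvg_eq _ _ (fun n => u n * T)).
    by apply: cvg_mul => //; exact: cvg_cst.
  suff h n : u n * T = T * u n.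
    by rewrite (funext h); apply: cvg_mul => //; exact: cvg_cst.
  elim: n => [|n IH]; first by rewrite /u /= mul0r mulr0.
  by rewrite /u iterS -/(u n) mulrDl mulrDr mul1r mulr1 -mulrA IH.
have Ty : (1 - T) * y = 1 by rewrite mulrBl mul1r {1}yE addrK.
exists y; split => //; by rewrite mulrBr mulr1 yT -Ty mulrBl mul1r.
Qed.

(** With [s = nm q] and [M = e + s^2], the element is [M (1 - T)] for [T = (s^2 - q^2) / M]. As
    [s^2 - q^2 = s^2 b^2] with [nm b <= 1], [nm T <= s^2 / M < 1] and the Neumann series applies. *)
Lemma pos_inv (e : R) q : 0 < e -> star q = q ->
  exists d, [/\ star d = d, d * (e%:C%C *: 1 + q * q) = 1
              & (e%:C%C *: 1 + q * q) * d = 1].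
Proof.
move=> e0 qs; set c : A := _ + _; pose s := nm q; pose M := e + s ^+ 2.
have M0 : 0 < M by rewrite ltr_pwDl ?sqr_ge0.
have s2 : nm ((s ^+ 2)%:C%C *: 1 - q * q) <= s ^+ 2.
  have [q0|/eqP q0] := eqVneq q 0.
    by rewrite /s q0 cnm0 mulr0 subr0 expr0n scale0r cnm0.
  have s0 : 0 < s by rewrite lt_neqAle nm_ge0 andbT eq_sym; apply/eqP => /cnm0_eq0.
  have [||b [bs ab _ b1]] := @sa_sqrt_compl _ _ (s^-1%:C%C *: q).
  - by rewrite starZr qs.
  - by rewrite cnmZr ger0_norm ?invr_ge0 ?nm_ge0 // mulVf ?gt_eqF.
  have -> : (s ^+ 2)%:C%C *: 1 - q * q = (s ^+ 2)%:C%C *: (b * b).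
    rewrite -ab scalerDr -scalerAl -scalerAr !scalerA -!rmorphM /= expr2.
    by rewrite mulfK ?gt_eqF // divff ?gt_eqF // scale1r addrAC subrr add0r.
  rewrite cnmZr ger0_norm ?sqr_ge0 // -[leRHS]mulr1 ler_wpM2l ?sqr_ge0 //.
  by apply: le_trans (nmM _ _) _; have := nm_ge0 b; nra.
have Mc : c = M%:C%C *: (1 - (M^-1%:C%C *: ((s ^+ 2)%:C%C *: 1 - q * q))).
  rewrite scalerBr scalerA -rmorphM /= mulfV ?gt_eqF // scale1r opprB.
  by rewrite /M rmorphD scalerDl /c addrACA subrr addr0.
have [|y [y1 y2]] := @neumann (M^-1%:C%C *: ((s ^+ 2)%:C%C *: 1 - q * q)).
  rewrite cnmZr ger0_norm ?invr_ge0 ?ltW // -(ltr_pM2l M0) mulrA mulfV ?gt_eqF //.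
  by rewrite mul1r mulr1; apply: le_lt_trans s2 _; rewrite ltrDr.
pose d : A := M^-1%:C%C *: y.
have dc : d * c = 1.
  by rewrite Mc /d -scalerAl -scalerAr scalerA y2 -rmorphM /= mulVf ?gt_eqF // scale1r.
have cd : c * d = 1.
  by rewrite Mc /d -scalerAl -scalerAr scalerA y1 -rmorphM /= mulfV ?gt_eqF // scale1r.
exists d; split => //.
have cs : star c = c by rewrite starD starZr star1 starM qs.
have dsc : star d * c = 1 by rewrite -{1}cs -starM cd star1.
by rewrite -[LHS]mulr1 -{1}cd mulrA dsc mul1r.
Qed.
End Inverse.

Section Schur.
Context {R : realType} {A : cstarAlgType R}.

(** The quadratic form of an operator matrix. Indices are naturals so that a matrix and its
    truncations have the same type in inductions on [m]. *)
Definition block_form (H : hilbertSpace R) (pi : A -> H -> H)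
    (S : nat -> nat -> A) m (h : nat -> H) : R[i] :=
  \sum_(j < m) \sum_(l < m) inner H (pi (S j l) (h j)) (h l).

Definition hermitian_block (S : nat -> nat -> A) :=
  forall j l, star (S j l) = S l j.

(** Completion of the square in the last vector, with [d] the inverse of the pivot. *)
Lemma schur_complement (H : hilbertSpace R) (pi : A -> H -> H)
    (S : nat -> nat -> A) (d : A) m (h : nat -> H) :
  unital_rep pi -> hermitian_block S -> star d = d -> d * S m m = 1 ->
  S m m * d = 1 ->
  let k := h m + pi d (\sum_(j < m) pi (S j m) (h j)) in
  block_form pi S m.+1 h = inner H (pi (S m m) k) k +
    block_form pi (fun j l => S j l - S m l * d * S j m) m h.
Proof.
move=> rp Sh ds dc cd; set v := \sum_(j < m) _; move=> k.
have cs : star (S m m) = S m m by exact: Sh.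
have SlE (l : nat) x : inner H (pi (S m l) x) (h l) = inner H x (pi (S l m) (h l)).
  by rewrite repS // Sh.
have -> : block_form pi S m.+1 h = block_form pi S m h + inner H v (h m)
    + (inner H (h m) v + inner H (pi (S m m) (h m)) (h m)).
  rewrite /block_form big_ord_recr /= big_ord_recr /=; congr (_ + (_ + _)).
    under eq_bigr do rewrite big_ord_recr /=.
    by rewrite big_split /= ip_suml.
  by rewrite ip_sumr; apply: eq_bigr => l _; rewrite SlE.
have -> : block_form pi (fun j l => S j l - S m l * d * S j m) m h =
    block_form pi S m h - inner H (pi d v) v.
  have -> : inner H (pi d v) v =
      \sum_(j < m) \sum_(l < m) inner H (pi (S m l * d * S j m) (h j)) (h l).
    rewrite rep_sumr // ip_suml; apply: eq_bigr => j _; rewrite ip_sumr.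
    by apply: eq_bigr => l _; rewrite -SlE !repM.
  rewrite /block_form -sumrB; apply: eq_bigr => j _; rewrite -sumrB.
  by apply: eq_bigr => l _; rewrite repBl // ipDl ipNl.
have -> : inner H (pi (S m m) k) k = inner H (pi (S m m) (h m)) (h m)
   + inner H (h m) v + (inner H v (h m) + inner H (pi d v) v).
  rewrite /k repDr // -(repM rp) cd rep1 // ipDl !ipDr; congr (_ + _ + (_ + _)).
    by rewrite repS // cs -(repM rp) cd rep1.
  by rewrite [RHS]repS // ds.
by rewrite [RHS]addrC -!addrA; congr (_ + _); rewrite [RHS]addrC -!addrA;
   rewrite [X in _ = _ + X]addrC; ring.
Qed.

(* Rank-one peeling: the last vector is eliminated by a Schur complement, whose
   pivot [S m m >= e] is invertible. *)
Lemma block_form_pos (H H' : hilbertSpace R) (pi : A -> H -> H)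
    (pi' : A -> H' -> H') (e : R) m S : unital_rep pi -> injective pi ->
  unital_rep pi' -> hermitian_block S -> 0 < e ->
  (forall h : nat -> H, e%:C%C * \sum_(j < m) inner H (h j) (h j) <= block_form pi S m h) ->
  forall h', 0 <= block_form pi' S m h'.
Proof.
move=> rp pi_inj rp' + e0.
elim: m S => [|m IH] S Sh pos h'; first by rewrite /block_form big_ord0.
have cs : star (S m m) = S m m by exact: Sh.
have [||q [qs qq _]] := @rep_pos_sqrt _ _ _ _ rp pi_inj (S m m - e%:C%C *: 1).
- by rewrite starB starZr star1 cs.
- move=> k; have := pos (fun j => if j == m then k else 0).
  rewrite /block_form big_ord_recr big1 /=; last first.
    by move=> i _; rewrite ltn_eqF // ip0l.
  rewrite add0r big_ord_recr big1 /=; last first.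
    by move=> i _; rewrite big1 // => l _; rewrite ltn_eqF // rep0r // ip0l.
  rewrite add0r big_ord_recr big1 /= ?eqxx; last first.
    by move=> i _; rewrite (ltn_eqF (ltn_ord i)) ip0r.
  by rewrite add0r repBl // ipDl ipNl repZl // ipZl rep1 // subr_ge0.
have SE : S m m = e%:C%C *: 1 + q * q by rewrite qq addrC subrK.
have [d [ds dc cd]] := pos_inv e0 qs; rewrite -SE in dc cd.
rewrite (schur_complement h' rp' Sh ds dc cd) addr_ge0 //.
  rewrite SE repDl // ipDl repZl // rep1 // ipZl addr_ge0 //.
    by rewrite mulr_ge0 ?ip_ge0 // lecR ltW.
  by rewrite rep_sq_ge0.
apply: IH.
  by move=> j l; rewrite starB !starM !Sh ds mulrA.
move=> h.
pose v := \sum_(j < m) pi (S j m) (h j).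
(* This last vector makes the pivot term vanish, so the Schur complement inherits the lower bound
   [e]. *)
pose g j := if j == m then - pi d v else h j.
have gE (j : 'I_m) : g j = h j by rewrite /g ltn_eqF.
have gm : g m = - pi d v by rewrite /g eqxx.
have := pos g; rewrite (schur_complement g rp Sh ds dc cd).
have -> : g m + pi d (\sum_(j < m) pi (S j m) (g j)) = 0.
  rewrite gm; under eq_bigr do rewrite gE.
  by rewrite addNr.
rewrite rep0r // ip0l add0r big_ord_recr /= mulrDr.
have -> : \sum_(i < m) inner H (g i) (g i) = \sum_(i < m) inner H (h i) (h i).
  by apply: eq_bigr => i _; rewrite gE.
have -> : block_form pi (fun j l => S j l - S m l * d * S j m) m g =
          block_form pi (fun j l => S j l - S m l * d * S j m) m h.
  by apply: eq_bigr => j _; apply: eq_bigr => l _; rewrite !gE.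
by apply: le_trans; rewrite lerDl mulr_ge0 ?ip_ge0 // lecR ltW.
Qed.

(** Adding [e] on the diagonal makes the form coercive, and then [e] tends to 0. *)
Lemma block_form_ge0 (H H' : hilbertSpace R) (pi : A -> H -> H)
    (pi' : A -> H' -> H') m S : unital_rep pi -> injective pi ->
  unital_rep pi' -> hermitian_block S ->
  (forall h, 0 <= block_form pi S m h) -> forall h', 0 <= block_form pi' S m h'.
Proof.
move=> rp pi_inj rp' Sh pos h'.
have shift (K : hilbertSpace R) (rho : A -> K -> K) (e : R) h : unital_rep rho ->
    block_form rho (fun j l => S j l + (if j == l then e%:C%C else 0) *: 1) m h =
    block_form rho S m h + e%:C%C * \sum_(j < m) inner K (h j) (h j).
  move=> rr; rewrite /block_form mulr_sumr -big_split; apply: eq_bigr => j _ /=.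
  transitivity (\sum_(l < m) (inner K (rho (S j l) (h j)) (h l) +
      (if l == j then e%:C%C * inner K (h j) (h j) else 0))).
    apply: eq_bigr => l _; rewrite repDl // repZl // rep1 // ipDl ipZl.
    congr (_ + _); rewrite -val_eqE /= eq_sym; case: eqP => [->//|_].
    by rewrite mul0r.
  by rewrite big_split /= -big_mkcond /= big_pred1_eq.
pose N := \sum_(j < m) nm (h' j) ^+ 2.
have NE : \sum_(j < m) inner H' (h' j) (h' j) = N%:C%C.
  by rewrite rmorph_sum /=; apply: eq_bigr => j _; rewrite ip_nm.
have N0 : 0 <= N by apply: sumr_ge0 => j _; exact: sqr_ge0.
have key (e : R) : 0 < e -> 0 <= block_form pi' S m h' + (e * N)%:C%C.
  move=> e0; rewrite rmorphM /= -NE -shift //.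
  apply: (@block_form_pos H H' pi pi' e) => //.
    move=> j l; rewrite starD Sh starZ star1; congr (_ + _ *: _).
    by rewrite eq_sym; case: eqP => _; rewrite ?conjC0 //; exact: conjc_real.
  by move=> h; rewrite shift // lerDr.
case: (block_form pi' S m h') key => x y key.
(* Nonnegativity in [R[i]] includes a zero imaginary part, which the real perturbation leaves
   unchanged. *)
have yx : y = 0 by have := key 1 ltr01; rewrite lecE /= addr0 => /andP[/eqP].
rewrite lecE /= yx eqxx /=.
apply/ler_addgt0Pl => e e0; have N1 : 0 < N + 1 by lra.
have := key (e / (N + 1)) (divr_gt0 e0 N1); rewrite lecE /= => /andP[_].
have : e / (N + 1) * N <= e.
  by rewrite mulrAC ler_pdivrMr // ler_wpM2l ?ltW //; lra.
lra.
Qed.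

End Schur.

Section TensorNorm.
Context {R : realType}.

(* [c] bounds the norm of [\sum_i pi (a i) (x) rho (b i)] on the algebraic tensor
   product of the Hilbert spaces, written with inner products only. *)
Definition tensor_bound (A B : cstarAlgType R) (H K : hilbertSpace R)
    (pi : A -> H -> H) (rho : B -> K -> K) n (a : 'I_n -> A) (b : 'I_n -> B)
    (c : R) :=
  forall m (h : nat -> H) (k : nat -> K),
  \sum_(j < m) \sum_(l < m) \sum_(i < n) \sum_(i' < n)
     inner H (pi (a i) (h j)) (pi (a i') (h l)) *
     inner K (rho (b i) (k j)) (rho (b i') (k l)) <=
  (c ^+ 2)%:C%C *
    \sum_(j < m) \sum_(l < m) inner H (h j) (h l) * inner K (k j) (k l).

Lemma tensor_bound_flip (A B : cstarAlgType R) (H K : hilbertSpace R)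
    (pi : A -> H -> H) (rho : B -> K -> K) n (a : 'I_n -> A) (b : 'I_n -> B) c :
  tensor_bound pi rho a b c -> tensor_bound rho pi b a c.
Proof.
move=> ab m k h; have := ab m h k; congr (_ <= _).
  by do 4 (apply: eq_bigr => ? _); rewrite mulrC.
by congr (_ * _); do 2 (apply: eq_bigr => ? _); rewrite mulrC.
Qed.

(** Once the vectors [k] are fixed, the bound says that a block form with entries in [A], the [S]
    below, is nonnegative; this does not depend on the faithful representation of [A]. *)
Lemma tensor_bound_indep (A B : cstarAlgType R) (H H' K : hilbertSpace R)
    (pi : A -> H -> H) (pi' : A -> H' -> H') (rho : B -> K -> K) n
    (a : 'I_n -> A) (b : 'I_n -> B) c :
  faithful_rep pi -> unital_rep pi' ->
  tensor_bound pi rho a b c -> tensor_bound pi' rho a b c.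
Proof.
move=> [rp pi_inj] rp' ab m h' k.
pose S (j l : nat) : A := ((c ^+ 2)%:C%C * inner K (k j) (k l)) *: 1 -
  \sum_(i < n) \sum_(i' < n)
    inner K (rho (b i) (k j)) (rho (b i') (k l)) *: (star (a i') * a i).
have SE (G : hilbertSpace R) (sg : A -> G -> G) g : unital_rep sg ->
    block_form sg S m g =
    (c ^+ 2)%:C%C *
      \sum_(j < m) \sum_(l < m) inner G (g j) (g l) * inner K (k j) (k l) -
    \sum_(j < m) \sum_(l < m) \sum_(i < n) \sum_(i' < n)
     inner G (sg (a i) (g j)) (sg (a i') (g l)) *
     inner K (rho (b i) (k j)) (rho (b i') (k l)).
  move=> rs; rewrite mulr_sumr -sumrB; apply: eq_bigr => j _.
  rewrite mulr_sumr -sumrB; apply: eq_bigr => l _.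
  rewrite repBl // ipDl ipNl repZl // rep1 // ipZl; congr (_ - _).
    by rewrite -mulrA [inner G _ _ * _]mulrC.
  rewrite rep_suml // ip_suml; apply: eq_bigr => i _.
  rewrite rep_suml // ip_suml; apply: eq_bigr => i' _.
  by rewrite (repZl rs) ipZl (repM rs) (repS rs) starK mulrC.
rewrite -subr_ge0 -SE //; apply: (block_form_ge0 rp pi_inj rp').
  move=> j l; rewrite starB starZ star1 star_sum /S; congr (_ *: _ - _).
    by rewrite rmorphM /= -ipC; congr (_ * _); exact: conjc_real.
  rewrite exchange_big; apply: eq_bigr => i _; rewrite star_sum.
  by apply: eq_bigr => i' _; rewrite starZ starM starK -ipC.
by move=> h; rewrite SE // subr_ge0.
Qed.

Section Spatial.
Variables (A B E : cstarAlgType R) (tau : A -> B -> E).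
Variables (H K L : hilbertSpace R) (t : H -> K -> L).
Variables (pi : A -> H -> H) (rho : B -> K -> K) (Pi : E -> L -> L).
Hypothesis tH : hilbert_tensor t.
Hypothesis pi_rep : unital_rep pi.
Hypothesis rho_rep : unital_rep rho.
Hypothesis Pi_rep : faithful_rep Pi.
Hypothesis PiE : forall a b h k, Pi (tau a b) (t h k) = t (pi a h) (rho b k).

Let tD : dense (elementary_sums t). Proof. by case: tH. Qed.
Let rP : unital_rep Pi. Proof. by case: Pi_rep. Qed.

(** [Pi (x - y)] is bounded and vanishes on the dense span of the elementary tensors; [Pi] is
    faithful. *)
Lemma spatial_ext x y :
  (forall h k, Pi x (t h k) = Pi y (t h k)) -> x = y.
Proof.
move=> xy; apply/eqP; rewrite -subr_eq0; apply/eqP.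
apply: (rep_eq0 rP); first by case: Pi_rep.
move=> xi; apply: nm_le_eq0 => e e0.
have M0 : 0 < nm (x - y) + 1 by have := nm_ge0 (x - y); lra.
have /dense_nmP d := tD.
have [s [n [u [v sE]]] xs] := d xi _ (divr_gt0 e0 M0).
have z0 : Pi (x - y) s = 0.
  rewrite sE rep_sumr // big1 // => i _; by rewrite repBl // xy subrr.
have -> : Pi (x - y) xi = Pi (x - y) (xi - s).
  by rewrite repDr // repNr // z0 subr0.
apply: le_trans (rep_contr rP _ _) _.
have : nm (xi - s) * (nm (x - y) + 1) <= e by rewrite -ler_pdivlMr // ltW.
have := nm_ge0 (xi - s); have := nm_ge0 (x - y); nra.
Qed.

Lemma spatial_extD a b x : x = tau a b <-> forall h k, Pi x (t h k) = t (pi a h) (rho b k).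
Proof.
split=> [-> //|xE]; apply: spatial_ext => h k; by rewrite xE PiE.
Qed.

Lemma tDl h h' k : t (h + h') k = t h k + t h' k.
Proof. by case: tH => + _ _ _ => /(_ k) l; have := l 1 h h'; rewrite !scale1r. Qed.
Lemma tDr h k k' : t h (k + k') = t h k + t h k'.
Proof. by case: tH => _ + _ _ => /(_ h) l; have := l 1 k k'; rewrite !scale1r. Qed.
Lemma t0l k : t 0 k = 0.
Proof. by apply: (addrI (t 0 k)); rewrite -tDl !addr0. Qed.
Lemma t0r h : t h 0 = 0.
Proof. by apply: (addrI (t h 0)); rewrite -tDr !addr0. Qed.
Lemma tZl c h k : t (c *: h) k = c *: t h k.
Proof. by case: tH => + _ _ _ => /(_ k) l; have := l c h 0; rewrite t0l !addr0. Qed.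
Lemma tZr c h k : t h (c *: k) = c *: t h k.
Proof. by case: tH => _ + _ _ => /(_ h) l; have := l c k 0; rewrite t0r !addr0. Qed.
Lemma t_ip h h' k k' : inner L (t h k) (t h' k') = inner H h h' * inner K k k'.
Proof. by case: tH. Qed.

Lemma tau_linl b : linear (tau^~ b : A -> E).
Proof.
move=> c a a' /=; apply/esym/spatial_extD => h k.
by rewrite repDl // repZl // !PiE repDl // repZl // tDl tZl.
Qed.

Lemma tau_linr a : linear (tau a : B -> E).
Proof.
move=> c b b' /=; apply/esym/spatial_extD => h k.
by rewrite repDl // repZl // !PiE repDl // repZl // tDr tZr.
Qed.

Lemma tauM a a' b b' : tau a b * tau a' b' = tau (a * a') (b * b').
Proof. by apply/spatial_extD => h k; rewrite !(repM _, PiE) // !repM. Qed.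

Lemma tau11 : tau 1 1 = 1.
Proof. by apply/esym/spatial_extD => h k; rewrite !rep1. Qed.

Lemma tauS a b : star (tau a b) = tau (star a) (star b).
Proof.
apply/spatial_extD => h k; apply/eqP; rewrite -subr_eq0; apply/eqP.
apply: (dense_ortho tD) => _ [n [u [v ->]]]; rewrite ip_sumr big1 // => i _.
by rewrite ipDl ipNl repS // starK PiE !t_ip !repS // !starK subrr.
Qed.

Lemma spatial_ip n (a : 'I_n -> A) (b : 'I_n -> B) m (h : nat -> H) (k : nat -> K) :
  let xi := \sum_(j < m) t (h j) (k j) in
  let y := Pi (\sum_(i < n) tau (a i) (b i)) xi in
  inner L y y = \sum_(j < m) \sum_(l < m) \sum_(i < n) \sum_(i' < n)
     inner H (pi (a i) (h j)) (pi (a i') (h l)) *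
     inner K (rho (b i) (k j)) (rho (b i') (k l)).
Proof.
move=> xi y; have -> : y = \sum_(j < m) \sum_(i < n) t (pi (a i) (h j)) (rho (b i) (k j)).
  rewrite /y rep_sumr //; apply: eq_bigr => j _.
  by rewrite rep_suml //; apply: eq_bigr => i _; rewrite PiE.
rewrite ip_suml; apply: eq_bigr => j _; rewrite ip_sumr; apply: eq_bigr => l _.
rewrite ip_suml; apply: eq_bigr => i _; rewrite ip_sumr; apply: eq_bigr => i' _.
exact: t_ip.
Qed.

Lemma spatial_ip_vec m (h : nat -> H) (k : nat -> K) :
  let xi := \sum_(j < m) t (h j) (k j) in
  inner L xi xi = \sum_(j < m) \sum_(l < m) inner H (h j) (h l) * inner K (k j) (k l).
Proof.
move=> xi; rewrite ip_suml; apply: eq_bigr => j _; rewrite ip_sumr.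
by apply: eq_bigr => l _; exact: t_ip.
Qed.

(** [Pi] is isometric, so the norm of [E] is an operator norm; tested on the dense elementary sums,
    it involves inner products of [H] and [K] only. *)
Lemma spatial_nmP n (a : 'I_n -> A) (b : 'I_n -> B) (c : R) : 0 <= c ->
  nm (\sum_(i < n) tau (a i) (b i)) <= c <-> tensor_bound pi rho a b c.
Proof.
move=> c0; set x := \sum_(i < n) _; split => [xc m h k|ab].
  rewrite -(spatial_ip a b) -spatial_ip_vec !ip_nm -rmorphM /= lecR -exprMn.
  rewrite ler_pXn2r ?nnegrE ?mulr_ge0 ?nm_ge0 //.
  by apply: le_trans (rep_contr rP _ _) _; rewrite ler_wpM2r ?nm_ge0.
apply: (rep_isom rP) => //; first by case: Pi_rep.
move=> xi; apply/ler_addgt0Pl => e e0.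
have M0 : 0 < nm x + c + 1 by have := nm_ge0 x; lra.
have /dense_nmP d := tD.
have [s [m [u [v sE]]] xs] := d xi _ (divr_gt0 e0 M0).
have ext (V : hilbertSpace R) (w : 'I_m -> V) : exists f : nat -> V, forall i : 'I_m, f i = w i.
  by exists (fun j => if insub j is Some i then w i else 0) => i; rewrite valK.
have [h hu] := ext _ u; have [k kv] := ext _ v.
have sc : nm (Pi x s) <= c * nm s.
  have -> : s = \sum_(j < m) t (h j) (k j).
    by rewrite sE; apply: eq_bigr => i _; rewrite hu kv.
  rewrite -(ler_pXn2r (ltn0Sn 1)) ?nnegrE ?mulr_ge0 ?nm_ge0 // exprMn -lecR [leRHS]rmorphM /=.
  by rewrite -!ip_nm spatial_ip spatial_ip_vec.
have -> : Pi x xi = Pi x s + Pi x (xi - s) by rewrite -repDr // addrC subrK.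
have h1 := nmD (Pi x s) (Pi x (xi - s)); have h2 := rep_contr rP x (xi - s).
have h3 : nm s <= nm xi + nm (xi - s) by have := nmB xi (xi - s); rewrite subKr.
have h4 : nm (xi - s) * (nm x + c + 1) <= e by rewrite -ler_pdivlMr // ltW.
have h5 : c * nm s <= c * (nm xi + nm (xi - s)) by rewrite ler_wpM2l.
have := nm_ge0 (xi - s); lra.
Qed.
End Spatial.

End TensorNorm.

(** * Automorphisms of the tensor square *)

Section Extension.
Context {R : realType}.

Section TensorSums.
Context {A B D : cstarAlgType R}.
Variables (al : A -> D) (be : B -> D).

Definition commuting := forall a b, al a * be b = be b * al a.

(** A list of pairs represents an element of the algebraic tensor product. It can be evaluated in
    any algebra with two embeddings, so that norms are compared across algebras. *)
Definition tensor_sum (s : seq (A * B)) : D := \sum_(p <- s) al p.1 * be p.2.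

Definition tensor_dense :=
  forall x (e : R), 0 < e -> exists s, nm (x - tensor_sum s) < e.

Hypotheses (ah : unital_hom al) (bh : unital_hom be) (comm : commuting).

Lemma tensor_sum_cat s s' : tensor_sum (s ++ s') = tensor_sum s + tensor_sum s'.
Proof. by rewrite /tensor_sum big_cat. Qed.

Lemma tensor_sumZ c s :
  tensor_sum [seq (c *: p.1, p.2) | p <- s] = c *: tensor_sum s.
Proof.
case: ah => h _; rewrite /tensor_sum big_map scaler_sumr; apply: eq_bigr => p _ /=.
by rewrite (homZ h) scalerAl.
Qed.

Lemma tensor_sum_star s :
  tensor_sum [seq (star p.1, star p.2) | p <- s] = star (tensor_sum s).
Proof.
case: ah bh => h _ [h' _]; rewrite /tensor_sum big_map star_sum.
by apply: eq_bigr => p _ /=; rewrite (homS h) (homS h') -starM comm.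
Qed.

Lemma tensor_sumM s s' :
  tensor_sum [seq (p.1 * q.1, p.2 * q.2) | p <- s, q <- s'] =
  tensor_sum s * tensor_sum s'.
Proof.
case: ah bh => h _ [h' _]; rewrite /tensor_sum big_allpairs_dep /= mulr_suml.
apply: eq_bigr => p _; rewrite mulr_sumr; apply: eq_bigr => q _.
by rewrite (homM h) (homM h') -!mulrA; congr (_ * _); rewrite !mulrA comm.
Qed.

Lemma tensor_suml a : tensor_sum [:: (a, 1)] = al a.
Proof. by case: bh => _ b1; rewrite /tensor_sum big_seq1 /= b1 mulr1. Qed.

Lemma tensor_sumr b : tensor_sum [:: (1, b)] = be b.
Proof. by case: ah => _ a1; rewrite /tensor_sum big_seq1 /= a1 mul1r. Qed.

End TensorSums.

Lemma cvg_nm_eq (D D' : cstarAlgType R) (u : nat -> D) (v : nat -> D') x y :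
  u n @[n --> \oo] --> x -> v n @[n --> \oo] --> y ->
  (forall n, nm (u n) = nm (v n)) -> nm x = nm y.
Proof.
move=> /ccvg_nmP ux /ccvg_nmP vy uv.
have key (e : R) : 0 < e -> nm x <= nm y + e /\ nm y <= nm x + e.
  move=> e0; have e2 : 0 < e / 2 by rewrite divr_gt0.
  have [N _ /(_ N (leqnn N)) [h1 h2]] := filterI (ux _ e2) (vy _ e2).
  have := cnmD (x - u N) (u N); have := cnmD (y - v N) (v N); rewrite !subrK.
  have := cnmB x (x - u N); have := cnmB y (y - v N); rewrite !subKr (uv N) in h1 h2 *.
  by split; lra.
by apply/eqP; rewrite eq_le; apply/andP; split; apply/ler_addgt0Pr => e /key[].
Qed.

Section Graph.
Context {A B : cstarAlgType R}.

(** Closure of the correspondence between the values of a list in [D] and in [D']. It is a relation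
    because distinct lists may have the same value. *)
Definition graph (D D' : cstarAlgType R) (al : A -> D) (be : B -> D)
    (al' : A -> D') (be' : B -> D') (e : D) (e' : D') :=
  exists s : nat -> seq (A * B), tensor_sum al be (s n) @[n --> \oo] --> e /\
     tensor_sum al' be' (s n) @[n --> \oo] --> e'.

Lemma graph_sym (D D' : cstarAlgType R) (al : A -> D) (be : B -> D)
    (al' : A -> D') (be' : B -> D') e e' :
  graph al be al' be' e e' -> graph al' be' al be e' e.
Proof. by move=> [s [h h']]; exists s. Qed.

Variables D D' : cstarAlgType R.
Variables (al : A -> D) (be : B -> D) (al' : A -> D') (be' : B -> D').
Hypotheses (ah : unital_hom al) (bh : unital_hom be) (comm : commuting al be).
Hypotheses (ah' : unital_hom al') (bh' : unital_hom be') (comm' : commuting al' be').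
Hypothesis nm_eq : forall s, nm (tensor_sum al' be' s) = nm (tensor_sum al be s).

Lemma graph_lin c e e' d d' : graph al be al' be' e e' -> graph al be al' be' d d' ->
  graph al be al' be' (c *: e + d) (c *: e' + d').
Proof.
move=> [s [h h']] [r [k k']].
exists (fun n => [seq (c *: p.1, p.2) | p <- s n] ++ r n); split.
  have -> : (fun n => tensor_sum al be ([seq (c *: p.1, p.2) | p <- s n] ++ r n)) =
    (fun n => c *: tensor_sum al be (s n) + tensor_sum al be (r n)).
    by apply/funext => n; rewrite tensor_sum_cat tensor_sumZ.
  by apply: cvgD k; exact: cvgZr.
have -> : (fun n => tensor_sum al' be' ([seq (c *: p.1, p.2) | p <- s n] ++ r n)) =
    (fun n => c *: tensor_sum al' be' (s n) + tensor_sum al' be' (r n)).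
  by apply/funext => n; rewrite tensor_sum_cat tensor_sumZ.
by apply: cvgD k'; exact: cvgZr.
Qed.

Lemma graphM e e' d d' : graph al be al' be' e e' -> graph al be al' be' d d' ->
  graph al be al' be' (e * d) (e' * d').
Proof.
move=> [s [h h']] [r [k k']].
exists (fun n => [seq (p.1 * q.1, p.2 * q.2) | p <- s n, q <- r n]); split.
  by rewrite (funext (fun n => tensor_sumM ah bh comm (s n) (r n))); exact: cvg_mul.
by rewrite (funext (fun n => tensor_sumM ah' bh' comm' (s n) (r n))); exact: cvg_mul.
Qed.

Lemma graph_star e e' : graph al be al' be' e e' ->
  graph al be al' be' (star e) (star e').
Proof.
move=> [s [h h']].
exists (fun n => [seq (star p.1, star p.2) | p <- s n]); split.
  by rewrite (funext (fun n => tensor_sum_star ah bh comm (s n))); exact: cvg_star.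
by rewrite (funext (fun n => tensor_sum_star ah' bh' comm' (s n))); exact: cvg_star.
Qed.

(** By linearity [0] is related to [e'' - e'], and related elements have equal norms. *)
Lemma graph_inj e e' e'' : graph al be al' be' e e' -> graph al be al' be' e e'' ->
  e' = e''.
Proof.
move=> h k; have [s [u v]] := graph_lin (-1) h k.
have := cvg_nm_eq u v (fun n => esym (nm_eq (s n))).
rewrite !scaleN1r addNr cnm0 => /esym/cnm0_eq0/eqP.
by rewrite addrC subr_eq0 => /eqP.
Qed.

Lemma graph_total : tensor_dense al be -> forall e, exists e', graph al be al' be' e e'.
Proof.
move=> dn e.
have /choice[s sE] : forall n, exists s, nm (e - tensor_sum al be s) < 2^-1 ^+ n.
  by move=> n; apply: dn; rewrite exprn_gt0 // invr_gt0.
have subE (D0 : cstarAlgType R) (f : A -> D0) (g : B -> D0) r r' : unital_hom f ->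
    tensor_sum f g ([seq (-1 *: p.1, p.2) | p <- r] ++ r') =
    tensor_sum f g r' - tensor_sum f g r.
  by move=> fh; rewrite tensor_sum_cat tensor_sumZ // scaleN1r addrC.
have [||e' h] := @ccvg_majorant _ _ (fun n => tensor_sum al' be' (s n))
   (* The increments [2 * 2^-n] exceed the distance bound [2^-n + 2^-(n+1)]. *)
   (fun n => 4 * (1 - 2^-1 ^+ n)) 4.
- move=> n; rewrite -subE // nm_eq subE // exprS.
  have := cnm_tri e (tensor_sum al be (s n.+1)) (tensor_sum al be (s n)).
  rewrite [X in _ <= X + _]cnm_sub; have := sE n; have := sE n.+1; rewrite exprS.
  have := nm_ge0 (e - tensor_sum al be (s n)); lra.
- move=> n; have p0 : 0 <= 2^-1 ^+ n :> R by rewrite exprn_ge0 ?invr_ge0.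
  lra.
exists e', s; split => //; apply/ccvg_nmP => d d0.
have /cvgrPdist_lt/(_ d d0) : (2^-1 : R) ^+ n @[n --> \oo] --> 0.
  by apply: cvg_expr; rewrite ger0_norm // invf_lt1 // ltr1n.
apply: filterS => n; rewrite sub0r normrN ger0_norm ?exprn_ge0 ?invr_ge0 //.
by apply: lt_trans; exact: sE.
Qed.

End Graph.

(** The hypotheses are symmetric in [D] and [D'], so the inverse is the map defined by the reversed
    graph. *)
Lemma tensor_extension (A B D D' : cstarAlgType R) (al : A -> D) (be : B -> D)
    (al' : A -> D') (be' : B -> D') :
  unital_hom al -> unital_hom be -> commuting al be -> tensor_dense al be ->
  unital_hom al' -> unital_hom be' -> commuting al' be' -> tensor_dense al' be' ->
  (forall s, nm (tensor_sum al' be' s) = nm (tensor_sum al be s)) ->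
  exists F : D -> D', [/\ star_iso (F : D -> D'), forall a, F (al a) = al' a
                        & forall b, F (be b) = be' b].
Proof.
move=> ah bh comm dn ah' bh' comm' dn' nme.
have nme' s := esym (nme s).
have [F FE] := choice (graph_total ah ah' nme dn).
have [G GE] := choice (graph_total ah' ah nme' dn').
have Fu e e' : graph al be al' be' e e' -> F e = e'.
  by move=> h; exact: graph_inj nme _ _ _ (FE e) h.
exists F; split.
- split.
    split.
    + by move=> c x y; apply: Fu; exact: graph_lin.
    + by move=> x y; apply: Fu; exact: graphM.
    + by move=> x; apply: Fu; exact: graph_star.
  exists G => x.
    by apply: (graph_inj ah' ah nme' (GE (F x))); exact/graph_sym.
  by apply: Fu; exact/graph_sym.
- move=> a; apply: Fu; exists (fun=> [:: (a, 1)]).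
  by rewrite !tensor_suml //; split; exact: cvg_cst.
- move=> b; apply: Fu; exists (fun=> [:: (1, b)]).
  by rewrite !tensor_sumr //; split; exact: cvg_cst.
Qed.
End Extension.

Section HalfFlip.
Context {R : realType}.

Lemma tensor_bound_indep2 (A B : cstarAlgType R) (H H' K K' : hilbertSpace R)
    (pi : A -> H -> H) (pi' : A -> H' -> H') (rho : B -> K -> K)
    (rho' : B -> K' -> K') n (a : 'I_n -> A) (b : 'I_n -> B) c :
  faithful_rep pi -> unital_rep pi' -> faithful_rep rho -> unital_rep rho' ->
  tensor_bound pi rho a b c -> tensor_bound pi' rho' a b c.
Proof.
move=> fp up fr ur ab; apply: tensor_bound_flip.
by apply: tensor_bound_indep fr ur _; apply: tensor_bound_flip;
  apply: tensor_bound_indep fp up ab.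
Qed.

Lemma faithful_rep_comp (A B : cstarAlgType R) (H : hilbertSpace R)
    (pi : B -> H -> H) (f : A -> B) :
  faithful_rep pi -> unital_hom f -> injective f -> faithful_rep (pi \o f).
Proof.
move=> [rp pi_inj] [fh f1] f_inj; split; last exact: inj_comp.
split => [a|h|h|a b h|a h k] /=.
- by case: rp => /(_ (f a)).
- by move=> c x y /=; rewrite (homD fh) (homZ fh) repDl // repZl.
- by rewrite f1 rep1.
- by rewrite (homM fh) repM.
- by rewrite repS // (homS fh).
Qed.

Lemma eq_nm_le (D D' : cstarAlgType R) (x : D) (y : D') :
  (forall c : R, 0 <= c -> nm x <= c <-> nm y <= c) -> nm x = nm y.
Proof.
move=> h; apply/eqP; rewrite eq_le; apply/andP; split.
  by apply/h; rewrite ?nm_ge0.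
by apply/h; rewrite ?nm_ge0.
Qed.

Lemma sum_tensor_ord (A B E : cstarAlgType R) (tau : A -> B -> E) (s : seq (A * B)) :
  \sum_(p <- s) tau p.1 p.2 =
  \sum_(i < size s) tau (nth (0, 0) s i).1 (nth (0, 0) s i).2.
Proof. by rewrite (big_nth (0, 0)) big_mkord. Qed.

(** One unitary per finite set and tolerance is what the later constructions consume. *)
Definition approx_equiv (C B : cstarAlgType R) (f g : C -> B) :=
  forall (F : seq C) (e : R), 0 < e ->
  exists2 u : B, unitary u & forall c, c \in F -> nm (u * f c * star u - g c) < e.

Lemma approx_unitary_equivW (C B : cstarAlgType R) (f g : C -> B) :
  approx_unitary_equiv f g -> approx_equiv f g.
Proof.
move=> [u uU fg] F e e0.
suff [n h] : exists n, forall c, c \in F -> nm (u n * f c * star (u n) - g c) < e.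
  by exists (u n).
suff [N _ h] : \forall n \near \oo, forall c, c \in F ->
    nm (u n * f c * star (u n) - g c) < e by exists N; exact: h (leqnn N).
elim: F => [|c F IH]; first by near=> n => c; rewrite in_nil.
have /ccvg_nmP/(_ e e0) h := fg c.
apply: filterS2 h IH => n h1 h2 d; rewrite inE => /orP[/eqP ->|]; last exact: h2.
by rewrite cnm_sub.
Unshelve. all: by end_near. Qed.

(* [al] and [be] are the two factor embeddings of [D] in [D (x) D], read in [D]. *)
Lemma self_absorbing_embeddings (D : cstarAlgType R) :
  strongly_self_absorbing D -> exists al be : D -> D,
  [/\ unital_hom al, unital_hom be, commuting al be, tensor_dense al be &
  [/\ forall s, nm (tensor_sum be al s) = nm (tensor_sum al be s),
      forall f g, star_iso (f : D -> D) -> star_iso (g : D -> D) ->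
        forall s, nm (tensor_sum (al \o f) (be \o g) s) = nm (tensor_sum al be s)
    & approx_equiv (@id D) al]].
Proof.
move=> [_ _ [E [tau [[dn sp] [phi phi_iso phi_id]]]]].
have [H [K [L [t [pi [rho [Pi [tH fp fr fP PiE]]]]]]]] := sp.
have up := proj1 fp; have ur := proj1 fr.
have [phi_h [psi phiK psiK]] := phi_iso.
have psi_h := bij_hom_inv phi_h phiK psiK.
have psi1 : psi 1 = 1 by apply: (hom_surj1 psi_h) => y; exists (phi y).
have psi_iso : star_iso (psi : E -> D) by split => //; exists phi.
have tM := tauM tH up ur fP PiE.
have tl := tau_linl tH up fP PiE; have tr := tau_linr tH ur fP PiE.
have t11 := tau11 tH up ur fP PiE; have tS := tauS tH up ur fP PiE.
pose al d : D := psi (tau d 1); pose be d : D := psi (tau 1 d).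
have alh : unital_hom al.
  split; last by rewrite /al t11.
  split.
  - by move=> c x y; rewrite /al tl (homD psi_h) (homZ psi_h).
  - by move=> x y; rewrite /al -(homM psi_h) tM mulr1.
  - by move=> x; rewrite /al -(homS psi_h) tS star1.
have beh : unital_hom be.
  split; last by rewrite /be t11.
  split.
  - by move=> c x y; rewrite /be tr (homD psi_h) (homZ psi_h).
  - by move=> x y; rewrite /be -(homM psi_h) tM mulr1.
  - by move=> x; rewrite /be -(homS psi_h) tS star1.
have abE a b : al a * be b = psi (tau a b) by rewrite -(homM psi_h) tM mulr1 mul1r.
have comm : commuting al be.
  by move=> a b; rewrite abE /al /be -(homM psi_h) tM mulr1 mul1r.
have sumE s : nm (tensor_sum al be s) = nm (\sum_(p <- s) tau p.1 p.2).
  rewrite -(star_iso_nm _ psi_iso) (hom_sum psi_h); congr nm.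
  by apply: eq_bigr => p _; rewrite abE.
have nmP := spatial_nmP tH fP PiE.
exists al, be; split => //.
  move=> x e e0.
  have [_ [n [u [v ->]]] xs] := proj1 (cdense_nmP _) dn (phi x) _ e0.
  exists [seq (u i, v i) | i <- enum 'I_n].
  suff -> : tensor_sum al be [seq (u i, v i) | i <- enum 'I_n] =
      psi (\sum_(i < n) tau (u i) (v i)).
    by rewrite -[x]phiK -(homB psi_h) (star_iso_nm _ psi_iso).
  rewrite /tensor_sum big_map big_enum (hom_sum psi_h) /=.
  by apply: eq_bigr => i _; rewrite abE.
split.
- move=> s; have -> : tensor_sum be al s = tensor_sum al be [seq (p.2, p.1) | p <- s].
    by rewrite /tensor_sum big_map; apply: eq_bigr => p _ /=; rewrite comm.
  rewrite !sumE big_map /= (sum_tensor_ord tau) (sum_tensor_ord (fun a b => tau b a)).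
  (* Flipping a bound exchanges [pi] and [rho], which are two faithful representations of the same
     [D] and may be swapped back. *)
  apply: eq_nm_le => c c0; split => /nmP h; apply/nmP => //.
    apply: tensor_bound_indep2 fr up fp ur _.
    by apply: tensor_bound_flip; exact: h.
  by apply: tensor_bound_flip; apply: tensor_bound_indep2 fp ur fr up _; exact: h.
- move=> f g fi gi s.
  have fu : unital_hom f.
    by case: fi => fh [k _ kf]; split => //; apply: (hom_surj1 fh) => y; exists (k y).
  have gu : unital_hom g.
    by case: gi => gh [k _ kg]; split => //; apply: (hom_surj1 gh) => y; exists (k y).
  (* Applying [f] and [g] to the legs amounts to using other faithful representations. *)
  have pf : faithful_rep (pi \o f) by apply: faithful_rep_comp => //; case: fi => _ /bij_inj.
  have pg : faithful_rep (rho \o g) by apply: faithful_rep_comp => //; case: gi => _ /bij_inj.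
  have -> : tensor_sum (al \o f) (be \o g) s = tensor_sum al be [seq (f p.1, g p.2) | p <- s].
    by rewrite /tensor_sum big_map.
  rewrite !sumE big_map (sum_tensor_ord tau) (sum_tensor_ord (fun a b => tau (f a) (g b))).
  apply: eq_nm_le => c c0; split => /nmP h; apply/nmP => //.
    by apply: (tensor_bound_indep2 pf up pg ur); exact: h.
  by apply: (tensor_bound_indep2 fp (proj1 pf) fr (proj1 pg)); exact: h.
- move=> F e e0; have [u uU h] := approx_unitary_equivW phi_id F e0.
  exists (psi u); first exact: (hom_unitary psi_h).
  move=> c /h; suff -> : psi u * id c * star (psi u) - al c =
      psi (u * phi c * star u - tau c 1) by rewrite (star_iso_nm _ psi_iso).
  by rewrite (homB psi_h) !(homM psi_h) (homS psi_h) phiK.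
Qed.

End HalfFlip.

(** * Approximate unitary equivalence *)

Section ApproxEquiv.
Context {R : realType}.

Lemma unitary_conjK (B : cstarAlgType R) (u x : B) : unitary u ->
  star u * (u * x * star u) * u = x.
Proof.
by move=> [u1 _]; rewrite !mulrA u1 mul1r -mulrA u1 mulr1.
Qed.

Lemma approx_equiv_sym (C B : cstarAlgType R) (f g : C -> B) :
  approx_equiv f g -> approx_equiv g f.
Proof.
move=> fg F e e0; have [u uU h] := fg F e e0.
exists (star u); first exact: unitary_star.
move=> c /h; rewrite starK cnm_sub.
rewrite -(nm_unitaryl _ (unitary_star uU)) -(nm_unitaryr _ uU) mulrBr mulrBl.
by rewrite unitary_conjK.
Qed.

Lemma approx_equiv_trans (C B : cstarAlgType R) (f g h : C -> B) :
  approx_equiv f g -> approx_equiv g h -> approx_equiv f h.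
Proof.
move=> fg gh F e e0; have e2 : 0 < e / 2 by rewrite divr_gt0.
have [u uU hu] := fg F _ e2; have [v vU hv] := gh F _ e2.
exists (v * u); first exact: unitaryM.
move=> c cF; apply: le_lt_trans (cnm_tri (v * g c * star v) _ _) _.
suff -> : nm (v * u * f c * star (v * u) - v * g c * star v) = nm (u * f c * star u - g c).
  by have := hu c cF; have := hv c cF; lra.
rewrite -[RHS](nm_unitaryl _ vU) -[RHS](nm_unitaryr _ (unitary_star vU)).
by rewrite mulrBr mulrBl starM !mulrA.
Qed.

Lemma approx_equiv_precomp (C' C B : cstarAlgType R) (k : C' -> C) (f g : C -> B) :
  approx_equiv f g -> approx_equiv (f \o k) (g \o k).
Proof.
move=> fg F e e0; have [u uU h] := fg (map k F) e e0; exists u => // c cF.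
by apply: h; exact: map_f.
Qed.

Lemma approx_equiv_postcomp (C B B' : cstarAlgType R) (k : B -> B') (f g : C -> B) :
  unital_hom k -> approx_equiv f g -> approx_equiv (k \o f) (k \o g).
Proof.
move=> [kh k1] fg F e e0; have [u uU h] := fg F e e0.
exists (k u); first exact: hom_unitary.
move=> c /h; apply: le_lt_trans; rewrite /= -(homS kh) -!(homM kh) -(homB kh).
exact: hom_contr.
Qed.

(* The second factor embedding is moved to the first by the flip of the first
   two factors of [(D (x) D) (x) D], which fixes the third. *)
Lemma second_embedding_inner (D : cstarAlgType R) (al be sg F : D -> D) :
  unital_hom F -> approx_equiv id al ->
  (forall d, sg (be d) = al d) -> (forall d, F (al d) = al (sg d)) ->
  (forall d, F (be d) = be d) -> approx_equiv id be.
Proof.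
move=> Fh ial sgbe Fal Fbe.
have be_albe : approx_equiv be (al \o be) by exact: (approx_equiv_precomp be ial).
have al_alal : approx_equiv al (al \o al) by exact: (approx_equiv_precomp al ial).
(* [al \o al], [al \o be] and [be] embed the first, second and third factor. The third is already
   equivalent to the second; [F] turns this into an equivalence of the third with the first. *)
have alal_be : approx_equiv (al \o al) be.
  apply: approx_equiv_sym; have := approx_equiv_postcomp Fh be_albe.
  have -> : F \o be = be by apply/funext => d /=; rewrite Fbe.
  by have -> // : F \o (al \o be) = al \o al by apply/funext => d /=; rewrite Fal sgbe.
exact: approx_equiv_trans ial (approx_equiv_trans al_alal alal_be).
Qed.

End ApproxEquiv.

(** * Short paths of unitaries *)

Section ShortPath.
Context {R : realType} {A : cstarAlgType R}.
Implicit Types v z T : A.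

(** [2 (z - z') = (z - z') (z + z') + (T - T')], where [z + z'] has norm at most 1. The case
    [T = T'] is uniqueness of small solutions. *)
Lemma sqrt_lipschitz z z' T T' : z * z' = z' * z -> nm z <= 2^-1 ->
  nm z' <= 2^-1 -> (1 - z) * (1 - z) = 1 - T -> (1 - z') * (1 - z') = 1 - T' ->
  nm (z - z') <= nm (T - T').
Proof.
move=> zz z2 z'2 zT zT'.
have E : (z - z') * (z + z') + (T - T') = (z - z') + (z - z').
  have TE x S : (1 - x) * (1 - x) = 1 - S -> S = x + x - x * x :> A.
    move=> xS; apply: (@oppr_inj A); apply: (@addrI A 1); rewrite -xS.
    by rewrite mulrBl mul1r mulrBr mulr1 -addrA -opprD addrA.
  have -> : (z - z') * (z + z') = z * z - z' * z'.
    by rewrite mulrDr !mulrBl zz addrA subrK.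
  rewrite (TE _ _ zT) (TE _ _ zT') opprB addrA [z * z - _ + _]addrC !subrKA.
  by rewrite opprD addrACA.
have h1 := cnmD ((z - z') * (z + z')) (T - T').
have h2 := nmM (z - z') (z + z'); have h3 := cnmD z z'.
have h4 : nm ((z - z') + (z - z')) = 2 * nm (z - z').
  by rewrite -[in RHS](half_dbl (z - z')) nm_half mulrA divff // mul1r.
have h5 : nm (z - z') * nm (z + z') <= nm (z - z').
  by rewrite -[leRHS]mulr1 ler_wpM2l ?nm_ge0 //; lra.
rewrite E h4 in h1; lra.
Qed.

(** For [v = c + i k] in real and imaginary parts, the path is [sqrt (1 - s^2 k^2) + i s k], which
    needs no logarithm. *)
Lemma short_path v : unitary v -> nm (v - 1) <= 2^-1 -> exists g : R -> A,
  [/\ g 0 = 1, g 1 = v,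
      forall s, 0 <= s <= 1 -> unitary (g s) /\ nm (g s - 1) <= 2 * nm (v - 1) &
      forall s s', 0 <= s <= 1 -> 0 <= s' <= 1 -> nm (g s - g s') <= `|s - s'|].
Proof.
move=> [v1 v2] dv; set dl := nm (v - 1) in dv *; have dl0 : 0 <= dl by exact: nm_ge0.
pose k : A := - ('i *: (2^-1 *: (v - star v))).
pose c : A := 2^-1 *: (v + star v).
have ks : star k = k.
  rewrite /k starN star_i opprK halfC starZr starB starK.
  by rewrite -scalerN -scalerN opprB.
have cs : star c = c by rewrite /c halfC starZr starD starK addrC.
have vE : v = c + 'i *: k.
  rewrite /k /c scalerN scalerA -expr2 sqrCi scaleN1r opprK -scalerDr.
  by rewrite addrACA subrr addr0 half_dbl.
have ck : c * k = k * c.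
  have pw : (v + star v) * (v - star v) = (v - star v) * (v + star v).
    rewrite mulrDl !mulrBr v1 v2 subrKA mulrBl !mulrDr v1 v2.
    by rewrite opprD addrA addrK.
  rewrite /k /c mulrN mulNr -!scalerAl -!scalerAr !scalerA pw.
  by congr (- (_ *: _)); ring.
have sq : c * c + k * k = 1.
  by rewrite -sa_cartesian // -vE.
have dvs : nm (star v - 1) = dl by rewrite -star1 -starB nm_star.
have inm (x : A) : nm ('i *: x) = nm x by rewrite nmZ normCi mul1r.
have kd : nm k <= dl.
  rewrite /k cnmN inm nm_half -(subrKA 1).
  by have := cnmD (v - 1) (1 - star v); rewrite [nm (1 - star v)]cnm_sub dvs -/dl; lra.
have cd : nm (1 - c) <= dl.
  have -> : 1 - c = 2^-1 *: ((1 - v) + (1 - star v)).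
    by rewrite addrACA -opprD scalerBr half_dbl.
  rewrite nm_half; have := cnmD (1 - v) (1 - star v).
  rewrite [nm (1 - v)]cnm_sub [nm (1 - star v)]cnm_sub dvs -/dl; lra.
clearbody c k.
pose T (s : R) : A := (s ^+ 2)%:C%C *: (k * k).
have kk : nm (k * k) <= dl * dl.
  by apply: le_trans (nmM _ _) _; rewrite ler_pM ?nm_ge0.
have Td s : 0 <= s <= 1 -> nm (T s) <= s ^+ 2 * (dl * dl).
  by move=> s01; rewrite cnmZr ger0_norm ?sqr_ge0 // ler_wpM2l ?sqr_ge0.
have dd : dl * dl <= 2^-1 * dl by rewrite ler_wpM2r.
have T14 s : 0 <= s <= 1 -> nm (T s) <= dl * dl.
  move=> s01; apply: le_trans (Td s s01) _; rewrite -[leRHS]mul1r.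
  by rewrite ler_wpM2r ?mulr_ge0 // expr_le1 //; case/andP: s01.
have /choice[z zP] : forall s, exists z, 0 <= s <= 1 ->
    [/\ (1 - z) * (1 - z) = 1 - T s, star z = z,
        forall x, x * T s = T s * x -> x * z = z * x & nm z <= nm (T s)].
  move=> s; case: (boolP (0 <= s <= 1)) => s01; last by exists 0.
  have T1 : nm (T s) <= 1 by have := T14 s s01; lra.
  have [z [z2 zs zc zn]] := sqrt_exists T1; exists z => _; split => //.
    by apply: zs; rewrite starZr starM ks.
  apply: zn; first exact: nm_ge0.
  have : nm (T s) ^+ 2 <= nm (T s) by rewrite -[leRHS]mulr1 expr2 ler_wpM2l ?nm_ge0.
  lra.
have TT s s' : T s * T s' = T s' * T s.
  by rewrite -!scalerAl -!scalerAr !scalerA [in RHS]mulrC.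
have kT s : k * T s = T s * k by rewrite -scalerAl -scalerAr mulrA.
have zk s : 0 <= s <= 1 -> k * z s = z s * k by move=> /zP[_ _ + _]; apply.
have zz s s' : 0 <= s <= 1 -> 0 <= s' <= 1 -> z s * z s' = z s' * z s.
  move=> /zP[_ _ h _] /zP[_ _ h' _]; apply: h'; apply/esym/h; exact: TT.
have z14 s : 0 <= s <= 1 -> nm (z s) <= dl * dl.
  by move=> s01; have [_ _ _ h] := zP s s01; exact: le_trans h (T14 s s01).
exists (fun s => (1 - z s) + 'i *: (s%:C%C *: k)).
have s0 : 0 <= (0 : R) <= 1 by rewrite lexx ler01.
have s1 : 0 <= (1 : R) <= 1 by rewrite lexx ler01.
split.
- have [_ _ _ z0] := zP 0 s0; have : nm (z 0) = 0.
    apply/eqP; rewrite eq_le nm_ge0 andbT; apply: le_trans z0 _.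
    by rewrite /T expr0n scale0r cnm0.
  by move=> /cnm0_eq0 ->; rewrite subr0 scale0r scaler0 addr0.
- have [z12 _ zc _] := zP 1 s1.
  (* [1 - c] solves the same equation, since [c^2 = 1 - k^2], and both solutions are small. *)
  have zc1 : z 1 = 1 - c.
    apply/eqP; rewrite -subr_eq0; apply/eqP/cnm0_eq0/eqP.
    rewrite eq_le nm_ge0 andbT -(cnm0 (A := A)) -(subrr (T 1)).
    apply: sqrt_lipschitz => //.
    + rewrite mulrBl mulrBr mul1r mulr1; congr (_ - _); apply/esym/zc.
      by rewrite /T -scalerAl -scalerAr !mulrA ck -!mulrA ck.
    + by have := z14 1 s1; lra.
    + by lra.
    + by rewrite subKr /T expr1n scale1r -sq addrK.
  by rewrite zc1 subKr scale1r -vE.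
- move=> s s01; have [zs2 zss zsc zsn] := zP s s01; split.
    apply: sa_unitary; rewrite ?starZr ?ks ?starB ?star1 ?zss //.
      rewrite mulrBl mulrBr mul1r mulr1 -scalerAl -scalerAr; congr (_ - _ *: _).
      by rewrite zk.
    by rewrite zs2 -scalerAl -scalerAr scalerA -rmorphM -expr2 subrK.
  rewrite addrAC [1 - z s]addrC addrK; apply: le_trans (cnmD _ _) _.
  rewrite cnmN inm cnmZr ger0_norm; last by case/andP: s01.
  have := z14 s s01; case/andP: s01 => sa sb.
  have : s * nm k <= 1 * nm k by rewrite ler_wpM2r ?nm_ge0.
  lra.
- move=> s s' s01 s01'; rewrite opprD addrACA.
  apply: le_trans (cnmD _ _) _.
  have -> : 1 - z s - (1 - z s') = z s' - z s by rewrite opprB addrC addrA subrK addrC.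
  have [zs2 _ _ _] := zP s s01; have [zs2' _ _ _] := zP s' s01'.
  have h1 : nm (z s' - z s) <= nm (T s' - T s).
    apply: sqrt_lipschitz => //; first exact: zz.
      by have := z14 s' s01'; lra.
    by have := z14 s s01; lra.
  have h2 : nm (T s' - T s) <= `|s - s'| * (2 * (dl * dl)).
    rewrite -scalerBl -rmorphB cnmZr subr_sqr normrM distrC -mulrA.
    rewrite ler_wpM2l // ler_pM ?nm_ge0 // ger0_norm; case/andP: s01; case/andP: s01'; lra.
  have h3 : nm ('i *: (s%:C%C *: k) - 'i *: (s'%:C%C *: k)) <= `|s - s'| * dl.
    by rewrite -scalerBr -scalerBl -rmorphB inm cnmZr ler_wpM2l.
  (* The bound [dl <= 1 / 2] on the distance from [v] to [1] is what makes the speed at most 1. *)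
  have h4 : `|s - s'| * (2 * (dl * dl) + dl) <= `|s - s'|.
    by rewrite -[leRHS]mulr1 ler_wpM2l //; lra.
  lra.
Qed.

End ShortPath.

(** * Commutators of unitaries and K1-injectivity *)

Section Components.

Lemma component_image (T U : topologicalType) (f : T -> U) (A : set T) (B : set U) x y :
  continuous f -> (forall z, A z -> B (f z)) ->
  connected_component A x y -> connected_component B (f x) (f y).
Proof.
move=> cf AB [C [Cx CA Cc] Cy]; exists (f @` C); last by exists y.
split; [by exists x|by move=> _ [z /CA/AB + <-]|].
by apply: connected_continuous_connected Cc _; exact: continuous_subspaceT.
Qed.

Lemma component_path (R : realType) (T : topologicalType) (g : R -> T) (A : set T) a b :
  a <= b -> {within `[a, b], continuous g} -> (forall s, a <= s <= b -> A (g s)) ->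
  connected_component A (g a) (g b).
Proof.
move=> ab gc gA; exists (g @` `[a, b]); last first.
  by exists b => //=; rewrite in_itv /= ab lexx.
split.
- by exists a => //=; rewrite in_itv /= ab lexx.
- by move=> _ [s /= + <-]; rewrite in_itv /= => /gA.
- by apply: connected_continuous_connected gc; exact: segment_connected.
Qed.

Lemma mx_cvg (T : Type) (U : topologicalType) (F : set_system T) {FF : Filter F}
    m n (f : T -> 'M[U]_(m, n)) (M : 'M[U]_(m, n)) :
  (forall i j, f t i j @[t --> F] --> M i j) -> f t @[t --> F] --> M.
Proof.
move=> fM A [P MP PA]; change (F (f @^-1` A)).
have : F [set t | forall ij : 'I_m * 'I_n, P ij.1 ij.2 (f t ij.1 ij.2)].
  by apply: filter_forall => -[i j]; exact: fM (MP i j).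
by apply: filterS => t h; apply: PA => i j; exact: (h (i, j)).
Qed.

Lemma coord_continuous (U : topologicalType) m n i j :
  continuous (fun M : 'M[U]_(m, n) => M i j).
Proof.
move=> M A /= MA; exists (fun i' j' => if (i', j') == (i, j) then A else setT).
  by move=> i' j'; case: eqP => [[-> ->]//|_]; exact: filterT.
by move=> N /(_ i j); rewrite eqxx.
Qed.

Lemma coord_cvg (T : Type) (U : topologicalType) (F : set_system T)
    m n (f : T -> 'M[U]_(m, n)) (M : 'M[U]_(m, n)) i j :
  f t @[t --> F] --> M -> f t i j @[t --> F] --> M i j.
Proof. by move=> fM A MA; apply: (fM [set N | A (N i j)]); exact: coord_continuous. Qed.

End Components.

(** * Unitary matrices and K1 *)

Section MatrixUnitaries.
Context {R : realType} {D : cstarAlgType R}.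

Lemma adjmxM n (u v : 'M[D]_n) : adjmx (u *m v) = adjmx v *m adjmx u.
Proof.
apply/matrixP => i j; rewrite !mxE star_sum; apply: eq_bigr => k _.
by rewrite !mxE starM.
Qed.

Lemma adjmxK n (u : 'M[D]_n) : adjmx (adjmx u) = u.
Proof. by apply/matrixP => i j; rewrite !mxE starK. Qed.

Lemma unitary_mxM n (u v : 'M[D]_n) :
  unitary_mx u -> unitary_mx v -> unitary_mx (u *m v).
Proof.
move=> [u1 u2] [v1 v2]; split; rewrite adjmxM.
  by rewrite mulmxA -(mulmxA (adjmx v)) u1 mulmx1.
by rewrite mulmxA -(mulmxA u) v2 mulmx1.
Qed.

Lemma unitary_mx_adj n (u : 'M[D]_n) : unitary_mx u -> unitary_mx (adjmx u).
Proof. by move=> [u1 u2]; split; rewrite adjmxK. Qed.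

Lemma adjmx_block m n (a : 'M[D]_m) (b : 'M[D]_(m, n)) (c : 'M[D]_(n, m)) (d : 'M[D]_n) :
  adjmx (block_mx a b c d) =
  block_mx (adjmx a) (map_mx star c^T) (map_mx star b^T) (adjmx d).
Proof. by rewrite /adjmx tr_block_mx map_block_mx. Qed.

Lemma adjmx_scalar n (a : D) : adjmx (a%:M : 'M[D]_n) = (star a)%:M.
Proof.
apply/matrixP => i j; rewrite !mxE eq_sym; case: (i == j) => //=.
by rewrite !mulr0n star0.
Qed.

Lemma map_star_tr_scalar (a : D) : map_mx star (a%:M : 'M[D]_1)^T = (star a)%:M.
Proof. exact: adjmx_scalar. Qed.

Lemma map_star0 m n : map_mx star (0 : 'M[D]_(m, n)) = 0.
Proof. by apply/matrixP => i j; rewrite !mxE star0. Qed.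

Lemma adjmx_stabilize n (u : 'M[D]_n) p : adjmx (stabilize u p) = stabilize (adjmx u) p.
Proof.
by rewrite /stabilize adjmx_block !trmx0 !map_star0 adjmx_scalar star1.
Qed.

Lemma stabilizeM n (u v : 'M[D]_n) p :
  stabilize u p *m stabilize v p = stabilize (u *m v) p.
Proof.
by rewrite /stabilize mulmx_block !mul0mx !mulmx0 !mulmx1 !addr0 !add0r.
Qed.

Lemma stabilize1 n p : stabilize (1%:M : 'M[D]_n) p = 1%:M.
Proof. by rewrite /stabilize -scalar_mx_block. Qed.

Lemma unitary_mx_stabilize n (u : 'M[D]_n) p : unitary_mx u -> unitary_mx (stabilize u p).
Proof.
by move=> [u1 u2]; split; rewrite adjmx_stabilize stabilizeM ?u1 ?u2 stabilize1.
Qed.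

Lemma unitary_scalar n u : unitary u -> unitary_mx (u%:M : 'M[D]_n).
Proof. by move=> [u1 u2]; split; rewrite adjmx_scalar -scalar_mxM ?u1 ?u2. Qed.

(* All stabilizations and casts in [K1_eq] are instances of [extend], which pads
   with an identity block. *)
Definition extend N m (u : 'M[D]_m) : 'M[D]_N :=
  \matrix_(i, j) match insub (val i), insub (val j) with
    | Some i', Some j' => u i' j' | _, _ => (i == j)%:R end.

Lemma castmx_extend N N' (e : N = N') m (u : 'M[D]_m) :
  castmx (e, e) (extend N u) = extend N' u.
Proof. by case: _ / e; rewrite castmx_id. Qed.

Lemma stabilize_extend m (u : 'M[D]_m) p : stabilize u p = extend (m + p) u.
Proof.
apply/matrixP => i j; rewrite /stabilize.
have insubr k : insub (val (rshift m k : 'I_(m + p))) = None :> option 'I_m.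
  by rewrite insubN // -leqNgt leq_addr.
case: (split_ordP i) => i' ->; case: (split_ordP j) => j' ->.
- by rewrite block_mxEul [RHS]mxE /= !valK.
- rewrite block_mxEur [RHS]mxE insubr /= valK mxE.
  by rewrite -val_eqE /= ltn_eqF ?(leq_trans (ltn_ord i')) ?leq_addr.
- rewrite block_mxEdl [RHS]mxE insubr mxE.
  by rewrite -val_eqE /= gtn_eqF ?(leq_trans (ltn_ord j')) ?leq_addr.
- by rewrite block_mxEdr [RHS]mxE insubr mxE (inj_eq (@rshift_inj _ _)).
Qed.

Lemma extend_extend N M m (u : 'M[D]_m) : (m <= M)%N ->
  extend N (extend M u) = extend N u.
Proof.
move=> mM; apply/matrixP => i j; rewrite !mxE.
case: (insubP 'I_M (val i)) => [i' _ ii'|]; last first.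
  rewrite -leqNgt => Mi; rewrite (insubN 'I_m) // -leqNgt; exact: leq_trans Mi.
case: (insubP 'I_M (val j)) => [j' _ jj'|]; last first.
  rewrite -leqNgt => Mj; rewrite (insubN 'I_m (x := val j)) -?leqNgt.
    by case: insub.
  exact: leq_trans Mj.
by rewrite !mxE ii' jj' -val_eqE ii' jj' val_eqE.
Qed.

Lemma unitary_extend N m (u : 'M[D]_m) : (m <= N)%N -> unitary_mx u ->
  unitary_mx (extend N u).
Proof.
move=> mN uU; rewrite -(subnKC mN) -stabilize_extend; exact: unitary_mx_stabilize.
Qed.

Lemma continuous_extend N m : continuous (extend N (m := m)).
Proof.
move=> u; apply: (mx_cvg (F := nbhs u)) => i j; rewrite !mxE.
have -> : (fun v : 'M[D]_m => extend N v i j) = fun v =>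
    match insub (val i), insub (val j) with
    | Some i', Some j' => v i' j' | _, _ => (i == j)%:R end.
  by apply/funext => v; rewrite !mxE.
case: insub => [i'|]; last exact: cvg_cst.
by case: insub => [j'|]; [exact: coord_continuous|exact: cvg_cst].
Qed.

Lemma component_extend N m (u v : 'M[D]_m) : (m <= N)%N ->
  connected_component (@unitary_mx R D m) u v ->
  connected_component (@unitary_mx R D N) (extend N u) (extend N v).
Proof.
move=> mN; apply: component_image; first exact: continuous_extend.
by move=> z; exact: unitary_extend.
Qed.

Lemma K1_eqW (a b : D) n (v : 'M[D]_n) :
  connected_component (@unitary_mx R D 2) (extend 2 (a%:M : 'M[D]_1)) (extend 2 (b%:M : 'M[D]_1)) ->
  K1_eq (a%:M : 'M[D]_1) v -> K1_eq (b%:M : 'M[D]_1) v.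
Proof.
move=> ab [p [q [e h]]].
(* One more stabilization leaves room for the 2x2 matrices of the hypothesis, even when [p = 0]. *)
have e' : (1 + p.+1 = n + q.+1)%N by rewrite !addnS e.
exists p.+1, q.+1, e'; move: h.
rewrite !stabilize_extend !castmx_extend => h.
have leN : (n + q <= n + q.+1)%N by rewrite leq_add2l.
have := component_extend leN h.
rewrite !extend_extend ?leq_addr //; last by rewrite -e leq_addr.
move=> /connected_component_trans; apply.
have le2 : (2 <= n + q.+1)%N by rewrite -e'.
have := component_extend le2 ab.
by rewrite !extend_extend.
Qed.

Lemma K1_class_eq (a b : D) :
  connected_component (@unitary_mx R D 2) (extend 2 (a%:M : 'M[D]_1)) (extend 2 (b%:M : 'M[D]_1)) ->
  K1_class (a%:M : 'M[D]_1) = K1_class (b%:M : 'M[D]_1).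
Proof.
move=> ab; apply/seteqP; split => w [wU h]; split => //.
  exact: K1_eqW h.
exact: K1_eqW (connected_component_sym ab) h.
Qed.

Lemma component_extend1 N (a b : D) : connected_component (@unitary R D) a b ->
  (0 < N)%N ->
  connected_component (@unitary_mx R D N) (extend N (a%:M : 'M[D]_1)) (extend N (b%:M : 'M[D]_1)).
Proof.
move=> ab N0; apply: component_extend => //.
apply: (component_image (f := fun x : D => x%:M : 'M[D]_1)) ab.
  move=> x; apply: (mx_cvg (F := nbhs x)) => i j; rewrite !mxE.
  have -> : (fun t : D => (t%:M : 'M[D]_1) i j) = (fun t => t *+ (i == j)).
    by apply/funext => t; rewrite mxE.
  by rewrite !ord1 eqxx.
by move=> z; exact: unitary_scalar.
Qed.

Lemma continuous_mulmx (T : topologicalType) n (f g : T -> 'M[D]_n) :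
  continuous f -> continuous g -> continuous (fun t => f t *m g t).
Proof.
move=> fc gc t; apply: (mx_cvg (F := nbhs t)) => i j; rewrite !mxE.
have -> : (fun s => (f s *m g s) i j) = (fun s => \sum_k f s i k * g s k j).
  by apply/funext => s; rewrite mxE.
apply: cvg_big => [|k _]; first exact: add_continuous.
by apply: cvg_mul; apply: coord_cvg; [exact: fc|exact: gc].
Qed.

Lemma continuous_adjmx (T : topologicalType) n (f : T -> 'M[D]_n) :
  continuous f -> continuous (fun t => adjmx (f t)).
Proof.
move=> fc t; apply: (mx_cvg (F := nbhs t)) => i j; rewrite !mxE.
have -> : (fun s => (adjmx (f s)) i j) = (fun s => star (f s j i)).
  by apply/funext => s; rewrite !mxE.
by apply: cvg_star; apply: coord_cvg; exact: fc.
Qed.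

Definition commutator_mx n (a b : 'M[D]_n) := a *m b *m adjmx a *m adjmx b.

Lemma commutator_stabilize (u w : D) : commutator_mx
    (stabilize (u%:M : 'M[D]_1) 1) (stabilize (w%:M : 'M[D]_1) 1) =
  stabilize ((u * w * star u * star w)%:M : 'M[D]_1) 1.
Proof.
by rewrite /commutator_mx !adjmx_stabilize !stabilizeM !adjmx_scalar -!scalar_mxM.
Qed.

Lemma commutator_split (u w : D) : unitary u -> unitary w -> commutator_mx
    (stabilize (u%:M : 'M[D]_1) 1) (block_mx 1%:M 0 0 (w%:M : 'M[D]_1)) = 1%:M.
Proof.
move=> [_ u2] [_ w2]; rewrite /commutator_mx adjmx_stabilize adjmx_block.
rewrite !trmx0 !map_star0 !adjmx_scalar star1 /stabilize !mulmx_block.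
rewrite !(mulmx0, mul0mx, mulmx1, mul1mx, addr0, add0r) -!scalar_mxM u2 w2.
by rewrite -scalar_mx_block.
Qed.

Definition rotation (s : R) : 'M[D]_(1 + 1) :=
  block_mx ((cos s)%:C%C *: 1)%:M (- ((sin s)%:C%C *: 1))%:M
           ((sin s)%:C%C *: 1)%:M ((cos s)%:C%C *: 1)%:M.

Lemma rotation_unitary s : unitary_mx (rotation s).
Proof.
have cs : ((cos s)%:C%C *: 1) * ((cos s)%:C%C *: 1) +
          ((sin s)%:C%C *: 1) * ((sin s)%:C%C *: 1) = 1 :> D.
  rewrite -!scalerAl !mul1r !scalerA -scalerDl -!rmorphM -rmorphD /= -!expr2.
  by rewrite cos2Dsin2 scale1r.
have comm (a b : R) : (a%:C%C *: 1 : D) * (b%:C%C *: 1) = (b%:C%C *: 1) * (a%:C%C *: 1).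
  by rewrite -!scalerAl !mul1r !scalerA mulrC.
split; rewrite adjmx_block !map_star_tr_scalar !adjmx_scalar;
  rewrite starN !starZr star1 mulmx_block -!scalar_mxM -!raddfD /=.
  rewrite !mulrN !mulNr opprK cs [X in block_mx _ _ _ X%:M]addrC cs.
  by rewrite !(comm (cos s) (sin s)) ?(subrr, addNr) !raddf0 -scalar_mx_block.
rewrite !mulrN !mulNr opprK cs [X in block_mx _ _ _ X%:M]addrC cs.
by rewrite !(comm (cos s) (sin s)) ?(subrr, addNr) !raddf0 -scalar_mx_block.
Qed.

Lemma rotation_continuous : continuous rotation.
Proof.
have cC (f : R -> R) : continuous f -> continuous (fun s => (f s)%:C%C *: (1 : D)).
  move=> fc s; apply/ccontinuous_nmP => e e0.
  have /cvgrPdist_lt/(_ e e0) := fc s; apply: filterS => r.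
  by rewrite -scalerBl -rmorphB cnmZr nm1 mulr1.
have cM (f : R -> D) : continuous f -> continuous (fun s => (f s)%:M : 'M[D]_1).
  move=> fc s; apply: (mx_cvg (F := nbhs s)) => i j; rewrite mxE !ord1 eqxx mulr1n.
  have -> : (fun t : R => ((f t)%:M : 'M[D]_1) 0 0) = f.
    by apply/funext => t; rewrite mxE eqxx.
  exact: fc.
have cc := cM _ (cC _ (@continuous_cos R)); have sc := cM _ (cC _ (@continuous_sin R)).
have nc : continuous (fun s => (- ((sin s)%:C%C *: 1))%:M : 'M[D]_1).
  by apply: cM => s; apply: cvgN; apply: cC; exact: continuous_sin.
have co (f : R -> 'M[D]_1) i j : continuous f -> continuous (fun s => f s i j).
  by move=> fc s; apply: coord_cvg; exact: fc.
move=> s; apply: (mx_cvg (F := nbhs s)) => i j.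
case: (split_ordP i) => i' ->; case: (split_ordP j) => j' ->.
- rewrite block_mxEul; under eq_fun do rewrite block_mxEul; exact: co.
- rewrite block_mxEur; under eq_fun do rewrite block_mxEur; exact: co.
- rewrite block_mxEdl; under eq_fun do rewrite block_mxEdl; exact: co.
- rewrite block_mxEdr; under eq_fun do rewrite block_mxEdr; exact: co.
Qed.

Lemma rotation0 : rotation 0 = 1%:M.
Proof. by rewrite /rotation cos0 sin0 !scale0r oppr0 scale1r raddf0 -scalar_mx_block. Qed.

Lemma rotation_pihalf (w : D) : rotation (pi / 2) *m stabilize (w%:M : 'M[D]_1) 1 *m
  adjmx (rotation (pi / 2)) = block_mx 1%:M 0 0 (w%:M : 'M[D]_1).
Proof.
rewrite /rotation cos_pihalf sin_pihalf !scale0r !scale1r raddf0 /stabilize.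
rewrite adjmx_block !map_star_tr_scalar starN star1.
rewrite /adjmx trmx0 map_star0 !mulmx_block.
rewrite !(mulmx0, mul0mx, mulmx1, mul1mx, addr0, add0r) -!scalar_mxM.
by rewrite !(mulrN, mulNr, mulr1, mul1r) opprK.
Qed.

(* Conjugating [diag (w, 1)] by rotations joins it to [diag (1, w)], which
   commutes with [diag (u, 1)]. *)
Lemma commutator_component (u w : D) : unitary u -> unitary w ->
  connected_component (@unitary_mx R D (1 + 1))
    (stabilize ((u * w * star u * star w)%:M : 'M[D]_1) 1) 1%:M.
Proof.
move=> uU wU; pose a := stabilize (u%:M : 'M[D]_1) 1.
pose b s := rotation s *m stabilize (w%:M : 'M[D]_1) 1 *m adjmx (rotation s).
have aU : unitary_mx a by apply: unitary_mx_stabilize; exact: unitary_scalar.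
have bU s : unitary_mx (b s).
  apply: unitary_mxM; last exact/unitary_mx_adj/rotation_unitary.
  by apply: unitary_mxM (rotation_unitary s) _; apply: unitary_mx_stabilize; exact: unitary_scalar.
have ac : continuous (fun _ : R => a) by move=> s; exact: cvg_cst.
have bc : continuous b.
  apply: continuous_mulmx; last exact/continuous_adjmx/rotation_continuous.
  by apply: continuous_mulmx rotation_continuous _ => s; exact: cvg_cst.
have := @component_path R _ (fun s => commutator_mx a (b s)) (@unitary_mx R D (1 + 1)) 0 (pi / 2).
rewrite /b rotation0 rotation_pihalf mul1mx adjmx_scalar star1 mulmx1 commutator_stabilize commutator_split //; apply.
- by rewrite divr_ge0 // pi_ge0.
- apply: continuous_subspaceT; apply: continuous_mulmx; last exact: continuous_adjmx.
  apply: continuous_mulmx; last exact: continuous_adjmx.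
  exact: continuous_mulmx.
- move=> s _; apply: unitary_mxM; last exact/unitary_mx_adj/bU.
  apply: unitary_mxM (unitary_mx_adj aU).
  exact: unitary_mxM aU (bU s).
Qed.

(** The commutator is joined to [1] over 2x2 matrices, so its coset and that of [1] have the same
    image in K1. *)
Lemma commutator_unitary0 (u w : D) : K1_injective D -> unitary u -> unitary w ->
  unitary0 (u * w * star u * star w).
Proof.
move=> inj uU wU; set c : D := u * w * star u * star w.
have cU : unitary c.
  apply: unitaryM (unitary_star wU); apply: unitaryM (unitary_star uU).
  exact: unitaryM.
(* The union defining [K1_map] runs over products [a * b] with [b] in the identity component; all
   are joined to [a], so it is a single class. *)
have mapE (a : D) : unitary a -> connected_component (@unitary_mx R D 2)
    (extend 2 (a%:M : 'M[D]_1)) (extend 2 (1%:M : 'M[D]_1)) ->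
    K1_map (unitary_coset a) = K1_class (1%:M : 'M[D]_1).
  move=> aU a1; apply/seteqP; split => x.
    move=> [_ [b bU0 <-] h]; rewrite -(K1_class_eq a1).
    suff ab : connected_component (@unitary R D) a (a * b).
      by rewrite (K1_class_eq (component_extend1 ab (ltn0Sn 1))).
    rewrite -[X in connected_component _ X]mulr1.
    apply: (component_image (f := fun z => a * z)) bU0.
      by move=> z; apply: cvg_mul => //; exact: cvg_cst.
    by move=> z; exact: unitaryM.
  move=> x1; exists a; last by rewrite (K1_class_eq a1).
  exists 1; last by rewrite mulr1.
  exact: connected_component_refl unitary1.
have : unitary_coset c = unitary_coset 1.
  apply: inj; rewrite ?inE; [by exists c|by exists 1 => //; exact: unitary1|].
  rewrite !mapE //.
  - exact: unitary1.
  - exact/connected_component_refl/unitary_extend/unitary_scalar/unitary1.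
  - have := commutator_component uU wU; rewrite -(stabilize1 1 1).
    by rewrite !stabilize_extend.
move=> E; have : unitary_coset 1 c.
  by rewrite -E; exists 1; rewrite ?mulr1 //; exact: connected_component_refl unitary1.
by move=> [w' w'0 <-]; rewrite mul1r.
Qed.

End MatrixUnitaries.

(** * The basic homotopy lemma *)

Section UnitaryComponent.
Context {R : realType} {D : cstarAlgType R}.
Implicit Types u v x y z : D.

(** The short path from [1] to [star x * y], translated by [x]. *)
Lemma unitary_near x y : unitary x -> unitary y -> nm (x - y) <= 2^-1 ->
  connected_component (@unitary R D) x y.
Proof.
move=> xU yU xy; have vU := unitaryM (unitary_star xU) yU.
have [|g [g0 g1 gU gL]] := short_path vU.
  rewrite -(proj1 xU) -mulrBr (nm_unitaryl _ (unitary_star xU)).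
  by rewrite cnm_sub.
have := @component_path R D (fun s => x * g s) (@unitary R D) 0 1.
rewrite g0 g1 mulr1 mulrA (proj2 xU) mul1r; apply.
- exact: ler01.
- apply/subspace_continuousP => s /=; rewrite in_itv /= => s01.
  apply/ccvg_nmP => e e0.
  rewrite near_withinE; near=> r => /=; rewrite in_itv /= => r01.
  rewrite -mulrBr (nm_unitaryl _ xU); apply: le_lt_trans (gL _ _ s01 r01) _.
  near: r; exact: (@cvgr_dist_lt _ _ _ (nbhs s) _ id s).
- by move=> s /gU[sU _]; exact: unitaryM.
Unshelve. all: by end_near. Qed.

Lemma unitary0_unitary u : unitary0 u -> unitary u.
Proof. exact: connected_component_sub. Qed.

Lemma unitary0_near u v : unitary0 u -> unitary v -> nm (u - v) <= 2^-1 -> unitary0 v.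
Proof.
move=> u0 vU uv; apply: (connected_component_trans (y := u)) => //.
exact: unitary_near (unitary0_unitary u0) vU uv.
Qed.

Lemma unitary0M u v : unitary0 u -> unitary0 v -> unitary0 (u * v).
Proof.
move=> u0 v0; apply: (connected_component_trans u0).
rewrite -[X in connected_component _ X]mulr1.
apply: (component_image (f := fun z => u * z)) v0.
  by move=> z; apply: cvg_mul => //; exact: cvg_cst.
by move=> z; apply: unitaryM; exact: unitary0_unitary.
Qed.

Lemma unitary0_star u : unitary0 u -> unitary0 (star u).
Proof.
move=> u0; have := @component_image _ _ (fun z : D => star z : D)
  (@unitary R D) (@unitary R D) _ _ _ _ u0.
rewrite star1; apply; last by move=> z; exact: unitary_star.
by move=> z; apply: cvg_star.
Qed.

Hypothesis K1_inj : K1_injective D.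

(** [ga u] is within [1 / 2] of some [w * u * star w], so the product is as close to the commutator
    of [u] and [w]. *)
Lemma unitary0_defect (ga : D -> D) u : unital_hom ga -> approx_equiv id ga ->
  unitary u -> unitary0 (u * star (ga u)).
Proof.
move=> [gh g1] ig uU.
have [|w wU /(_ u)] := ig [:: u] (2^-1); first by rewrite invr_gt0.
rewrite inE eqxx => /(_ isT) h.
apply: unitary0_near (commutator_unitary0 K1_inj uU wU) _ _.
  by exact: unitaryM uU (unitary_star (hom_unitary gh g1 uU)).
have -> : u * w * star u * star w = u * star (w * u * star w).
  by rewrite !starM starK !mulrA.
by rewrite -mulrBr (nm_unitaryl _ uU) -starB nm_star ltW.
Qed.

(** As [ga' w] commutes with the range of [ga], the factor [star (ga' w)] does not affect the
    approximation; [star (ga' w) * w] is the adjoint of the defect of [star w]. *)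
Lemma approx_unitary0 (ga ga' : D -> D) : unital_hom ga' ->
  commuting ga ga' -> approx_equiv id ga -> approx_equiv id ga' ->
  forall (F : seq D) (e : R), 0 < e ->
  exists2 u, unitary0 u & forall d, d \in F -> nm (u * d * star u - ga d) < e.
Proof.
move=> gu' comm ig ig' F e e0; have [w wU h] := ig F e e0.
have [gh' g1'] := gu'; have gwU := hom_unitary gh' g1' wU.
exists (star (ga' w) * w) => [|d /h].
  have := unitary0_star (unitary0_defect gu' ig' (unitary_star wU)).
  by rewrite (homS gh') starK starM starK.
apply: le_lt_trans; rewrite starM starK /=.
have E : ga d = star (ga' w) * ga d * ga' w by rewrite -mulrA comm mulrA (proj1 gwU) mul1r.
rewrite {1}E -!mulrA -mulrBr (nm_unitaryl _ (unitary_star gwU)) !mulrA -mulrBl.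
by rewrite (nm_unitaryr _ gwU).
Qed.

End UnitaryComponent.

Section Chains.
Context {T : Type}.

Fixpoint chained (S : T -> T -> Prop) (P : T -> Prop) x l z : Prop :=
  if l is y :: l' then [/\ P x, S x y & chained S P y l' z] else P x /\ x = z.

Definition chain S P x z := exists l, chained S P x l z.

Lemma chain_refl S P x : P x -> chain S P x x.
Proof. by exists [::]. Qed.

Lemma chain_step S P x y z : P x -> S x y -> chain S P y z -> chain S P x z.
Proof. by move=> Px xy [l h]; exists (y :: l). Qed.

Lemma chain_trans S P x y z : chain S P x y -> chain S P y z -> chain S P x z.
Proof.
move=> [l]; elim: l x => [|x' l IH] x /= [Px]; first by move=> ->.
by move=> xx' h k; apply: chain_step xx' _ => //; exact: IH.
Qed.

Lemma chain_rcons S P x y z : chain S P x y -> S y z -> P y -> P z -> chain S P x z.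
Proof.
move=> xy yz Py Pz; apply: chain_trans xy _.
by apply: chain_step yz _ => //; exact: chain_refl.
Qed.

End Chains.

Lemma chain_map (T U : Type) (f : T -> U) (S : T -> T -> Prop) (P : T -> Prop)
    (S' : U -> U -> Prop) (P' : U -> Prop) x z :
  (forall y, P y -> P' (f y)) -> (forall y y', S y y' -> S' (f y) (f y')) ->
  chain S P x z -> chain S' P' (f x) (f z).
Proof.
move=> PP SS [l]; elim: l x => [|y l IH] x /= [Px].
  by move=> <-; apply: chain_refl; exact: PP.
by move=> xy /IH; apply: chain_step; [exact: PP|exact: SS].
Qed.

Section BasicHomotopy.
Context {R : realType} {D : cstarAlgType R}.
Implicit Types u v x y z d : D.

Definition near_step (dl : R) x y : Prop := nm (x - y) < dl.

Lemma unitary0_chain u (dl : R) : 0 < dl -> unitary0 u ->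
  chain (near_step dl) (@unitary R D) 1 u.
Proof.
move=> dl0 u0; set C := @unitary0 R D.
have openU (Q : set D) : open [set x | exists2 z, Q z & nm (x - z) < dl].
  rewrite openE => x [z Qz xz]; apply/nbhs_nmP.
  exists (dl - nm (x - z)); first by rewrite subr_gt0.
  move=> y xy; exists z => //; apply: le_lt_trans (cnm_tri x _ _) _.
  by rewrite cnm_sub -ltrBrDr.
pose B := [set x | C x /\ chain (near_step dl) (@unitary R D) 1 x].
suff : B = C by move=> BC; have [] : B u by rewrite BC.
apply: (@component_connected D (@unitary R D) 1).
- exists 1; split; first exact/connected_component_refl/unitary1.
  exact/chain_refl/unitary1.
- exists [set x | exists2 z, B z & nm (x - z) < dl]; first exact: openU.
  apply/seteqP; split => x.
    by move=> Bx; split; [case: Bx|exists x => //; rewrite subrr cnm0].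
  move=> [Cx [z [Cz ch] xz]]; split => //; apply: chain_rcons ch _ _ _.
  + by rewrite /near_step cnm_sub.
  + exact: unitary0_unitary.
  + exact: unitary0_unitary.
- exists (~` [set x | exists2 z, C z /\ ~ B z & nm (x - z) < dl]).
    exact/open_closedC/openU.
  apply/seteqP; split => x.
    move=> [Cx ch]; split => // -[z [Cz nBz] xz]; apply: nBz; split => //.
    by apply: chain_rcons ch _ _ _ => //; exact: unitary0_unitary.
  move=> [Cx /= nx]; apply: contrapT => nB; apply: nx; exists x => //.
  by rewrite subrr cnm0.
Qed.

Definition commutes_within (F : seq D) (e : R) z : Prop :=
  unitary z /\ forall d, d \in F -> nm (z * d - d * z) < e.

Lemma nm_comm_near z x y (e : R) : unitary z -> nm (x - y) < e ->
  nm (z * y - y * z) < nm (z * x - x * z) + 2 * e.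
Proof.
move=> zU xy.
have -> : z * y - y * z = (z * x - x * z) - (z * (x - y) - (x - y) * z).
  have -> : z * (x - y) - (x - y) * z = (z * x - x * z) - (z * y - y * z).
    rewrite mulrBr mulrBl !opprB addrACA [RHS]addrACA; congr (_ + _).
    by rewrite addrC.
  by rewrite subKr.
have := cnmB (z * x - x * z) (z * (x - y) - (x - y) * z).
have := cnmB (z * (x - y)) ((x - y) * z).
rewrite nm_unitaryl // nm_unitaryr //; lra.
Qed.

Lemma nm_conj_comm u x : unitary u -> nm (u * x * star u - x) = nm (u * x - x * u).
Proof.
by move=> uU; rewrite -[RHS](nm_unitaryr _ (unitary_star uU)) mulrBl -(mulrA x) (proj2 uU) mulr1.
Qed.

(* With [w be(d) w* ~ al(d)] on [F], the path [w al(c) w*], [c] from [1] to [u],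
   almost commutes with [al(F)]; it ends close to [al(u)] because [u] almost
   commutes with the finitely many first legs of [w], and it is finally carried
   back along [al ~ id]. *)
Lemma basic_homotopy (al be : D -> D) : unital_hom al -> unital_hom be ->
  commuting al be -> tensor_dense al be ->
  approx_equiv id al -> approx_equiv id be ->
  forall (F : seq D) (e dl : R), 0 < e -> 0 < dl ->
  exists (G : seq D) (eta : R), 0 < eta /\ forall u, unitary0 u ->
    (forall d, d \in G -> nm (u * d - d * u) < eta) ->
    chain (near_step dl) (commutes_within F e) 1 u.
Proof.
move=> [ah a1] [bh b1] comm dn ial ibe F e dl e0 dl0.
have e8 : 0 < e / 8 by rewrite divr_gt0.
have d8 : 0 < dl / 8 by rewrite divr_gt0.
have [w wU hw] := approx_equiv_trans (approx_equiv_sym ibe) ial F e8.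
have [s ws] := dn w _ d8.
pose M : R := \sum_(p <- s) nm (be p.2).
have M0 : 0 <= M by apply: sumr_ge0 => p _; exact: nm_ge0.
pose eta := Num.min (e / 2) (dl / (4 * (M + 1))).
have eta0 : 0 < eta.
  by rewrite lt_min !divr_gt0 // mulr_gt0 // ltr_wpDl.
have eta_e : eta <= e / 2 by rewrite ge_min lexx.
have eta_d : eta * M <= dl / 4.
  have : eta * (4 * (M + 1)) <= dl.
    by rewrite -ler_pdivlMr ?mulr_gt0 ?ltr_wpDl // ge_min lexx orbT.
  have : 0 <= eta by exact: ltW.
  lra.
exists (F ++ [seq p.1 | p <- s]), eta; split => // u u0 hu.
have uU := unitary0_unitary u0; have auU := hom_unitary ah a1 uU.
have uF d : d \in F -> nm (u * d - d * u) < eta.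
  by move=> dF; apply: hu; rewrite mem_cat dF.
have auw : nm (al u * w - w * al u) < dl.
  have h1 := @nm_comm_near (al u) (tensor_sum al be s) w (dl / 8) auU.
  have h2 : nm (al u * tensor_sum al be s - tensor_sum al be s * al u) <= eta * M.
    rewrite /tensor_sum mulr_sumr mulr_suml -sumrB /M mulr_sumr.
    apply: le_trans (cnm_sum _ _ _) _; rewrite big_seq [leRHS]big_seq.
    apply: ler_sum => p ps.
    have -> : al u * (al p.1 * be p.2) - al p.1 * be p.2 * al u =
       al (u * p.1 - p.1 * u) * be p.2.
      by rewrite (homB ah) !(homM ah) mulrBl !mulrA -[in X in _ - X = _]mulrA -comm !mulrA.
    apply: le_trans (nmM _ _) _; rewrite ler_wpM2r ?nm_ge0 //.
    apply: le_trans (hom_contr ah _ a1) _; apply/ltW/hu.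
    by rewrite mem_cat map_f // orbT.
  have h3 := h1 _; rewrite cnm_sub in h3; have := h3 ws; lra.
pose P1 z := unitary z /\ forall d, d \in F -> nm (z * al d - al d * z) < e / 2.
have wP z : unitary z -> P1 (w * al z * star w).
  move=> zU; have azU := hom_unitary ah a1 zU.
  have wzU := unitaryM (unitaryM wU azU) (unitary_star wU).
  split => // d /hw h; have := nm_comm_near wzU h.
  suff -> : w * al z * star w * (w * be d * star w) =
            w * be d * star w * (w * al z * star w).
    by rewrite subrr cnm0; lra.
  rewrite !mulrA -(mulrA _ (star w) w) (proj1 wU) mulr1 -(mulrA _ (star w) w) (proj1 wU) mulr1.
  by rewrite -(mulrA w) comm mulrA.
have ch1 : chain (near_step dl) P1 1 (al u).
  apply: (@chain_rcons _ _ _ _ (w * al u * star w)).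
  - have E1 : 1 = w * al 1 * star w by rewrite a1 mulr1 (proj2 wU).
    rewrite {1}E1.
    apply: (chain_map (f := fun z => w * al z * star w) _ _ (unitary0_chain dl0 u0)) => [z|z z'].
      exact: wP.
    rewrite /near_step -mulrBl nm_unitaryr; last exact: unitary_star.
    by rewrite -mulrBr nm_unitaryl // -(homB ah); apply: le_lt_trans (hom_contr ah _ a1).
  - by rewrite /near_step nm_conj_comm // cnm_sub.
  - exact: wP.
  - split => // d dF; rewrite -!(homM ah) -(homB ah).
    by apply: le_lt_trans (hom_contr ah _ a1) _; have := uF d dF; lra.
have m0 : 0 < Num.min (e / 8) dl by rewrite lt_min e8.
have [y yU hy] := approx_equiv_sym ial (u :: F) m0.
have ych z : P1 z -> commutes_within F e (y * z * star y).
  move=> [zU zF]; split; first exact: unitaryM (unitaryM yU zU) (unitary_star yU).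
  move=> d dF; have : nm (y * al d * star y - d) < e / 8.
    by have := hy d; rewrite inE dF orbT lt_min => /(_ isT)/andP[].
  move/(nm_comm_near (unitaryM (unitaryM yU zU) (unitary_star yU))).
  have -> : y * z * star y * (y * al d * star y) - y * al d * star y * (y * z * star y) =
      y * (z * al d - al d * z) * star y.
    rewrite !mulrA -(mulrA _ (star y) y) (proj1 yU) mulr1 -(mulrA _ (star y) y) (proj1 yU) mulr1.
    by rewrite mulrBr mulrBl !mulrA.
  rewrite nm_unitaryr; last exact: unitary_star.
  by rewrite nm_unitaryl //; have := zF d dF; lra.
apply: (@chain_rcons _ _ _ _ (y * al u * star y)).
- have E1 : 1 = y * 1 * star y by rewrite mulr1 (proj2 yU).
  rewrite {1}E1; apply: (chain_map (f := fun z => y * z * star y) ych _ ch1) => z z'.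
  rewrite /near_step -mulrBl nm_unitaryr; last exact: unitary_star.
  by rewrite -mulrBr nm_unitaryl.
- by have := hy u; rewrite inE eqxx lt_min => /(_ isT)/andP[].
- apply: ych; split => // d dF; rewrite -!(homM ah) -(homB ah).
  by apply: le_lt_trans (hom_contr ah _ a1) _; have := uF d dF; lra.
- by split => // d /uF; lra.
Qed.

End BasicHomotopy.

(** * Asymptotically inner embeddings *)

Section Stream.
Context {T : Type}.
Variables (S : nat -> T -> T -> Prop) (P : nat -> T -> Prop) (x : nat -> T).
Hypothesis S_refl : forall k z, S k z z.

(* The state is (level, current point, rest of the chain of that level). *)
Lemma chain_stream : (forall k, chain (S k) (P k) (x k) (x k.+1)) ->
  exists (g : nat -> T) (kap : nat -> nat), [/\ g 0%N = x 0%N,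
    forall n, P (kap n) (g n), forall n, S (kap n) (g n) (g n.+1)
    & forall K, exists N, forall n, (N <= n)%N -> (K <= kap n)%N].
Proof.
move=> /choice[L LP].
pose next (st : nat * T * seq T) := let: (k, cur, l) := st in
  if l is y :: l' then (k, y, l') else (k.+1, cur, L k.+1).
pose st n := iter n next (0%N, x 0%N, L 0%N).
pose inv (s : nat * T * seq T) := chained (S s.1.1) (P s.1.1) s.1.2 s.2 (x s.1.1.+1).
have invP n : inv (st n).
  elim: n => [|n]; first exact: LP.
  rewrite /st iterS -/(st n); case: (st n) => [[k cur] [|y l]]; rewrite /inv /=.
    by move=> [_ ->]; exact: LP.
  by move=> [].
have mono n : ((st n).1.1 <= (st n.+1).1.1)%N.
  by rewrite /st iterS -/(st n); case: (st n) => [[k cur] [|y l]] /=.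
have monoD n m : ((st n).1.1 <= (st (n + m)%N).1.1)%N.
  elim: m => [|m IH]; first by rewrite addn0.
  by rewrite addnS; exact: leq_trans IH (mono _).
have grow l : forall n, (st n).2 = l -> exists m, (st (n + m)%N).1.1 = (st n).1.1.+1.
  elim: l => [|y l IH] n nl.
    exists 1%N; rewrite addn1 /st iterS -/(st n).
    by move: nl; case: (st n) => [[k cur] l'] /= ->.
  have [m mE] : exists m, (st (n.+1 + m)%N).1.1 = (st n.+1).1.1.+1.
    by apply: IH; rewrite /st iterS -/(st n); move: nl; case: (st n) => [[k cur] l'] /= ->.
  exists m.+1; rewrite addnS -addSn mE; congr _.+1.
  by rewrite /st iterS -/(st n); move: nl; case: (st n) => [[k cur] l'] /= ->.
exists (fun n => (st n).1.2), (fun n => (st n).1.1); split => //.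
- by move=> n; have := invP n; case: (st n) => [[k cur] [|y l]] /= [].
- move=> n; have := invP n; rewrite /st iterS -/(st n).
  by case: (st n) => [[k cur] [|y l]] /=; [move=> _; exact: S_refl|case].
- move=> K; suff [N NK] : exists N, (K <= (st N).1.1)%N.
    exists N => n /subnKC <-; exact: leq_trans NK (monoD _ _).
  elim: K => [|K [N NK]]; first by exists 0%N.
  have [m mE] := grow _ N erefl; exists (N + m)%N; rewrite mE ltnS; exact: NK.
Qed.
End Stream.

Section AsymptoticPath.
Context {R : realType} {D : cstarAlgType R}.

Lemma separable_seq : separable D ->
  exists e : nat -> D, forall d (r : R), 0 < r -> exists n, nm (d - e n) < r.
Proof.
move=> [S cS /cdense_nmP dS].
have [f fi] := countable_injP _ cS.
pose e n := if pselect (exists2 d, S d & f d = n) is left h then s2val (cid2 h) else 0.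
exists e => d r r0; have [y Sy dy] := dS d r r0.
exists (f y); rewrite /e; case: pselect => [h|[]]; last by exists y.
case: (cid2 h) => z Sz fz /=.
by rewrite (fi z y) // inE.
Qed.

Lemma unitary_sequence (ga : D -> D) : separable D -> unital_hom ga ->
  (forall (F : seq D) (e : R), 0 < e ->
     exists2 u, unitary0 u & forall d, d \in F -> nm (u * d * star u - ga d) < e) ->
  (forall (F : seq D) (e dl : R), 0 < e -> 0 < dl ->
    exists (G : seq D) (eta : R), 0 < eta /\ forall u : D, unitary0 u ->
      (forall d, d \in G -> nm (u * d - d * u) < eta) ->
      chain (near_step dl) (commutes_within F e) 1 u) ->
  exists g : nat -> D, [/\ g 0%N = 1, forall n, unitary (g n),
    forall n, nm (g n - g n.+1) <= 2^-1,
    forall e : R, 0 < e -> exists N, forall n, (N <= n)%N -> nm (g n - g n.+1) < e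
    & forall d (e : R), 0 < e -> exists N, forall n, (N <= n)%N ->
        nm (g n * d * star (g n) - ga d) < e].
Proof.
move=> /separable_seq[ds dsP] [gh g1] inn bh.
pose F k := [seq ds i | i <- iota 0 k].
pose ep k : R := 2^-1 ^+ k.+1.
have ep0 k : 0 < ep k by rewrite exprn_gt0 // invr_gt0.
have epS k : ep k.+1 <= ep k.
  by have := ep0 k; rewrite /ep (exprS _ k.+1); lra.
have /choice[GE GEP] : forall k, exists GE : seq D * R, 0 < GE.2 /\ forall u, unitary0 u ->
    (forall d, d \in GE.1 -> nm (u * d - d * u) < GE.2) ->
    chain (near_step (ep k)) (commutes_within (F k) (ep k)) 1 u.
  by move=> k; have [G [eta h]] := bh (F k) _ _ (ep0 k) (ep0 k); exists (G, eta).
pose tol k := Num.min (ep k) (Num.min ((GE k).2 / 2) ((GE k.-1).2 / 2)).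
have tol0 k : 0 < tol k.
  by rewrite !lt_min ep0 !divr_gt0 //; [case: (GEP k.-1)|case: (GEP k)].
have /choice[u uP] : forall k, exists u, unitary0 u /\ forall d,
    d \in F k ++ (GE k).1 ++ (GE k.-1).1 -> nm (u * d * star u - ga d) < tol k.
  by move=> k; have [u u0 h] := inn (F k ++ (GE k).1 ++ (GE k.-1).1) _ (tol0 k); exists u.
pose S k (y z : D) := nm (y - z) < ep k.
pose P k (z : D) := unitary z /\ forall d, d \in F k -> nm (z * d * star z - ga d) < 2 * ep k.
pose x k := if k is 0%N then 1 else u k.
have xchain k : chain (S k) (P k) (x k) (x k.+1).
  case: k => [|k].
    exact: (chain_map (f := id) _ _ (unitary0_chain (ep0 0%N) (proj1 (uP 1%N)))).
  have [uk0 ukP] := uP k.+1; have [uk0' ukP'] := uP k.+2.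
  have ukU := unitary0_unitary uk0; have ukU' := unitary0_unitary uk0'.
  pose v := star (u k.+1) * u k.+2.
  have v0 : unitary0 v by apply: unitary0M uk0'; exact: unitary0_star.
  have vU := unitary0_unitary v0.
  have vc : chain (near_step (ep k.+1)) (commutes_within (F k.+1) (ep k.+1)) 1 v.
    apply: (proj2 (GEP k.+1)) => // d dG.
    have h1 : nm (u k.+1 * d * star (u k.+1) - ga d) < (GE k.+1).2 / 2.
      have := ukP d; rewrite !mem_cat dG orbT => /(_ isT).
      by rewrite !lt_min => /and3P[].
    have h2 : nm (u k.+2 * d * star (u k.+2) - ga d) < (GE k.+1).2 / 2.
      have := ukP' d; rewrite !mem_cat dG !orbT => /(_ isT).
      by rewrite !lt_min => /and3P[].
    rewrite -nm_conj_comm // -(nm_unitaryl _ ukU) -(nm_unitaryr _ (unitary_star ukU)).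
    have -> : u k.+1 * (v * d * star v - d) * star (u k.+1) =
        u k.+2 * d * star (u k.+2) - u k.+1 * d * star (u k.+1).
      rewrite mulrBr mulrBl /v starM starK !mulrA (proj2 ukU) mul1r.
      by rewrite -(mulrA _ (u k.+1)) (proj2 ukU) mulr1.
    apply: le_lt_trans (cnm_tri (ga d) _ _) _.
    by rewrite [X in _ + X]cnm_sub; lra.
  have -> : x k.+1 = u k.+1 * 1 by rewrite mulr1.
  have -> : x k.+2 = u k.+1 * v by rewrite /v mulrA (proj2 ukU) mul1r.
  apply: (chain_map (f := fun z => u k.+1 * z) _ _ vc) => [z [zU zF]|z z']; last first.
    by rewrite /near_step /S -mulrBr nm_unitaryl.
  split; first exact: unitaryM.
  move=> d dF; have h1 : nm (u k.+1 * d * star (u k.+1) - ga d) < ep k.+1.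
    have := ukP d; rewrite !mem_cat dF => /(_ isT).
    by rewrite !lt_min => /and3P[].
  apply: le_lt_trans (cnm_tri (u k.+1 * d * star (u k.+1)) _ _) _.
  have -> : nm (u k.+1 * z * d * star (u k.+1 * z) - u k.+1 * d * star (u k.+1)) =
      nm (z * d - d * z).
    rewrite -(nm_conj_comm _ zU) -[RHS](nm_unitaryl _ ukU) -[RHS](nm_unitaryr _ (unitary_star ukU)).
    by rewrite mulrBr mulrBl starM !mulrA.
  by have := zF d dF; lra.
have S_refl k z : S k z z by rewrite /S subrr cnm0.
have [g [kap [g0 gP gS gK]]] := chain_stream S_refl xchain.
have ep_le k : ep k <= 2^-1.
  elim: k => [|k]; first by rewrite /ep expr1.
  exact: le_trans (epS k).
have ep_small (e : R) : 0 < e -> exists K, forall k, (K <= k)%N -> 4 * ep k < e.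
  move=> e0; have /cvgrPdist_lt/(_ (e / 4)) : (2^-1 : R) ^+ n @[n --> \oo] --> 0.
    by apply: cvg_expr; rewrite ger0_norm // invf_lt1 // ltr1n.
  rewrite divr_gt0 // => /(_ isT)[K _ KP]; exists K => k Kk.
  have := KP k.+1 (leq_trans Kk (leqnSn k)).
  rewrite /= sub0r normrN ger0_norm ?ltW ?(ep0 k) // -/(ep k); lra.
exists g; split => //.
- by move=> n; case: (gP n).
- by move=> n; have := gS n; rewrite /S => /ltW h; exact: le_trans h (ep_le _).
- move=> e e0; have [K KP] := ep_small e e0; have [N NP] := gK K.
  exists N => n /NP/KP; have := gS n; rewrite /S; have := ep0 (kap n); lra.
- move=> d e e0; have e4 : 0 < e / 4 by rewrite divr_gt0.
  have [i di] := dsP d _ e4.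
  have [K KP] := ep_small (e) e0; have [N NP] := gK (maxn K i.+1).
  exists N => n /NP; rewrite geq_max => /andP[/KP kk ik].
  have [gU gF] := gP n.
  have h : nm (g n * ds i * star (g n) - ga (ds i)) < 2 * ep (kap n).
    by apply: gF; rewrite map_f // mem_iota.
  have h1 : nm (g n * d * star (g n) - g n * ds i * star (g n)) = nm (d - ds i).
    by rewrite -mulrBl -mulrBr nm_unitaryr ?nm_unitaryl //; exact: unitary_star.
  have h2 : nm (ga (ds i) - ga d) <= nm (d - ds i).
    by rewrite cnm_sub -(homB gh); exact: hom_contr.
  have := cnm_tri (g n * ds i * star (g n)) (g n * d * star (g n)) (ga d).
  have := cnm_tri (ga (ds i)) (g n * ds i * star (g n)) (ga d).
  rewrite h1; lra.
Qed.

Lemma lipschitz_glue (f : R -> D) :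
  (forall (n : nat) s t, n%:R <= s -> s <= t -> t <= n.+1%:R -> nm (f s - f t) <= t - s) ->
  forall s t, 0 <= s -> s <= t -> nm (f s - f t) <= t - s.
Proof.
move=> fL s t s0 st.
pose n := Num.truncn s; have ns : n%:R <= s by rewrite truncn_le.
have sn : s < n.+1%:R by rewrite truncnS_gt.
have key m : forall t, s <= t -> t <= (n + m)%N.+1%:R -> nm (f s - f t) <= t - s.
  elim: m => [|m IH] r sr rm; first by apply: (fL n) => //; rewrite addn0 in rm.
  have [rm'|mr] := leP r (n + m)%N.+1%:R; first exact: IH.
  have sm : s <= (n + m)%N.+1%:R.
    by apply: le_trans (ltW sn) _; rewrite ler_nat ltnS leq_addr.
  apply: le_trans (cnm_tri (f (n + m)%N.+1%:R) _ _) _.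
  have h1 := IH _ sm (lexx _).
  have h2 : nm (f (n + m)%N.+1%:R - f r) <= r - (n + m)%N.+1%:R.
    by apply: (fL (n + m)%N.+1) => //; [exact: ltW|rewrite -addnS].
  lra.
apply: (key (Num.truncn t)) => //.
have t1 : t < (Num.truncn t).+1%:R by rewrite truncnS_gt.
by apply: le_trans (ltW t1) _; rewrite ler_nat ltnS leq_addl.
Qed.

Lemma unitary_path (ga : D -> D) (g : nat -> D) : g 0%N = 1 -> (forall n, unitary (g n)) ->
  (forall n, nm (g n - g n.+1) <= 2^-1) ->
  (forall e : R, 0 < e -> exists N, forall n, (N <= n)%N -> nm (g n - g n.+1) < e) ->
  (forall d (e : R), 0 < e -> exists N, forall n, (N <= n)%N ->
        nm (g n * d * star (g n) - ga d) < e) ->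
  exists w : R -> D, [/\ w 0 = 1, forall t, 0 <= t -> unitary (w t),
    forall s t, 0 <= s -> s <= t -> nm (w s - w t) <= t - s
    & forall d (e : R), 0 < e -> exists M : R, forall t, 0 <= t -> M <= t ->
        nm (w t * d * star (w t) - ga d) < e].
Proof.
move=> g0 gU gh gs gd.
pose v n : D := star (g n) * g n.+1.
have vU n : unitary (v n) by apply: unitaryM => //; exact: unitary_star.
have v1 n : nm (v n - 1) = nm (g n - g n.+1).
  have -> : v n - 1 = star (g n) * (g n.+1 - g n) by rewrite mulrBr (proj1 (gU n)).
  by rewrite (nm_unitaryl _ (unitary_star (gU n))) cnm_sub.
have vs n : nm (v n - 1) <= 2^-1 by rewrite v1.
have /choice[h hP] := fun n => short_path (vU n) (vs n).
pose w t := g (Num.truncn t) * h (Num.truncn t) (t - (Num.truncn t)%:R).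
have trn (t : R) : 0 <= t -> 0 <= t - (Num.truncn t)%:R <= 1.
  move=> t0; apply/andP; split; first by rewrite subr_ge0 truncn_le.
  by rewrite lerBlDl natr1 ltW // truncnS_gt.
have wE (n : nat) t : n%:R <= t -> t <= n.+1%:R -> w t = g n * h n (t - n%:R).
  move=> nt tn; have t0 : 0 <= t by apply: le_trans nt.
  have [tlt|nle] := ltP t n.+1%:R.
    by rewrite /w (_ : Num.truncn t = n) //; apply: truncn_def; rewrite nt tlt.
  have -> : t = n.+1%:R by apply/eqP; rewrite eq_le tn nle.
  rewrite /w natrK subrr -natr1 addrC addKr.
  case: (hP n.+1) (hP n) => -> _ _ _ [_ -> _ _].
  by rewrite mulr1 /v mulrA (proj2 (gU n)) mul1r.
exists w; split.
- rewrite (wE 0%N) // ?ler01 // subr0; case: (hP 0%N) => -> _ _ _.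
  by rewrite mulr1.
- move=> t t0; apply: unitaryM => //; case: (hP (Num.truncn t)) => _ _ + _.
  by move=> /(_ _ (trn t t0))[].
- apply: lipschitz_glue => n s t ns st tn.
  rewrite (wE n s) // ?(le_trans st) // (wE n t) // ?(le_trans ns) //.
  rewrite -mulrBr nm_unitaryl //; case: (hP n) => _ _ _ hL.
  apply: le_trans (hL _ _ _ _) _.
  + rewrite subr_ge0 ns /= lerBlDl natr1; exact: le_trans st tn.
  + rewrite subr_ge0 (le_trans ns st) /= lerBlDl natr1; exact: tn.
  + by rewrite opprB subrKA distrC ger0_norm ?subr_ge0.
- move=> d e e0.
  have dd : 0 < 8 * (nm d + 1) by rewrite mulr_gt0 // ltr_wpDl ?nm_ge0.
  have [N1 h1] := gd d (e / 2) (divr_gt0 e0 (ltr0Sn _ 1)).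
  have [N2 h2] := gs (e / (8 * (nm d + 1))) (divr_gt0 e0 dd).
  exists (maxn N1 N2)%:R => t t0 Nt; set n := Num.truncn t.
  have : (maxn N1 N2 <= n)%N by rewrite /n truncn_ge_nat.
  rewrite geq_max => /andP[/h1 k1 /h2 k2].
  case: (hP n) => _ _ /(_ _ (trn t t0))[hU hn] _.
  set y := h n (t - n%:R) in hU hn.
  have -> : w t = g n * y by [].
  have k3 : nm (y * d - d * y) <= 2 * (nm (y - 1) * nm d).
    have -> : y * d - d * y = (y - 1) * d - d * (y - 1).
      by rewrite mulrBl mulrBr mul1r mulr1 opprB addrA subrK.
    have := cnmB ((y - 1) * d) (d * (y - 1)); have := nmM (y - 1) d; have := nmM d (y - 1).
    lra.
  have k4 : nm (g n * y * d * star (g n * y) - g n * d * star (g n)) = nm (y * d - d * y).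
    rewrite -(nm_conj_comm _ hU) -[RHS](nm_unitaryl _ (gU n)) -[RHS](nm_unitaryr _ (unitary_star (gU n))).
    by rewrite mulrBr mulrBl starM !mulrA.
  apply: le_lt_trans (cnm_tri (g n * d * star (g n)) _ _) _; rewrite k4.
  have k5 : nm (y - 1) * nm d <= e / 4.
    rewrite v1 in hn.
    have k6 : nm (y - 1) <= 2 * (e / (8 * (nm d + 1))) by lra.
    have -> : e / 4 = 2 * (e / (8 * (nm d + 1))) * (nm d + 1).
      by field; have := nm_ge0 d; lra.
    apply: ler_pM; rewrite ?nm_ge0 //; lra.
  lra.
Qed.

End AsymptoticPath.

Section TwoSidedPath.
Context {R : realType} {D : cstarAlgType R}.
Variables (al be : D -> D) (wa wb : R -> D).
Hypotheses (wa0 : wa 0 = 1) (wb0 : wb 0 = 1).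
Hypothesis waU : forall t, 0 <= t -> unitary (wa t).
Hypothesis wbU : forall t, 0 <= t -> unitary (wb t).
Hypothesis waL : forall s t, 0 <= s -> s <= t -> nm (wa s - wa t) <= t - s.
Hypothesis wbL : forall s t, 0 <= s -> s <= t -> nm (wb s - wb t) <= t - s.
Hypothesis waE : forall d (e : R), 0 < e -> exists M : R, forall t, 0 <= t -> M <= t ->
  nm (wa t * d * star (wa t) - al d) < e.
Hypothesis wbE : forall d (e : R), 0 < e -> exists M : R, forall t, 0 <= t -> M <= t ->
  nm (wb t * d * star (wb t) - be d) < e.

Lemma two_sided_path : exists w : R -> D,
  [/\ forall t, 0 < t < 1 -> unitary (w t),
      forall t, 0 < t < 1 -> {for t, continuous w},
      forall d (e : R), 0 < e -> exists2 r : R, 0 < r & forall t, 0 < t < 1 -> t < r ->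
        nm (w t * d * star (w t) - al d) < e
    & forall d (e : R), 0 < e -> exists2 r : R, 0 < r & forall t, 0 < t < 1 -> 1 - t < r ->
        nm (w t * d * star (w t) - be d) < e].
Proof.
pose V (x : R) := if 0 <= x then wb x else wa (- x).
have VL s t : s <= t -> nm (V s - V t) <= t - s.
  move=> st; rewrite /V; case: (leP 0 s) => s0.
    by rewrite (le_trans s0 st); exact: wbL.
  case: (leP 0 t) => t0; last first.
    by rewrite cnm_sub; apply: le_trans (waL _ _) _; lra.
  apply: le_trans (cnm_tri 1 _ _) _; rewrite cnm_sub -{1}wa0 -wb0.
  have h1 := @waL 0 (- s) (lexx _); have h2 := @wbL 0 t (lexx _) t0.
  have h3 : 0 <= - s by lra.
  have := h1 h3; lra.
have VU x : unitary (V x).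
  by rewrite /V; case: (leP 0 x) => x0; [exact: wbU|apply: waU; lra].
pose th (t : R) := (1 - t)^-1 - t^-1.
have bound (M : R) : exists2 N : R, 0 <= N & M <= N.
  by exists (Num.max M 0); rewrite le_max lexx ?orbT.
have minpos (N : R) : 0 <= N -> 0 < Num.min 2^-1 (N + 3)^-1.
  by move=> N0; rewrite lt_min !invr_gt0 ltr0n /=; lra.
have invs (N t : R) : 0 <= N -> 0 < t -> t < 2^-1 -> t < (N + 3)^-1 ->
    N + 3 < t^-1 /\ (1 - t)^-1 <= 2.
  move=> N0 t0 t2 tN; split.
    by rewrite -[N + 3]invrK ltf_pV2 // posrE invr_gt0; lra.
  by rewrite -[2]invrK lef_pV2 ?posrE ?invr_gt0; lra.
exists (fun t => V (th t)); split.
- by move=> t _; exact: VU.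
- move=> t /andP[t0 t1]; apply/ccontinuous_nmP => e e0.
  have thc : th s @[s --> t] --> th t.
    apply: cvgB; last by apply: cvgV; [rewrite gt_eqF|exact: cvg_id].
    apply: cvgV; first by rewrite gt_eqF // subr_gt0.
    by apply: cvgB; [exact: cvg_cst|exact: cvg_id].
  have /cvgrPdist_lt/(_ e e0) := thc; apply: filterS => s hs.
  case: (leP (th t) (th s)) => ts.
    by apply: le_lt_trans (VL _ _ ts) _; move: hs; rewrite distrC ger0_norm ?subr_ge0.
  rewrite cnm_sub; apply: le_lt_trans (VL _ _ (ltW ts)) _.
  by move: hs; rewrite ger0_norm ?subr_ge0 // ltW.
- move=> d e /(waE d)[M MP]; have [N N0 MN] := bound M.
  exists (Num.min 2^-1 (N + 3)^-1); first exact: minpos.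
  move=> t /andP[t0 t1]; rewrite lt_min => /andP[t2 tN].
  have [h1 h2] := invs _ _ N0 t0 t2 tN.
  have thN : th t < - N by rewrite /th; lra.
  rewrite /V ifF; last by apply/negbTE; rewrite -ltNge; lra.
  by apply: MP; lra.
- move=> d e /(wbE d)[M MP]; have [N N0 MN] := bound M.
  exists (Num.min 2^-1 (N + 3)^-1); first exact: minpos.
  move=> t /andP[t0 t1]; rewrite lt_min => /andP[t2 tN].
  have t10 : 0 < 1 - t by rewrite subr_gt0.
  have [h1] := invs _ _ N0 t10 t2 tN; rewrite subKr => h2.
  have thN : N < th t by rewrite /th; lra.
  rewrite /V ifT; last by lra.
  by apply: MP; lra.
Qed.

End TwoSidedPath.

(** * Homotopies of automorphisms *)

Section AutTopology.
Context {R : realType} {D : cstarAlgType R}.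

Definition aut_fun (a : Aut D) : D -> D := set_val a.

Lemma aut_iso (a : Aut D) : star_iso (aut_fun a).
Proof. by have := set_valP a. Qed.

Lemma aut_of (f : D -> D) : star_iso f -> exists a : Aut D, aut_fun a = f.
Proof. by move=> fi; exists (exist _ (f : {ptws D -> D}) (mem_set fi)). Qed.

Lemma Aut_cvg (T : Type) (F : set_system T) {FF : Filter F} (h : T -> Aut D) (a : Aut D) :
  (forall d, aut_fun (h t) d @[t --> F] --> aut_fun a d) -> h t @[t --> F] --> a.
Proof.
move=> ha A; rewrite /nbhs /= => -[_ [[W oW <-] Wa] WA].
apply: (@filterS _ F _ (h @^-1` (set_val @^-1` W))) => [t|]; first exact: WA.
have hW : {ptws, (fun t => set_val (h t) : {ptws D -> D}) @ F --> (set_val a : {ptws D -> D})}.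
  by apply/pointwise_cvgP => d; exact: ha.
exact: (hW W (open_nbhs_nbhs (conj oW Wa))).
Qed.

Lemma Aut_eval_cvg (T : Type) (F : set_system T) (h : T -> Aut D) (a : Aut D) d :
  h t @[t --> F] --> a -> aut_fun (h t) d @[t --> F] --> aut_fun a d.
Proof.
move=> ha A Ad.
have c1 : {for a, continuous (set_val : Aut D -> {ptws D -> D})}.
  exact: initial_continuous.
have c2 := @proj_continuous D (fun=> D) d (set_val a).
exact: (ha _ (c1 _ (c2 A Ad))).
Qed.

End AutTopology.

Section TensorAutomorphisms.
Context {R : realType} {D : cstarAlgType R}.

Lemma conj_iso (u : D) : unitary u -> star_iso (fun d : D => u * d * star u).
Proof.
move=> uU; have uK := fun x => @unitary_conjK R D u x uU.
split; last first.
  exists (fun d => star u * d * u) => x; first exact: uK.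
  by have := @unitary_conjK R D (star u) x (unitary_star uU); rewrite starK.
split.
- by move=> c x y; rewrite mulrDr mulrDl -scalerAr -scalerAl.
- by move=> x y; rewrite !mulrA -(mulrA _ (star u) u) (proj1 uU) mulr1.
- by move=> x; rewrite !starM starK mulrA.
Qed.

Lemma star_iso_comp (f g : D -> D) : star_iso f -> star_iso g -> star_iso (f \o g).
Proof.
move=> [fh fb] [gh gb]; split; last exact: bij_comp.
split.
- by move=> c x y /=; rewrite (homD gh) (homZ gh) (homD fh) (homZ fh).
- by move=> x y /=; rewrite (homM gh) (homM fh).
- by move=> x /=; rewrite (homS gh) (homS fh).
Qed.

Lemma star_iso_unital (f : D -> D) : star_iso f -> unital_hom f.
Proof.
by move=> [fh [g _ gf]]; split => //; apply: (hom_surj1 fh) => y; exists (g y).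
Qed.

Lemma star_iso_inv (f : D -> D) : star_iso f -> exists g : D -> D,
  [/\ star_iso g, cancel f g & cancel g f].
Proof.
move=> [fh [g fg gf]]; exists g; split => //; split; last by exists f.
exact: bij_hom_inv fh fg gf.
Qed.

Variables (al be : D -> D).
Hypotheses (ah : unital_hom al) (bh : unital_hom be) (comm : commuting al be)
  (dn : tensor_dense al be).
Hypothesis auto_nm : forall f g, star_iso (f : D -> D) -> star_iso (g : D -> D) ->
  forall s, nm (tensor_sum (al \o f) (be \o g) s) = nm (tensor_sum al be s).

Lemma unital_hom_comp (f g : D -> D) : unital_hom f -> unital_hom g -> unital_hom (f \o g).
Proof.
move=> [fh f1] [gh g1]; split; last by rewrite /= g1.
split.
- by move=> c x y /=; rewrite (homD gh) (homZ gh) (homD fh) (homZ fh).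
- by move=> x y /=; rewrite (homM gh) (homM fh).
- by move=> x /=; rewrite (homS gh) (homS fh).
Qed.

Lemma tensor_automorphism (f g : D -> D) : star_iso f -> star_iso g ->
  exists F : D -> D, [/\ star_iso F, forall a, F (al a) = al (f a)
                       & forall b, F (be b) = be (g b)].
Proof.
move=> fi gi.
apply: (tensor_extension ah bh comm dn (al' := al \o f) (be' := be \o g)).
- exact: unital_hom_comp (star_iso_unital fi).
- exact: unital_hom_comp (star_iso_unital gi).
- by move=> a b /=; exact: comm.
- move=> x e /(dn x)[s xs].
  have [f' [_ _ fK]] := star_iso_inv fi; have [g' [_ _ gK]] := star_iso_inv gi.
  exists [seq (f' p.1, g' p.2) | p <- s].
  suff -> : tensor_sum (al \o f) (be \o g) [seq (f' p.1, g' p.2) | p <- s] = tensor_sum al be s by [].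
  by rewrite /tensor_sum big_map; apply: eq_bigr => p _ /=; rewrite fK gK.
- exact: auto_nm.
Qed.

Lemma flip_automorphism : (forall s, nm (tensor_sum be al s) = nm (tensor_sum al be s)) ->
  exists sg : D -> D, [/\ star_iso sg, forall a, sg (al a) = be a & forall b, sg (be b) = al b].
Proof.
move=> flip_nm; apply: (tensor_extension ah bh comm dn) => //.
move=> x e /(dn x)[s xs]; exists [seq (p.2, p.1) | p <- s].
suff -> : tensor_sum be al [seq (p.2, p.1) | p <- s] = tensor_sum al be s by [].
by rewrite /tensor_sum big_map; apply: eq_bigr => p _ /=; rewrite comm.
Qed.

Lemma tensor_automorphism_continuous (T : Type) (Fi : set_system T) {FF : Filter Fi}
    (f g : T -> D -> D) (F : T -> D -> D) f0 g0 F0 (d : D) :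
  (forall t, [/\ star_iso (F t), forall a, F t (al a) = al (f t a)
                       & forall b, F t (be b) = be (g t b)]) ->
  [/\ star_iso F0, forall a, F0 (al a) = al (f0 a) & forall b, F0 (be b) = be (g0 b)] ->
  (forall a, f t a @[t --> Fi] --> f0 a) -> (forall a, g t a @[t --> Fi] --> g0 a) ->
  F t d @[t --> Fi] --> F0 d.
Proof.
move=> FP [F0i F0a F0b] fc gc; apply/ccvg_nmP => e e0.
have e4 : 0 < e / 4 by rewrite divr_gt0.
have [s ds] := dn d e4.
have sumE (G : D -> D) f1 g1 : star_iso G -> (forall a, G (al a) = al (f1 a)) ->
    (forall b, G (be b) = be (g1 b)) ->
    G (tensor_sum al be s) = \sum_(p <- s) al (f1 p.1) * be (g1 p.2).
  move=> [Gh _] Ga Gb; rewrite /tensor_sum (hom_sum Gh); apply: eq_bigr => p _.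
  by rewrite (homM Gh) Ga Gb.
have homc (ga : D -> D) (k : T -> D) k0 : unital_hom ga ->
    k t @[t --> Fi] --> k0 -> ga (k t) @[t --> Fi] --> ga k0.
  move=> [gh g1] /ccvg_nmP kc; apply/ccvg_nmP => r /kc; apply: filterS => t.
  by rewrite -(homB gh); apply: le_lt_trans; exact: hom_contr.
have : F t (tensor_sum al be s) @[t --> Fi] --> F0 (tensor_sum al be s).
  rewrite (sumE _ _ _ F0i F0a F0b).
  have -> : (fun t => F t (tensor_sum al be s)) =
            (fun t => \sum_(p <- s) al (f t p.1) * be (g t p.2)).
    by apply/funext => t; have [Fi' Fa Fb] := FP t; exact: sumE.
  apply: cvg_big => [|p _]; first exact: add_continuous.
  by apply: cvg_mul; apply: homc.
move=> /ccvg_nmP/(_ _ e4); apply: filterS => t ht.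
have [Fti _ _] := FP t.
have h1 : nm (F0 d - F0 (tensor_sum al be s)) = nm (d - tensor_sum al be s).
  by rewrite -(homB (proj1 F0i)); exact: star_iso_nm.
have h2 : nm (F t d - F t (tensor_sum al be s)) = nm (d - tensor_sum al be s).
  by rewrite -(homB (proj1 Fti)); exact: star_iso_nm.
have := cnm_tri (F0 (tensor_sum al be s)) (F0 d) (F t d).
have := cnm_tri (F t (tensor_sum al be s)) (F0 (tensor_sum al be s)) (F t d).
rewrite [nm (F t (tensor_sum al be s) - F t d)]cnm_sub; lra.
Qed.

End TensorAutomorphisms.

Section Homotopies.
Context {R : realType} {D : cstarAlgType R} {X : topologicalType}.
Variables (al be : D -> D) (w : R -> D).
Hypotheses (ah : unital_hom al) (bh : unital_hom be) (comm : commuting al be)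
  (dn : tensor_dense al be).
Hypothesis auto_nm : forall f g, star_iso (f : D -> D) -> star_iso (g : D -> D) ->
  forall s, nm (tensor_sum (al \o f) (be \o g) s) = nm (tensor_sum al be s).
Hypothesis wU : forall t, 0 < t < 1 -> unitary (w t).
Hypothesis wc : forall t, 0 < t < 1 -> {for t, continuous w}.
Hypothesis w_al : forall d (e : R), 0 < e -> exists2 r : R, 0 < r &
  forall t, 0 < t < 1 -> t < r -> nm (w t * d * star (w t) - al d) < e.
Hypothesis w_be : forall d (e : R), 0 < e -> exists2 r : R, 0 < r &
  forall t, 0 < t < 1 -> 1 - t < r -> nm (w t * d * star (w t) - be d) < e.

Lemma conj_estimate (ga k k0 F : D -> D) (u d : D) (e : R) :
  unital_hom ga -> star_iso F -> (forall a, F (ga a) = ga (k a)) -> unitary u ->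
  nm (u * d * star u - ga d) < e -> nm (u * k0 d * star u - ga (k0 d)) < e ->
  nm (k0 d - k d) < e ->
  nm (k0 d - star u * F (u * d * star u) * u) < 3 * e.
Proof.
move=> [gh g1] Fi Fga uU h1 h2 h3.
rewrite -(nm_unitaryl _ uU) -(nm_unitaryr _ (unitary_star uU)) mulrBr mulrBl.
have -> : u * (star u * F (u * d * star u) * u) * star u = F (u * d * star u).
  by have := @unitary_conjK R D (star u) (F (u * d * star u)) (unitary_star uU); rewrite starK.
apply: le_lt_trans (cnm_tri (ga (k0 d)) _ _) _.
have := cnm_tri (ga (k d)) (ga (k0 d)) (F (u * d * star u)).
have : nm (ga (k0 d) - ga (k d)) <= nm (k0 d - k d) by rewrite -(homB gh); exact: hom_contr.
have : nm (ga (k d) - F (u * d * star u)) = nm (u * d * star u - ga d).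
  by rewrite -Fga -(homB (proj1 Fi)) cnm_sub star_iso_nm // cnm_sub.
lra.
Qed.

(* [Ad (w_t^* ) o (f_x (x) g_x) o Ad w_t] runs from [f_x] to [g_x]. *)
Lemma automorphism_homotopic (f g : continuousType X (Aut D)) : homotopic R f g.
Proof.
have /choice[F FP] := fun x => tensor_automorphism ah bh comm dn auto_nm
  (aut_iso (f x)) (aut_iso (g x)).
have HP (z : R * X) : exists a : Aut D,
    [/\ 0 < z.1 < 1 -> forall d,
          aut_fun a d = star (w z.1) * F z.2 (w z.1 * d * star (w z.1)) * w z.1,
        z.1 <= 0 -> a = f z.2 & 1 <= z.1 -> a = g z.2].
  have [z0|z0] := leP z.1 0.
    by exists (f z.2); split => // h; exfalso; lra.
  have [z1|z1] := leP 1 z.1.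
    by exists (g z.2); split => // h; exfalso; lra.
  have z01 : 0 < z.1 < 1 by rewrite z0.
  have [Fi _ _] := FP z.2; have wzU := wU z01.
  have [a aE] := aut_of (star_iso_comp (conj_iso (unitary_star wzU))
                          (star_iso_comp Fi (conj_iso wzU))).
  exists a; split => [_ d|h|h]; [by rewrite aE /= starK|exfalso; lra|exfalso; lra].
have /choice[H HE] := HP.
exists H; split; last 2 first.
- by move=> x; have [_ h _] := HE (0, x); apply: h.
- by move=> x; have [_ _ h] := HE (1, x); apply: h.
apply/subspace_continuousP => -[t0 x0] [/= + _]; rewrite in_itv /= => /andP[t00 t01].
set A := _ `*` _; apply: Aut_cvg => d.
pose Phi := within A (nbhs (t0, x0)).
have t_cvg : z.1 @[z --> Phi] --> t0.
  by apply: cvg_trans (cvg_fst (G := nbhs x0)); exact: cvg_fmap2 (cvg_within _).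
have t_near (P : set R) : nbhs t0 P -> \forall z \near Phi, P z.1 by exact: t_cvg.
have x_cvg : z.2 @[z --> Phi] --> x0.
  by apply: cvg_trans (cvg_snd (F := nbhs t0)); exact: cvg_fmap2 (cvg_within _).
have f_cvg a : aut_fun (f z.2) a @[z --> Phi] --> aut_fun (f x0) a.
  apply: Aut_eval_cvg; apply: cvg_comp x_cvg _; exact: (@cts_fun _ _ f x0).
have g_cvg a : aut_fun (g z.2) a @[z --> Phi] --> aut_fun (g x0) a.
  apply: Aut_eval_cvg; apply: cvg_comp x_cvg _; exact: (@cts_fun _ _ g x0).
have in01 : \forall z \near Phi, 0 <= z.1 <= 1.
  rewrite near_withinE; apply: nearW => -[s y] [/= + _]; by rewrite in_itv.
apply/ccvg_nmP => e e0; rewrite /from_subspace.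
have e3 : 0 < e / 3 by rewrite divr_gt0.
have [t0z|t0p] := leP t0 0.
  have [_ -> // _] := HE (t0, x0).
  have [r1 r10 r1P] := w_al d e3; have [r2 r20 r2P] := w_al (aut_fun (f x0) d) e3.
  have tr : \forall z \near Phi, z.1 < Num.min 1 (Num.min r1 r2).
    apply: (t_near [set s | s < _]); apply: lt_nbhsl.
    by rewrite !lt_min; apply/and3P; split; lra.
  have /ccvg_nmP/(_ _ e3) := f_cvg d.
  apply: filterS3 tr in01 => -[s y] /=; rewrite !lt_min => /and3P[s1 sr1 sr2] /andP[s0 _] fs.
  have [h1 h2 _] := HE (s, y).
  have [s0'|s0'] := leP s 0; first by rewrite h2 //=; apply: lt_trans fs _; lra.
  have s01 : 0 < s < 1 by rewrite s0'.
  rewrite (h1 s01) /=; have [Fi Fa _] := FP y.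
  have -> : e = 3 * (e / 3) by field.
  exact: conj_estimate ah Fi Fa (wU s01) (r1P _ s01 sr1) (r2P _ s01 sr2) fs.
have [t1z|t1p] := leP 1 t0.
  have [_ _ -> //] := HE (t0, x0).
  have [r1 r10 r1P] := w_be d e3; have [r2 r20 r2P] := w_be (aut_fun (g x0) d) e3.
  have tr : \forall z \near Phi, Num.max 0 (Num.max (1 - r1) (1 - r2)) < z.1.
    apply: (t_near [set s | _ < s]); apply: lt_nbhsr.
    by rewrite !gt_max; apply/and3P; split; lra.
  have /ccvg_nmP/(_ _ e3) := g_cvg d.
  apply: filterS3 tr in01 => -[s y] /=; rewrite !gt_max => /and3P[s0 sr1 sr2] /andP[_ s1] gs.
  have [h1 _ h2] := HE (s, y).
  have [s1'|s1'] := leP 1 s; first by rewrite h2 //=; apply: lt_trans gs _; lra.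
  have s01 : 0 < s < 1 by rewrite s0.
  rewrite (h1 s01) /=; have [Fi _ Fb] := FP y.
  have -> : e = 3 * (e / 3) by field.
  by apply: conj_estimate bh Fi Fb (wU s01) (r1P _ s01 _) (r2P _ s01 _) gs; lra.
have t01' : 0 < t0 < 1 by rewrite t0p.
have w_cvg : w z.1 @[z --> Phi] --> w t0 by apply: cvg_comp t_cvg _; exact: wc.
have ws_cvg : star (w z.1) @[z --> Phi] --> star (w t0) by exact: cvg_star.
have y_cvg : w z.1 * d * star (w z.1) @[z --> Phi] --> w t0 * d * star (w t0).
  by apply: cvg_mul => //; apply: cvg_mul => //; exact: cvg_cst.
have F_cvg : F z.2 (w z.1 * d * star (w z.1)) @[z --> Phi] -->
    F x0 (w t0 * d * star (w t0)).
  have e2 (r : R) : 0 < r -> 0 < r / 2 by move=> r0; rewrite divr_gt0.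
  apply/ccvg_nmP => r /e2 r0.
  have /ccvg_nmP/(_ _ r0) := y_cvg.
  have : F z.2 (w t0 * d * star (w t0)) @[z --> Phi] --> F x0 (w t0 * d * star (w t0)).
    apply: (tensor_automorphism_continuous ah bh dn (F := fun z : R * X => F z.2)
      (f := fun z => aut_fun (f z.2)) (g := fun z => aut_fun (g z.2)) 
      (fun z => FP z.2) (FP x0) f_cvg g_cvg).
  move=> /ccvg_nmP/(_ _ r0).
  apply: filterS2 => z h1 h2; have [Fi _ _] := FP z.2.
  have := cnm_tri (F z.2 (w t0 * d * star (w t0))) (F x0 (w t0 * d * star (w t0)))
    (F z.2 (w z.1 * d * star (w z.1))).
  rewrite -[X in _ + nm X](homB (proj1 Fi)) (star_iso_nm _ Fi); lra.
have : star (w z.1) * F z.2 (w z.1 * d * star (w z.1)) * w z.1 @[z --> Phi] -->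
    star (w t0) * F x0 (w t0 * d * star (w t0)) * w t0.
  by apply: cvg_mul w_cvg; exact: cvg_mul.
move=> /ccvg_nmP/(_ _ e0).
have tr : \forall z \near Phi, 0 < z.1 < 1.
  have h0 : \forall z \near Phi, 0 < z.1 by apply: (t_near [set s | _ < s]); exact: lt_nbhsr.
  have h1 : \forall z \near Phi, z.1 < 1 by apply: (t_near [set s | s < _]); exact: lt_nbhsl.
  by apply: filterS2 h0 h1 => z -> ->.
apply: filterS2 tr => z z01.
have [h1 _ _] := HE z; have [h2 _ _] := HE (t0, x0).
by rewrite /= (h1 z01) (h2 t01').
Qed.

End Homotopies.

Theorem corollary3p1 (R : realType) (D : cstarAlgType R) :
  separable D -> strongly_self_absorbing D -> K1_injective D ->
  forall X : topologicalType, hausdorff_space X -> compact [set: X] ->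
  exists c, homotopy_classes R X (Aut D) = [set c].
Proof.
move=> sep ssa inj X _ _.
have [al [be [ah bh comm dn [flip_nm auto_nm ial]]]] := self_absorbing_embeddings ssa.
have [sg [sgi sga sgb]] := flip_automorphism ah bh comm dn flip_nm.
have idi : star_iso (@id D) by split; [split|exists id].
have [F [Fi Fa Fb]] := tensor_automorphism ah bh comm dn auto_nm sgi idi.
have ibe := second_embedding_inner (star_iso_unital Fi) ial sgb Fa Fb.
have comm' : commuting be al by move=> a b; rewrite comm.
have path ga : unital_hom ga -> (forall (G : seq D) (e : R), 0 < e ->
     exists2 u, unitary0 u & forall d, d \in G -> nm (u * d * star u - ga d) < e) ->
   exists w : R -> D, [/\ w 0 = 1, forall t, 0 <= t -> unitary (w t),
    forall s t, 0 <= s -> s <= t -> nm (w s - w t) <= t - s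
    & forall d (e : R), 0 < e -> exists M : R, forall t, 0 <= t -> M <= t ->
        nm (w t * d * star (w t) - ga d) < e].
  move=> gh gin.
  have [g [g0 gU gl gs gd]] := unitary_sequence sep gh gin (basic_homotopy ah bh comm dn ial ibe).
  exact: unitary_path g0 gU gl gs gd.
have [wa [wa0 waU waL waE]] := path al ah (approx_unitary0 inj bh comm ial ibe).
have [wb [wb0 wbU wbL wbE]] := path be bh (approx_unitary0 inj ah comm' ibe ial).
have [w [wU wc w_al w_be]] := two_sided_path wa0 wb0 waU wbU waL wbL waE wbE.
have hom := automorphism_homotopic ah bh comm dn auto_nm wU wc w_al w_be.
have [a _] := aut_of idi.
have a_cont : continuous (fun _ : X => a) by move=> x; exact: cvg_cst.
pose f0 : continuousType X (Aut D) := HB.pack (fun _ : X => a) (isContinuous.Build X (Aut D) (fun _ => a) a_cont).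
exists setT; apply/seteqP; split => c.
  by move=> [f _ <-] /=; apply/seteqP; split => // g _; exact: hom.
by move=> ->; exists f0 => //; apply/seteqP; split => // g _; exact: hom.
Qed.
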